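(* Let $d\ge 1$, let $H_0,H_1,\dots,H_d\in(\frac12,1)$ satisfy $2H_0+\sum_{i=1}^d H_i>d+1$, and fix $t>0$ and $x\in\mathbb{R}^d$. Then, for every $\varepsilon>0$ and $\delta>0$, the random function $A^{\varepsilon,\delta}_{t,x}$ belongs to $\mathcal{H}$ almost surely, and the family of random variables $V^{\varepsilon,\delta}_{t,x}=W(A^{\varepsilon,\delta}_{t,x})$ converges in $L^2$, as $\varepsilon\downarrow 0$ and $\delta\downarrow 0$, to a limit denoted $$V_{t,x}=\int_0^t\int_{\mathbb{R}^d}\delta(B^x_{t-r}-y)\,W(dr,dy).$$ Moreover, conditionally on $B$, $V_{t,x}$ is a Gaussian random variable with mean $0$ and variance $$\operatorname{Var}^W(V_{t,x})=\alpha_H\int_0^t\int_0^t|r-s|^{2H_0-2}\prod_{i=1}^d|B^i_r-B^i_s|^{2H_i-2}\,dr\,ds .$$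
   Context: $W=\{W(t,x):t\ge0,x\in\mathbb{R}^d\}$ is a zero-mean Gaussian random field (fractional Brownian sheet) with covariance $E(W(t,x)W(s,y))=R_{H_0}(s,t)\prod_{i=1}^dR_{H_i}(x_i,y_i)$, where $R_H(s,t)=\frac12(|t|^{2H}+|s|^{2H}-|t-s|^{2H})$. Set $\alpha_H=\prod_{i=0}^dH_i(2H_i-1)$. $\mathcal{H}$ is the Hilbert space obtained by completing the linear span of the indicators of rectangles $(s,t]\times(x,y]\subset\mathbb{R}_+\times\mathbb{R}^d$ for the inner product $$\langle\phi,\psi\rangle_{\mathcal{H}}=\alpha_H\int_{\mathbb{R}_+^2\times\mathbb{R}^{2d}}\phi(s,x)\psi(t,y)|s-t|^{2H_0-2}\prod_{i=1}^d|x_i-y_i|^{2H_i-2}\,ds\,dt\,dx\,dy;$$ it contains every measurable $\phi$ for which this integral with $\phi=\psi$ replaced by $|\phi|$ is finite (with the same formula for the inner product). The map sending the indicator of a rectangle to the rectangular increment of $W$ over it extends to a linear isometry $\phi\mapsto W(\phi)=\int_0^\infty\int_{\mathbb{R}^d}\phi(t,x)W(dt,dx)$ from $\mathcal{H}$ into $L^2$. $B=(B^1,\dots,B^d)$ is a standard $d$-dimensional Brownian motion started at $0$, independent of $W$, and $B^x_t=B_t+x$. Let $p_\varepsilon(x)=(2\pi\varepsilon)^{-d/2}e^{-|x|^2/(2\varepsilon)}$ and $\varphi_\delta(r)=\frac1\delta I_{[0,\delta]}(r)$. For $r\in[0,t]$, $y\in\mathbb{R}^d$, $$A^{\varepsilon,\delta}_{t,x}(r,y)=\int_0^t\varphi_\delta(t-s-r)\,p_\varepsilon(B^x_s-y)\,ds,\qquad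 V^{\varepsilon,\delta}_{t,x}=\int_0^t\int_{\mathbb{R}^d}A^{\varepsilon,\delta}_{t,x}(r,y)\,W(dr,dy),$$ where the integral with respect to $W$ is taken for fixed $B$ ($A^{\varepsilon,\delta}_{t,x}$ is extended by $0$ for $r>t$). $L^2$ refers to the joint probability space of $(W,B)$, and $\operatorname{Var}^W$ is the variance with respect to $W$ for fixed $B$. *)

(* Defs.v *)
From HB Require Import structures.
From mathcomp Require Import all_boot all_order all_algebra.
From mathcomp Require Import all_classical all_reals all_analysis.

Set Implicit Arguments.
Unset Strict Implicit.
Unset Printing Implicit Defensive.
Import Order.TTheory GRing.Theory Num.Theory.
Import numFieldNormedType.Exports.

Local Open Scope classical_set_scope.
Local Open Scope ring_scope.

(** * Lebesgue measure on R^n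

  R^n is the measurable type [n.-tuple R] (the sigma-algebra generated by the
  coordinates); the library has no Lebesgue measure on it, so it is built by
  induction as the image of a product measure on R * R^n. *)


(* The library's sigma-finite instance on [m1 \x m2] is only found when the
   factors are subprobabilities; [prodm] is the same measure, with an instance
   for sigma-finite factors. *)
Section prodm.
Context d1 d2 (T1 : measurableType d1) (T2 : measurableType d2) (R : realType).
Variables (m1 : {sigma_finite_measure set T1 -> \bar R})
          (m2 : {sigma_finite_measure set T2 -> \bar R}).

Definition prodm : set (T1 * T2) -> \bar R := (m1 \x m2)%E.

HB.instance Definition _ := Measure.on prodm.

Let prodm_sigma_finite : sigma_finite setT prodm.
Proof.
have /sigma_finiteP[F [TF ndF Foo]] := sigma_finiteT m1.
have /sigma_finiteP[G [TG ndG Goo]] := sigma_finiteT m2.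
exists (fun n => F n `*` G n).
  rewrite -setXTT TF TG predeqE => -[x y]; split.
    move=> [/= [n _ Fnx] [k _ Gky]]; exists (maxn n k) => //; split.
    - by move: x Fnx; exact/subsetPset/ndF/leq_maxl.
    - by move: y Gky; exact/subsetPset/ndG/leq_maxr.
  by move=> [n _ []/= ? ?]; split; exists n.
move=> k; have [mF Fk] := Foo k; have [mG Gk] := Goo k.
split; first exact: measurableX.
by rewrite /prodm product_measure1E// lte_mul_pinfty// ge0_fin_numE.
Qed.

HB.instance Definition _ := Measure_isSigmaFinite.Build _ _ _ prodm
  prodm_sigma_finite.

End prodm.

Section lebesgue_cons.
Context {R : realType} (n : nat).
Variable m : {sigma_finite_measure set (n.-tuple R) -> \bar R}.

Definition tuple_cons (p : R * n.-tuple R) : n.+1.-tuple R :=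
  [the n.+1.-tuple R of p.1 :: p.2].

Definition tuple_uncons (v : n.+1.-tuple R) : R * n.-tuple R :=
  (thead v, [tuple of behead v]).

Lemma tuple_consK : cancel tuple_cons tuple_uncons.
Proof.
by move=> [a v]; congr pair; exact/val_inj.
Qed.

Lemma measurable_tuple_cons : measurable_fun [set: R * n.-tuple R] tuple_cons.
Proof. exact: measurable_cons. Qed.

Lemma measurable_tuple_uncons : measurable_fun [set: n.+1.-tuple R] tuple_uncons.
Proof.
apply: measurable_fun_pair; first exact: measurable_tnth.
exact: measurable_behead.
Qed.

Definition lebesgue_cons : set (n.+1.-tuple R) -> \bar R :=
  pushforward (prodm (@lebesgue_measure R) m) tuple_cons.

Let lebesgue_cons0 : lebesgue_cons set0 = 0%E.
Proof. by rewrite /lebesgue_cons /pushforward preimage_set0 measure0. Qed.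

Let lebesgue_cons_ge0 A : (0 <= lebesgue_cons A)%E.
Proof. by rewrite /lebesgue_cons /pushforward measure_ge0. Qed.

Let lebesgue_cons_sigma_additive : semi_sigma_additive lebesgue_cons.
Proof.
move=> F mF tF mUF; rewrite /lebesgue_cons /pushforward preimage_bigcup.
apply: measure_semi_sigma_additive.
- by move=> i; rewrite -[X in measurable X]setTI; exact: measurable_tuple_cons.
- apply/trivIsetP => /= i j _ _ ij; rewrite -preimage_setI.
  by move/trivIsetP : tF => /(_ _ _ _ _ ij) ->//; rewrite preimage_set0.
- rewrite -preimage_bigcup -[X in measurable X]setTI.
  exact: measurable_tuple_cons.
Qed.

HB.instance Definition _ := isMeasure.Build _ _ _ lebesgue_cons
  lebesgue_cons0 lebesgue_cons_ge0 lebesgue_cons_sigma_additive.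

Let lebesgue_cons_sigma_finite : sigma_finite setT lebesgue_cons.
Proof.
have [F FT Foo] := sigma_finiteT (prodm (@lebesgue_measure R) m).
exists (fun i => tuple_uncons @^-1` F i).
  by rewrite -preimage_bigcup -FT preimage_setT.
move=> i; have [mF Fioo] := Foo i; split.
  by rewrite -[X in measurable X]setTI; exact: measurable_tuple_uncons.
rewrite /lebesgue_cons /pushforward -comp_preimage.
suff -> : (tuple_uncons \o tuple_cons) @^-1` F i = F i by [].
by apply/seteqP; split=> p /=; rewrite tuple_consK.
Qed.

HB.instance Definition _ := Measure_isSigmaFinite.Build _ _ _ lebesgue_cons
  lebesgue_cons_sigma_finite.

End lebesgue_cons.

Fixpoint lebesgue_tuple (R : realType) (n : nat) :
    {sigma_finite_measure set (n.-tuple R) -> \bar R} :=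
  match n with
  | 0 => dirac (nil_tuple R)
  | n'.+1 => lebesgue_cons (lebesgue_tuple R n')
  end.

Definition lebesgue_spacetime (R : realType) (d : nat) :
    {sigma_finite_measure set (measurableTypeR R * d.-tuple R)%type -> \bar R} :=
  prodm (@lebesgue_measure R) (lebesgue_tuple R d).

Lemma lebesgue_tuple_box (R : realType) (n : nat) (A : 'I_n -> set R) :
  (forall i, measurable (A i)) ->
  lebesgue_tuple R n [set v | forall i, A i (tnth v i)] =
  (\prod_(i < n) @lebesgue_measure R (A i))%E.
Proof.
elim: n A => [|n IH] A mA.
  rewrite big_ord0 /= diracE (_ : _ \in _)//.
  by rewrite inE => -[].
have mA' : measurable [set v : n.-tuple R | forall i, A (lift ord0 i) (tnth v i)].
  rewrite (_ : [set v | _] =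
      \bigcap_(i in setT) (@tnth n R ^~ i @^-1` A (lift ord0 i))).
    apply: fin_bigcap_measurable => [|i _]; first exact: finite_finset.
    by rewrite -[X in measurable X]setTI; exact: measurable_tnth.
  by apply/seteqP; split=> v /= h i => [_|]; apply: h.
rewrite big_ord_recl -IH//= /lebesgue_cons /pushforward /prodm.
rewrite -product_measure1E//=; last exact: (mA ord0).
congr (product_measure1 _ _ _); apply/seteqP; split=> -[a v] /=.
  by move=> h; split=> [|i]; [exact: (h ord0)|rewrite -(tnthS a v); exact: h].
move=> [a0 h] i; case: (unliftP ord0 i) => [j ->|-> //].
by rewrite tnthS; exact: h.
Qed.

(** * Gaussian laws, independence *)

(* [normal_prob m s] is parameterized by the standard deviation and is not a
   Dirac mass when [s = 0], hence the case split. *)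
Definition gaussian_law (R : realType) (m v : R) (A : set R) : \bar R :=
  if v == 0 then \d_m A else normal_prob m (Num.sqrt v) A.

Section probability_notions.
Context d (T : measurableType d) (R : realType) (P : probability T R).

Definition is_gaussian (X : T -> R) (m v : R) : Prop :=
  [/\ measurable_fun [set: T] X, 0 <= v &
      forall A : set R, measurable A -> P (X @^-1` A) = gaussian_law m v A].

Definition mutually_independent (I : finType) (X : I -> T -> R) : Prop :=
  forall A : I -> set R, (forall i, measurable (A i)) ->
    P [set w | forall i, A i (X i w)] = (\prod_(i : I) P (X i @^-1` A i))%E.

(* Standard [n]-dimensional Brownian motion started at 0; only times [s >= 0]
   are meaningful. *)
Record standard_brownian_motion (n : nat) (B : 'I_n -> R -> {RV P >-> R}) :
    Prop := {
  bm_start : {ae P, forall w, forall i, B i 0 w = 0};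
  bm_increments : forall i s t, 0 <= s -> s <= t ->
    is_gaussian (fun w => B i t w - B i s w) 0 (t - s);
  bm_independent_increments : forall (k : nat) (u : nat -> R),
    0 <= u 0%N -> (forall j, u j <= u j.+1) ->
    mutually_independent (fun (p : 'I_n * 'I_k) w =>
      B p.1 (u p.2.+1) w - B p.1 (u p.2) w);
  bm_continuous : {ae P, forall w, forall i,
    {within `[0, +oo[, continuous (fun s => B i s w)}}
}.

End probability_notions.

(** * Fractional Brownian sheet and its Wiener integral *)

Section fractional_sheet.
Context {R : realType} (d : nat).
(* Hurst parameters: [H0] in time, [H i] in the i-th space direction. *)
Variables (H0 : R) (H : 'I_d -> R).

Definition fbm_cov (h s t : R) : R :=
  2^-1 * (`|t| `^ (2 * h) + `|s| `^ (2 * h) - `|t - s| `^ (2 * h)).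

Definition alphaH : R :=
  H0 * (2 * H0 - 1) * \prod_(i < d) (H i * (2 * H i - 1)).

(* Points of R x R^d, the first coordinate being the time. *)
Local Notation spacetime := (measurableTypeR R * d.-tuple R)%type.

(* R_+ x R^d *)
Definition halfspace : set spacetime := [set p | 0 <= p.1].

(* [0 `^ a = 0] for [a < 0] whereas the kernel is infinite when coordinates
   coincide; this only happens on a Lebesgue-null set. *)
Definition kernelH (p q : spacetime) : R :=
  `|p.1 - q.1| `^ (2 * H0 - 2) *
  \prod_(i < d) `|tnth p.2 i - tnth q.2 i| `^ (2 * H i - 2).

Definition innerH (phi psi : spacetime -> R) : R :=
  alphaH * \int[prodm (lebesgue_spacetime R d) (lebesgue_spacetime R d)]_(
    pq in halfspace `*` halfspace)
      (phi pq.1 * psi pq.2 * kernelH pq.1 pq.2).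

Definition finite_energy (phi : spacetime -> R) : Prop :=
  measurable_fun halfspace phi /\
  (\int[prodm (lebesgue_spacetime R d) (lebesgue_spacetime R d)]_(
    pq in halfspace `*` halfspace)
      (`|phi pq.1| * `|phi pq.2| * kernelH pq.1 pq.2)%:E < +oo)%E.

(* The rectangle (rs, rt] x (rx, ry] of R_+ x R^d. *)
Record rectangle := Rectangle {
  rs : R;
  rt : R;
  rx : d.-tuple R;
  ry : d.-tuple R;
  rs_ge0 : 0 <= rs;
  rs_le_rt : rs <= rt;
  rx_le_ry : forall i, tnth rx i <= tnth ry i
}.

Definition rect_set (r : rectangle) : set spacetime :=
  [set p | rs r < p.1 <= rt r /\
           forall i, tnth (rx r) i < tnth p.2 i <= tnth (ry r) i].

Definition corner (r : rectangle) (S : {set 'I_d}) : d.-tuple R :=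
  [tuple (if i \in S then tnth (ry r) i else tnth (rx r) i) | i < d].

(* Elements of the linear span of the indicators of rectangles, given by a
   list of coefficients and rectangles. *)
Definition step := seq (R * rectangle).

Definition step_fun (f : step) (p : spacetime) : R :=
  \sum_(cr <- f) cr.1 * \1_(rect_set cr.2) p.

(* A function [phi] represents the element of the completion of the step
   functions that is the class of the Cauchy sequence [u]. *)
Definition cvg_calH (u : nat -> step) (phi : spacetime -> R) : Prop :=
  innerH (fun p => step_fun (u n) p - phi p)
         (fun p => step_fun (u n) p - phi p) @[n --> \oo] --> 0.

(* Membership in the Hilbert space H of an actual function. *)
Definition in_calH (phi : spacetime -> R) : Prop :=
  finite_energy phi /\ exists u, cvg_calH u phi.

Section integral.
Context dO (Omega : measurableType dO) (P : probability Omega R).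
Variable W : R -> d.-tuple R -> {RV P >-> R}.

Record fractional_brownian_sheet : Prop := {
  fbs_gaussian : forall (n : nat) (c t : 'I_n -> R) (x : 'I_n -> d.-tuple R),
    (forall k, 0 <= t k) ->
    exists v, is_gaussian P (fun w => \sum_(k < n) c k * W (t k) (x k) w) 0 v;
  fbs_cov : forall t s (x y : d.-tuple R), 0 <= t -> 0 <= s ->
    ('E_P[(W t x \* W s y)%R] =
     (fbm_cov H0 s t * \prod_(i < d) fbm_cov (H i) (tnth x i) (tnth y i))%:E)%E
}.

(* Rectangular increment over (s, t] x (x, y]: the signed sum over the corners,
   [S] being the set of space directions where the upper bound is taken. *)
Definition increment (r : rectangle) (w : Omega) : R :=
  \sum_(S : {set 'I_d}) (-1) ^+ #|~: S| *
    (W (rt r) (corner r S) w - W (rs r) (corner r S) w).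

Definition step_integral (f : step) (w : Omega) : R :=
  \sum_(cr <- f) cr.1 * increment cr.2 w.

(* [X] is a version of [W(phi)]: the isometry defined on step functions is
   extended to H by density. *)
Definition is_wiener_integral (phi : spacetime -> R) (X : Omega -> R) : Prop :=
  [/\ in_calH phi, X \in Lfun P 2%:E &
      exists2 u : nat -> step, cvg_calH u phi &
        'N[P]_2%:E[EFin \o (step_integral (u n) \- X)%R]%E
          @[n --> \oo] --> 0%E].

End integral.
End fractional_sheet.

(** * The approximating random functions *)

Section approximation.
Context {R : realType} (d : nat).

(* p_eps *)
Definition heat_kernel (eps : R) (z : d.-tuple R) : R :=
  (2 * pi * eps) `^ (- (d%:R / 2)) *
  expR (- (\sum_(i < d) tnth z i ^+ 2) / (2 * eps)).

(* phi_delta *)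
Definition box_kernel (delta r : R) : R := delta^-1 * \1_(`[0, delta]) r.

(* A^{eps,delta}_{t,x}(r,y) at [p = (r,y)] for the path [b], extended by 0 outside [0,t]. *)
Definition approx_fun (b : 'I_d -> R -> R) (t : R) (x : d.-tuple R)
    (eps delta : R) (p : measurableTypeR R * d.-tuple R) : R :=
  if 0 <= p.1 <= t then
    \int[lebesgue_measure]_(s in `[0, t])
      (box_kernel delta (t - s - p.1) *
       heat_kernel eps [tuple b i s + tnth x i - tnth p.2 i | i < d])
  else 0.

Section version.
Context dW dB (OmegaW : measurableType dW) (OmegaB : measurableType dB).
Context (PW : probability OmegaW R) (PB : probability OmegaB R).
Variables (H0 : R) (H : 'I_d -> R).
Variables (W : R -> d.-tuple R -> {RV PW >-> R}) (B : 'I_d -> R -> {RV PB >-> R}).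

Definition A_fun (t : R) (x : d.-tuple R) (eps delta : R) (wB : OmegaB) :=
  approx_fun (fun i s => B i s wB) t x eps delta.

(* [V] is the random variable V^{eps,delta}_{t,x} on the joint space: a jointly
   measurable function which, for almost every fixed path of [B], is a version
   of the Wiener integral of A^{eps,delta}_{t,x} with respect to [W]. *)
Definition is_V_approx (t : R) (x : d.-tuple R) (eps delta : R)
    (V : OmegaW * OmegaB -> R) : Prop :=
  measurable_fun [set: OmegaW * OmegaB] V /\
  {ae PB, forall wB,
    is_wiener_integral H0 H W (A_fun t x eps delta wB) (fun wW => V (wW, wB))}.

Definition cond_variance (t : R) (wB : OmegaB) : \bar R :=
  ((alphaH H0 H)%:E *
   \int[lebesgue_measure]_(r in `[0%R, t]) \int[lebesgue_measure]_(s in `[0%R, t])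
     (`|r - s| `^ (2 * H0 - 2) *
      \prod_(i < d) `|B i r wB - B i s wB| `^ (2 * H i - 2))%R%:E)%E.

End version.
End approximation.

(* Main.v *)
(** For a fixed path of [B], the inner product of [A^{eps,delta}] and
  [A^{eps',delta'}] is [alpha_H] times the integral over [(r, s)] in [[0, t]^2]
  of a product of one-dimensional double integrals
  [\int \int q1 q2 |x - y|^(2 h - 2)], where [q1], [q2] are the regularizing
  kernels centered at [t - r], [t - s] (time) or at [B^i_r], [B^i_s] (space).
  Each factor is at most a constant, independent of [eps, delta], times the
  kernel evaluated at the centers, and it tends to that value; so, by dominated
  convergence, all these inner products have the same limit, namely the claimed
  conditional variance, and the family is Cauchy in [L^2], conditionally on [B].
  The dominating energy is integrable with respect to [B] because
  [E |N(0, u)|^(2 h - 2)] is [O(u^(h - 1))], which leaves the time singularity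
  [|r - s|^(2 H0 - 2 + \sum_i (H_i - 1))], of exponent greater than -1.

  [A^{eps,delta}] is in the space [H] as a pointwise limit of step functions
  dominated by a Gaussian envelope.  A functional of the pair [(W, B)] which is
  jointly measurable is obtained from limits at fixed [B] by choosing a rapidly
  converging subsequence whose indices are measurable functions of [B]. *)

Require Import Defs.
From HB Require Import structures.
From mathcomp Require Import all_boot all_order all_algebra.
From mathcomp Require Import all_classical all_reals all_analysis.
From mathcomp Require Import measurable_realfun ring lra.

Set Implicit Arguments.
Unset Strict Implicit.
Unset Printing Implicit Defensive.
Import Order.TTheory GRing.Theory Num.Theory.
Import numFieldNormedType.Exports.

Local Open Scope classical_set_scope.
Local Open Scope ring_scope.

(** * Iterated integrals over pairs of points of space-time *)

(** The inequality |x - u| q(x) <= 1 is invariant under rescaling of q about u: it makes the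
    constant in front of the kernel independent of [eps] and [delta]. The inequality |x - u|^2 q(x)
    <= s, with s the scale of q, concentrates the mass when s tends to 0. Both pass to the law of
    the difference of two independent points, so each double integral becomes a single integral
    against |w|^(h - 1). The form [innerH] is not visibly positive. Its positivity comes from second
    moments of step integrals, and estimates go through Young inequalities and through envelopes
    under which all pairings converge absolutely. Negative powers of 0 are 0 here, so the kernel
    does not dominate its smearings where two coordinates of the path coincide; such pairs of times
    must be shown to be null for almost every path. The limit is built along eps = delta = 1 / (n +
    1) from one choice of versions. An arbitrary family of versions is compared with it path by
    path, then on the product space with the energy of the path as dominating function. *)

Section prodm_integral.
Local Open Scope ereal_scope.
Context d1 d2 (T1 : measurableType d1) (T2 : measurableType d2) (R : realType).
Variables (m1 : {sigma_finite_measure set T1 -> \bar R})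
          (m2 : {sigma_finite_measure set T2 -> \bar R}).

Lemma ge0_integral_prodm1 (f : T1 * T2 -> \bar R) :
  measurable_fun [set: T1 * T2] f -> (forall z, 0 <= f z) ->
  \int[prodm m1 m2]_z f z = \int[m1]_x \int[m2]_y f (x, y).
Proof. exact: fubini_tonelli1. Qed.

End prodm_integral.

Section prodm_pairs.
Local Open Scope ereal_scope.
Context d1 d2 (T1 : measurableType d1) (T2 : measurableType d2) (R : realType).
Variables (m1 : {sigma_finite_measure set T1 -> \bar R})
          (m2 : {sigma_finite_measure set T2 -> \bar R}).
Variables (f : T1 * T1 -> \bar R) (g : T2 * T2 -> \bar R).
Hypothesis mf : measurable_fun [set: T1 * T1] f.
Hypothesis mg : measurable_fun [set: T2 * T2] g.
Hypothesis f0 : forall z, 0 <= f z.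
Hypothesis g0 : forall z, 0 <= g z.

(** Tonelli in [q] for fixed [p] separates the two factors; Tonelli in [p] then ends the proof. This
    is how an integral over pairs of points of R^n breaks up one coordinate at a time. *)
Lemma integral_prodm_pairs :
  \int[prodm m1 m2]_p \int[prodm m1 m2]_q (f (p.1, q.1) * g (p.2, q.2)) =
  (\int[m1]_x \int[m1]_y f (x, y)) * (\int[m2]_x \int[m2]_y g (x, y)).
Proof.
have msec1 x : measurable_fun setT (fun y => f (x, y)).
  by apply: measurableT_comp => //; exact: pair1_measurable.
have msec2 x : measurable_fun setT (fun y => g (x, y)).
  by apply: measurableT_comp => //; exact: pair1_measurable.
pose F x := \int[m1]_y f (x, y); pose G x := \int[m2]_y g (x, y).
have mF : measurable_fun setT F by exact: measurable_fun_fubini_tonelli_F.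
have mG : measurable_fun setT G by exact: measurable_fun_fubini_tonelli_F.
have F0 x : 0 <= F x by apply: integral_ge0.
have G0 x : 0 <= G x by apply: integral_ge0.
have inner p : \int[prodm m1 m2]_q (f (p.1, q.1) * g (p.2, q.2)) = F p.1 * G p.2.
  rewrite ge0_integral_prodm1//=; last 2 first.
    apply: emeasurable_funM.
      exact: (measurableT_comp (msec1 p.1) measurable_fst).
    exact: (measurableT_comp (msec2 p.2) measurable_snd).
    by move=> z; rewrite mule_ge0.
  under eq_integral => x _ do rewrite ge0_integralZl//.
  by rewrite ge0_integralZr// -/(G _).
under eq_integral => p _ do rewrite inner.
rewrite ge0_integral_prodm1//=; last 2 first.
- apply: emeasurable_funM.
    exact: (measurableT_comp mF measurable_fst).
  exact: (measurableT_comp mG measurable_snd).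
- by move=> z; rewrite mule_ge0.
under eq_integral => x _ do rewrite ge0_integralZl//.
by rewrite ge0_integralZr//; apply: integral_ge0.
Qed.

End prodm_pairs.

Section tuple_pairs.
Local Open Scope ereal_scope.
Context (R : realType).

Lemma measurable_prod_tnth_pairs (n : nat) (f : 'I_n -> R * R -> \bar R) :
  (forall i, measurable_fun [set: R * R] (f i)) ->
  measurable_fun [set: n.-tuple R * n.-tuple R]
    (fun p => \prod_(i < n) f i (tnth p.1 i, tnth p.2 i)).
Proof.
move=> mf.
elim: (index_enum _) => [|i s IH].
  under eq_fun => p do rewrite big_nil.
  exact: measurable_cst.
under eq_fun => p do rewrite big_cons.
apply: emeasurable_funM => //.
apply: (measurableT_comp (mf i)).
apply: measurable_fun_pair.
  exact: (measurableT_comp (measurable_tnth i) measurable_fst).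
exact: (measurableT_comp (measurable_tnth i) measurable_snd).
Qed.

(** Induction on the dimension: the measure on R^(n+1) is an image under [tuple_cons], so both
    integrals are pulled back to R x R^n and the first coordinate is split off. In dimension 0 both
    measures are the Dirac mass at the empty tuple. *)
Lemma integral_tuple_pairs (n : nat) (f : 'I_n -> R * R -> \bar R) :
  (forall i, measurable_fun [set: R * R] (f i)) -> (forall i z, 0 <= f i z) ->
  \int[lebesgue_tuple R n]_v \int[lebesgue_tuple R n]_w
    \prod_(i < n) f i (tnth v i, tnth w i) =
  \prod_(i < n) \int[@lebesgue_measure R]_x \int[@lebesgue_measure R]_y f i (x, y).
Proof.
elim: n f => [|n IH] f mf f0.
  rewrite big_ord0.
  under eq_integral => v _.
    under eq_integral => w _ do rewrite big_ord0.
    rewrite integral_dirac//= diracT mul1e.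
    over.
  by rewrite integral_dirac//= diracT mul1e.
have prod0 m (h : 'I_m -> \bar R) : (forall i, 0 <= h i) -> 0 <= \prod_(i < m) h i.
  by move=> h0; apply: prode_ge0.
have mprod := measurable_prod_tnth_pairs mf.
pose h (z : n.+1.-tuple R * n.+1.-tuple R) :=
  \prod_(i < n.+1) f i (tnth z.1 i, tnth z.2 i).
have h0 z : 0 <= h z by exact: prod0.
have mH : measurable_fun setT
    (fun v => \int[lebesgue_cons (lebesgue_tuple R n)]_w h (v, w)).
  exact: measurable_fun_fubini_tonelli_F.
rewrite [LHS]ge0_integral_pushforward//; last 2 first.
- exact: measurable_tuple_cons.
- by move=> v _; apply: integral_ge0 => w _; exact: prod0.
rewrite preimage_setT.
pose g (z : n.-tuple R * n.-tuple R) :=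
  \prod_(i < n) f (lift ord0 i) (tnth z.1 i, tnth z.2 i).
transitivity (\int[prodm lebesgue_measure (lebesgue_tuple R n)]_p
    \int[prodm lebesgue_measure (lebesgue_tuple R n)]_q
     (f ord0 (p.1, q.1) * g (p.2, q.2))).
  apply: eq_integral => p _ /=.
  rewrite [LHS]ge0_integral_pushforward//; last 3 first.
  - exact: measurable_tuple_cons.
  - have mh : measurable_fun setT h by exact: mprod.
    exact: (measurableT_comp mh (pair1_measurable _)).
  - by move=> v _; exact: prod0.
  rewrite preimage_setT; apply: eq_integral => q _ /=.
  rewrite big_ord_recl/= /g; congr (_ * _).
  by apply: eq_bigr => i _; rewrite /tuple_cons !tnthS.
rewrite integral_prodm_pairs//; last 2 first.
- exact: (@measurable_prod_tnth_pairs n (fun i => f (lift ord0 i))).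
- by move=> z; exact: prod0.
rewrite big_ord_recl; congr (_ * _).
  exact: (IH (fun i => f (lift ord0 i))).
exact: (mf ord0).
Qed.

Lemma integral_spacetime_pairs (d : nat) (f0 : R * R -> \bar R)
    (f : 'I_d -> R * R -> \bar R) :
  measurable_fun [set: R * R] f0 -> (forall z, 0 <= f0 z) ->
  (forall i, measurable_fun [set: R * R] (f i)) -> (forall i z, 0 <= f i z) ->
  \int[prodm (lebesgue_spacetime R d) (lebesgue_spacetime R d)]_pq
    (f0 (pq.1.1, pq.2.1) *
     \prod_(i < d) f i (tnth pq.1.2 i, tnth pq.2.2 i)) =
  (\int[@lebesgue_measure R]_x \int[@lebesgue_measure R]_y f0 (x, y)) *
  \prod_(i < d) \int[@lebesgue_measure R]_x \int[@lebesgue_measure R]_y f i (x, y).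
Proof.
move=> mf0 f00 mf f_ge0.
have mg := measurable_prod_tnth_pairs mf.
have g0 (z : d.-tuple R * d.-tuple R) :
    0 <= \prod_(i < d) f i (tnth z.1 i, tnth z.2 i) by apply: prode_ge0.
rewrite ge0_integral_prodm1/=; last 2 first.
- apply: emeasurable_funM.
    have m1 : measurable_fun [set: (measurableTypeR R * d.-tuple R) *
        (measurableTypeR R * d.-tuple R)] (fun pq => (pq.1.1, pq.2.1)).
      apply: measurable_fun_pair.
        exact: (measurableT_comp measurable_fst measurable_fst).
      exact: (measurableT_comp measurable_fst measurable_snd).
    exact: (measurableT_comp mf0 m1).
  have m2 : measurable_fun [set: (measurableTypeR R * d.-tuple R) *
        (measurableTypeR R * d.-tuple R)]
      (fun pq => (pq.1.2, pq.2.2)).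
    apply: measurable_fun_pair.
      exact: (measurableT_comp measurable_snd measurable_fst).
    exact: (measurableT_comp measurable_snd measurable_snd).
  exact: (measurableT_comp mg m2).
- by move=> z; apply: mule_ge0 => //; exact: (g0 (z.1.2, z.2.2)).
have := integral_prodm_pairs (@lebesgue_measure R)
  (lebesgue_tuple R d) mf0 mg f00 g0.
by rewrite integral_tuple_pairs.
Qed.

End tuple_pairs.

(** * The power kernel on the line and its smearings *)

Section lebesgue_translation.
Context {R : realType}.
Local Notation mu := (@lebesgue_measure R).

Lemma measurable_shift (c : R) : measurable_fun setT (+%R^~ c : R -> measurableTypeR R).
Proof. by apply: measurable_funD => //; exact: measurable_cst. Qed.

Lemma lebesgue_measure_shift (c : R) (A : set R) : measurable A ->
  pushforward mu (+%R^~ c : R -> measurableTypeR R) A = mu A.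
Proof.
move=> mA; apply/esym.
apply: lebesgue_measure_unique => //; first exact: measurable_shift.
move=> mshift X [[a b] /= _ <-].
rewrite /pushforward.
rewrite (_ : _ @^-1` _ = `]a - c, b - c]%classic); last first.
  by apply/seteqP; split=> y /=; rewrite !in_itv/= ltrBlDr lerBrDr.
rewrite !lebesgue_measure_itv/= !lte_fin ltrD2r.
by case: ifP => // _; rewrite -!EFinB; congr EFin; ring.
Qed.

Lemma ge0_integral_shift (c : R) (f : R -> \bar R) :
  measurable_fun setT f -> (forall y, 0 <= f y)%E ->
  (\int[mu]_y f (y + c)%R = \int[mu]_y f y)%E.
Proof.
move=> mf f0.
transitivity (\int[pushforward mu (+%R^~ c : R -> measurableTypeR R)]_y f y)%E.
  by rewrite ge0_integral_pushforward//; exact: measurable_shift.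
apply: eq_measure_integral => [|mshift A mA _]; first exact: measurable_shift.
exact: lebesgue_measure_shift.
Qed.

Lemma ge0_integral_opp (f : R -> \bar R) :
  measurable_fun setT f -> (forall y, 0 <= f y)%E ->
  (\int[mu]_y f (- y)%R = \int[mu]_y f y)%E.
Proof.
move=> mf f0.
transitivity (\int[pushforward mu (-%R : R -> measurableTypeR R)]_y f y)%E.
  by rewrite ge0_integral_pushforward.
by apply: eq_measure_integral => A mA _; exact: lebesgue_measureN.
Qed.

End lebesgue_translation.

(** * Integrals of |x - y|^(h - 1) over intervals and rectangles *)

Section power_integral.
Context {R : realType}.
Local Notation mu := (@lebesgue_measure R).
Implicit Types (h w p q : R).

(* The odd antiderivative of [|w| `^ (h - 1)], up to the factor [h]. *)
Definition signed_powR h w : R := Num.sg w * `|w| `^ h.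

Lemma measurable_norm_powR h : measurable_fun setT (fun w : R => `|w| `^ h).
Proof. exact: (measurableT_comp (measurable_powR h) (@normr_measurable R setT)). Qed.

Lemma norm_powR_cvg0 h : 0 < h -> (`|w| `^ h) @[w --> (0 : R)] --> 0.
Proof.
move=> h0; apply/cvgrPdist_lt => e e0.
near=> w.
rewrite sub0r normrN ger0_norm ?powR_ge0//.
have w1 : `|w| < e `^ h^-1.
  near: w; have := @cvgr0_norm_lt _ _ _ (nbhs (0:R)) _ id cvg_id (e `^ h^-1).
  by apply; rewrite powR_gt0.
rewrite -[ltRHS](@powRr1 _ e) ?ltW// -(mulVf (lt0r_neq0 h0)) powRrM.
by apply: gt0_ltr_powR => //; rewrite nnegrE ?powR_ge0.
Unshelve. all: by end_near. Qed.

Lemma is_derive_norm_powR h w : w != 0 ->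
  is_derive w 1 (fun w => `|w| `^ h) (h * signed_powR (h - 1) w).
Proof.
rewrite neq_lt => /orP[w0|w0].
- have : is_derive w 1 (fun w => (- w) `^ h) (h * signed_powR (h - 1) w).
    have w0' : 0 < - w by rewrite oppr_gt0.
    have d := is_derive1_powR h w0'.
    have dN : is_derive w 1 (fun w : R => - w) (-1) by exact: is_deriveN.
    have /= := @is_derive1_comp _ (fun y => y `^ h) (fun y => - y) w _ _ d dN.
    by rewrite /comp/= /signed_powR ltr0_sg// ltr0_norm// !mulN1r mulrN1 mulrN.
  apply: near_eq_is_derive.
  by near=> z; rewrite ltr0_norm//; near: z; exact: lt_nbhsl.
- have : is_derive w 1 (fun w => w `^ h) (h * signed_powR (h - 1) w).
    rewrite /signed_powR gtr0_sg// gtr0_norm// mul1r.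
    exact: is_derive1_powR.
  apply: near_eq_is_derive.
  by near=> z; rewrite gtr0_norm//; near: z; exact: lt_nbhsr.
Unshelve. all: by end_near. Qed.

Lemma continuous_norm_powR h : 0 < h -> continuous (fun w : R => `|w| `^ h).
Proof.
move=> h0 w; have [->|w0] := eqVneq w 0.
  by rewrite /continuous_at [X in _ --> X](_ : _ = 0) ?normr0 ?powR0 ?gt_eqF//; exact: norm_powR_cvg0.
have [/derivable1_diffP/differentiable_continuous] := is_derive_norm_powR h w0.
by [].
Qed.

Lemma continuous_signed_powR h : 0 < h -> continuous (signed_powR h).
Proof.
move=> h0 w; rewrite /signed_powR.
have [->|w0] := eqVneq w 0.
  rewrite /continuous_at [X in _ --> X](_ : _ = 0); last by rewrite sgr0 mul0r.
  apply/cvgr0Pnorm_lt => e e0.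
  near=> z; rewrite normrM; apply: (@le_lt_trans _ _ (`|z| `^ h)).
    rewrite (ger0_norm (powR_ge0 _ _)).
    by rewrite ler_piMl ?powR_ge0// normr_sg; case: (_ != _).
  rewrite -[ltLHS]ger0_norm ?powR_ge0//; near: z.
  by have /cvgr0Pnorm_lt := norm_powR_cvg0 h0; exact.
apply: cvgM; last exact: continuous_norm_powR.
move: w0; rewrite neq_lt => /orP[w0|w0].
- apply: (@near_cst_continuous _ _ (-1 : R) (@Num.sg R)).
  by near=> z; rewrite ltr0_sg//; near: z; exact: lt_nbhsl.
- apply: (@near_cst_continuous _ _ (1 : R) (@Num.sg R)).
  by near=> z; rewrite gtr0_sg//; near: z; exact: lt_nbhsr.
Unshelve. all: by end_near. Qed.

(** The exponent exceeds 1, so the origin is included: the difference quotient there has absolute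
    value |z|^h. The antiderivative in [integral_sub_powR_rect] needs this, since its interval may
    contain the singularity. *)
Lemma is_derive_norm_powRS h w : 0 < h ->
  is_derive w 1 (fun w => `|w| `^ (h + 1)) ((h + 1) * signed_powR h w).
Proof.
move=> h0; have [->|w0] := eqVneq w 0; last first.
  by have := is_derive_norm_powR (h + 1) w0; rewrite addrK.
rewrite /signed_powR sgr0 mul0r mulr0.
have cv : z^-1 *: (`|z *: (1:R) + 0| `^ (h + 1) - `|0:R| `^ (h + 1)) @[z --> 0^'] --> (0 : R).
  apply/cvgr0Pnorm_lt => e e0.
  near=> z.
  have z0 : z != 0 by near: z; exact: nbhs_dnbhs_neq.
  rewrite normr0 powR0 ?gt_eqF ?addr_gt0// subr0 addr0.
  rewrite [z *: _]mulr1 [_ *: _]/(_ * _) normrM (ger0_norm (powR_ge0 _ _)).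
  rewrite powRD ?normr_eq0 ?z0 ?implybT// powRr1// mulrCA normfV mulVf ?normr_eq0// mulr1.
  rewrite -[ltLHS]ger0_norm ?powR_ge0//; near: z.
  apply: nbhs_dnbhs.
  by have /cvgr0Pnorm_lt := norm_powR_cvg0 h0; exact.
apply: DeriveDef; first by apply/cvg_ex; exists 0.
exact/cvg_lim.
Unshelve. all: by end_near. Qed.

Lemma is_derive_signed_powR h w : 0 < w ->
  is_derive w 1 (signed_powR h) (h * `|w| `^ (h - 1)).
Proof.
move=> w0.
have : is_derive w 1 (fun w => w `^ h) (h * `|w| `^ (h - 1)).
  by rewrite gtr0_norm//; exact: is_derive1_powR.
apply: near_eq_is_derive; near=> z.
have z0 : 0 < z by near: z; exact: lt_nbhsr.
by rewrite /signed_powR gtr0_sg// gtr0_norm// mul1r.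
Unshelve. all: by end_near. Qed.

Lemma integral_powR_oc p q h : 0 < h -> 0 < p -> p <= q ->
  (\int[mu]_(w in `]p, q]) (`|w| `^ (h - 1))%:E =
   (h^-1 * (signed_powR h q - signed_powR h p))%:E)%E.
Proof.
move=> h0 p0; rewrite le_eqVlt => /predU1P[->|pq].
  by rewrite set_itvoc0 integral_set0 subrr mulr0.
have der z : z \in `]p, q[ -> is_derive z 1 (fun w => h^-1 * signed_powR h w) (`|z| `^ (h - 1)).
  rewrite in_itv/= => /andP[pz _]; have z0 := lt_trans p0 pz.
  have d := is_derive_signed_powR h z0.
  have := @is_deriveZ _ _ _ (signed_powR h) h^-1 _ _ _ d.
  by rewrite scalerA mulVf ?gt_eqF// scale1r.
have cG := continuous_signed_powR h0.
have cG' : continuous (fun w => h^-1 * signed_powR h w).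
  by move=> z; apply: cvgM; [exact: cvg_cst|exact: cG].
have := @continuous_FTC2 R (fun w => `|w| `^ (h - 1)) (fun w => h^-1 * signed_powR h w) p q pq.
rewrite -integral_itv_obnd_cbnd; last first.
  by apply: measurable_funTS; apply/measurable_EFinP; exact: measurable_norm_powR.
move=> ->.
- by rewrite -EFinB -mulrBr.
- apply: derivable_within_continuous => z; rewrite in_itv/= => /andP[pz _].
  have z0 : z != 0 by rewrite gt_eqF// (lt_le_trans p0).
  by have [] := is_derive_norm_powR (h - 1) z0.
- split; first by move=> z /der[].
  + by apply: cvg_at_right_filter; exact: cG'.
  + by apply: cvg_at_left_filter; exact: cG'.
- by move=> z /der dz; rewrite derive1E; exact: derive_val.
Qed.

Lemma integral_powR_oc0 q h : 0 < h -> 0 <= q ->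
  (\int[mu]_(w in `]0%R, q]) (`|w| `^ (h - 1))%:E = (h^-1 * signed_powR h q)%:E)%E.
Proof.
move=> h0 q0.
(* The fundamental theorem applies only away from the singularity at 0, so the interval is exhausted
   from the right and the two limits, by monotone convergence and by continuity of the
   antiderivative, are compared. *)
pose F (n : nat) : set R := `](q / n.+1%:R), q]%classic.
have FE : \bigcup_n F n = `]0, q]%classic.
  apply/seteqP; split=> w /=.
    move=> [n _]; rewrite /F/= !in_itv/= => /andP[qw ->]; rewrite andbT.
    by apply: le_lt_trans qw; rewrite divr_ge0.
  rewrite in_itv/= => /andP[w0 wq].
  have [n qn] : exists n : nat, q / w < n.+1%:R.
    exists (Num.truncn (q / w)); exact: truncnS_gt.
  exists n => //; rewrite /F/= in_itv/= wq andbT.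
  by rewrite ltr_pdivrMr// mulrC -ltr_pdivrMr.
have cv1 : (\int[mu]_(w in F n) (`|w| `^ (h - 1))%:E)%E @[n --> \oo] -->
   (\int[mu]_(w in `]0%R, q]) (`|w| `^ (h - 1))%:E)%E.
  rewrite -FE; apply: ge0_nondecreasing_set_cvg_integral => //.
  - move=> n m nm; apply/subsetPset => w; rewrite /F/= !in_itv/= => /andP[qw ->].
    rewrite andbT; apply: le_lt_trans qw.
    by apply: ler_wpM2l => //; rewrite lef_pV2 ?posrE// ler_nat ltnS.
  - by move=> n; exact: measurable_itv.
  - by move=> n; apply: measurable_funTS; apply/measurable_EFinP; exact: measurable_norm_powR.
have cv2 : (\int[mu]_(w in F n) (`|w| `^ (h - 1))%:E)%E @[n --> \oo] -->
   (h^-1 * (signed_powR h q - signed_powR h 0))%:E.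
  move: q0; rewrite le_eqVlt => /predU1P[q0|q0].
    rewrite -q0 subrr mulr0.
    rewrite [X in X @ _](_ : _ = cst 0%E); first exact: cvg_cst.
    by apply/funext => n; rewrite /F -q0 mul0r set_itvoc0 integral_set0.
  rewrite [X in X @ _](_ : _ = EFin \o (fun n : nat => h^-1 * (signed_powR h q - signed_powR h (q / n.+1%:R)))); last first.
    apply/funext => n /=; rewrite integral_powR_oc//.
    + by rewrite divr_gt0.
    + by rewrite ler_pdivrMr// ler_peMr// ?ler1n// ltW.
  apply: cvg_EFin; first by near=> n.
  apply: cvgM; first exact: cvg_cst.
  apply: cvgB; first exact: cvg_cst.
  apply: (@cvg_comp _ _ _ (fun n : nat => q / n.+1%:R) (signed_powR h) _ (nbhs (0:R))).
    have : (q / n.+1%:R) @[n --> \oo] --> q * 0.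
      by apply: cvgM; [exact: cvg_cst|exact: cvg_harmonic].
    by rewrite mulr0.
  exact: continuous_signed_powR.
have := cvg_unique _ cv1 cv2; rewrite [signed_powR h 0]/signed_powR sgr0 mul0r subr0.
exact.
Unshelve. all: by end_near. Qed.

(** The antiderivative is odd, so reflection carries the negative half-line to the positive one; an
    interval containing 0 in its interior is cut there. *)
Lemma integral_norm_powR_oc p q h : 0 < h -> p <= q ->
  (\int[mu]_(w in `]p, q]) (`|w| `^ (h - 1))%:E =
   (h^-1 * (signed_powR h q - signed_powR h p))%:E)%E.
Proof.
move=> h0.
have G0 : signed_powR h 0 = 0 by rewrite /signed_powR sgr0 mul0r.
have GN z : signed_powR h (- z) = - signed_powR h z.
  by rewrite /signed_powR sgrN normrN mulNr.
have pos a b : 0 <= a -> a <= b -> (\int[mu]_(w in `]a, b]) (`|w| `^ (h - 1))%:E =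
   (h^-1 * (signed_powR h b - signed_powR h a))%:E)%E.
  rewrite le_eqVlt => /predU1P[<-|a0] ab; last exact: integral_powR_oc.
  by rewrite integral_powR_oc0// G0 subr0.
have mf (D : set R) : measurable_fun D (fun w => (`|w| `^ (h - 1))%:E).
  by apply: measurable_funTS; apply/measurable_EFinP; exact: measurable_norm_powR.
have neg a b : b <= 0 -> a <= b -> (\int[mu]_(w in `]a, b]) (`|w| `^ (h - 1))%:E =
   (h^-1 * (signed_powR h b - signed_powR h a))%:E)%E.
  move=> b0 ab.
  rewrite integral_mkcond -ge0_integral_opp; last 2 first.
  - by apply/(measurable_restrictT _ _).1 => //; exact: mf.
  - by move=> y; rewrite erestrict_ge0// => z _; rewrite lee_fin powR_ge0.
  transitivity (\int[mu]_(w in `[(- b)%R, (- a)%R[) (`|w| `^ (h - 1))%:E)%E.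
    rewrite [RHS]integral_mkcond; apply: eq_integral => y _.
    rewrite !patchE/= normrN; congr (if _ then _ else _).
    by apply/idP/idP; rewrite !inE/= !in_itv/= lerNl ltrNr andbC.
  rewrite integral_itv_bndo_bndc// -integral_itv_obnd_cbnd//.
  by rewrite pos ?lerN2 ?oppr_ge0// !GN; congr ((_ * _)%:E); ring.
move=> pq.
have [p0|/ltW p0] := leP 0 p; first exact: pos.
have [q0|/ltW q0] := leP q 0; first exact: neg.
rewrite (_ : `]p, q]%classic = `]p, 0]%classic `|` `]0, q]%classic); last first.
  by rewrite -itv_bndbnd_setU// bnd_simp.
rewrite ge0_integral_setU//.
- by rewrite neg// pos// -EFinD G0; congr EFin; ring.
- exact: mf.
- apply/disj_setPLR => w /=; rewrite !in_itv/= => /andP[_ w0].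
  by apply/negP; rewrite negb_and -leNgt w0.
Qed.

Lemma integral_sub_powR_oc u c e h : 0 < h -> c <= e ->
  (\int[mu]_(v in `]c, e]) (`|u - v| `^ (h - 1))%:E =
   (h^-1 * (signed_powR h (e - u) - signed_powR h (c - u)))%:E)%E.
Proof.
move=> h0 ce.
have ce' : c - u <= e - u by rewrite lerD2r.
rewrite -(integral_norm_powR_oc h0 ce').
rewrite [LHS]integral_mkcond [RHS]integral_mkcond.
rewrite -(ge0_integral_shift u); last 2 first.
- apply/(measurable_restrictT _ _).1 => //; apply: measurable_funTS.
  apply/measurable_EFinP; apply: (measurableT_comp (measurable_norm_powR (h - 1))).
  by apply: measurable_funB => //; exact: measurable_cst.
- by move=> y; rewrite erestrict_ge0// => z _; rewrite lee_fin powR_ge0.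
apply: eq_integral => w _; rewrite !patchE.
rewrite opprD addrCA subrr addr0 normrN; congr (if _ then _ else _).
by apply/idP/idP; rewrite !inE/= !in_itv/= ltrBlDr lerBrDr.
Qed.

(** For h = 2 H - 1 the bracket is twice the covariance of the increments over ]a, b] and ]c, e] of
    a fractional Brownian motion of parameter H. This identity links the kernel to the sheet. *)
Lemma integral_sub_powR_rect a b c e h : 0 < h -> a <= b -> c <= e ->
  (\int[mu]_(u in `]a, b]) \int[mu]_(v in `]c, e]) (`|u - v| `^ (h - 1))%:E =
   ((h * (h + 1))^-1 * (`|e - a| `^ (h + 1) - `|e - b| `^ (h + 1)
      - `|c - a| `^ (h + 1) + `|c - b| `^ (h + 1)))%:E)%E.
Proof.
move=> h0; rewrite le_eqVlt => /predU1P[->|ab] ce.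
  by rewrite set_itvoc0 integral_set0 subrr add0r addNr mulr0.
under eq_integral => u _ do rewrite integral_sub_powR_oc//.
pose f (u : R) : R := h^-1 * (signed_powR h (e - u) - signed_powR h (c - u)).
pose F (u : R) : R := - (h * (h + 1))^-1 * (`|e - u| `^ (h + 1) - `|c - u| `^ (h + 1)).
have h1 : h + 1 != 0 by rewrite gt_eqF// addr_gt0.
have cf : continuous f.
  move=> u; apply: cvgM; first exact: cvg_cst.
  by apply: cvgB; apply: (@cvg_comp _ _ _ (fun u => _ - u) (signed_powR h)
    _ (nbhs (_ - u))); [apply: cvgB; [exact: cvg_cst|exact: cvg_id]
      |exact: continuous_signed_powR|apply: cvgB; [exact: cvg_cst|exact: cvg_id]
      |exact: continuous_signed_powR].
have dp (k u : R) : is_derive u 1 (fun u : R => `|k - u| `^ (h + 1)) (- ((h + 1) * signed_powR h (k - u))).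
  have d1 := is_derive_norm_powRS (k - u) h0.
  have d2 : is_derive u 1 (fun u : R => k - u) (-1).
    have := @is_deriveB _ _ _ (cst k) id u 1 _ _ (is_derive_cst _ _ _) (is_derive_id _ _).
    by rewrite sub0r.
  have /= := @is_derive1_comp _ (fun y => `|y| `^ (h + 1)) (fun y => k - y) u _ _ d1 d2.
  by rewrite mulrN1.
have dF (u : R) : is_derive u 1 F (f u).
  have d := is_deriveB (dp e u) (dp c u).
  have := @is_deriveZ _ _ _ _ (- (h * (h + 1))^-1) _ _ _ d.
  rewrite [_ *: _](_ : _ = f u)//.
  change ((- (h * (h + 1))^-1 * (- ((h + 1) * signed_powR h (e - u)) -
    - ((h + 1) * signed_powR h (c - u)))) = f u :> R).
  by rewrite /f; field; rewrite h1 gt_eqF.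
have := @continuous_FTC2 R f F a b ab.
rewrite -integral_itv_obnd_cbnd; last first.
  apply: measurable_funTS; apply/measurable_EFinP.
  exact: continuous_measurable_fun.
move=> ->.
- by rewrite -EFinB /F; congr EFin; ring.
- exact: continuous_subspaceT.
- split; first by move=> z _; case: (dF z).
  + apply: cvg_at_right_filter; apply: differentiable_continuous.
    by apply/derivable1_diffP; case: (dF a).
  + apply: cvg_at_left_filter; apply: differentiable_continuous.
    by apply/derivable1_diffP; case: (dF b).
- by move=> z _; rewrite derive1E; exact: derive_val.
Qed.

End power_integral.

(** * The kernel integrated against a density: uniform bounds and concentration *)

Section kernel_bounds.
Context {R : realType}.
Local Notation mu := (@lebesgue_measure R).
Implicit Types (h w c e rho z : R) (Q : R -> \bar R).

Lemma measurable_sub_powR z (r : R) : measurable_fun setT (fun w : R => `|z - w| `^ r).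
Proof.
apply: (measurableT_comp (measurable_norm_powR r)).
by apply: measurable_funB => //; exact: measurable_cst.
Qed.

Lemma powR_le_neg (r x y : R) : r <= 0 -> 0 < x -> x <= y -> y `^ r <= x `^ r.
Proof.
move=> r0 x0 xy; rewrite -(opprK r) powRN [leRHS]powRN lef_pV2 ?posrE ?powR_gt0//.
  by apply: ge0_ler_powR; rewrite ?nnegrE ?oppr_ge0// ltW// (lt_le_trans x0).
exact: lt_le_trans xy.
Qed.

Lemma integral_ball_powR z h rho : 0 < h -> 0 <= rho ->
  (\int[mu]_(w in `](z - rho)%R, (z + rho)%R]) (`|z - w| `^ (h - 1))%:E =
   (2 * rho `^ h / h)%:E)%E.
Proof.
move=> h0 r0.
rewrite integral_sub_powR_oc//; last by rewrite lerD2l ge0_cp.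
rewrite (addrC z rho) addrK (addrC z (- rho)) addrK; congr EFin.
rewrite /signed_powR sgrN normrN (ger0_norm r0).
have [->|rn0] := eqVneq rho 0; first by rewrite powR0 ?gt_eqF//; ring.
by rewrite gtr0_sg ?lt_neqAle ?r0 ?andbT 1?eq_sym//; ring.
Qed.

(* The common splitting: near the singularity [Q] is at most [a], elsewhere the
   power is at most [b]. *)
Lemma integral_powR_split Q z h rho (a b : R) :
  measurable_fun setT Q -> (forall w, 0 <= Q w)%E -> (\int[mu]_w Q w <= 1)%E ->
  0 < h -> 0 <= rho -> 0 <= a -> 0 <= b ->
  (forall w, `|z - w| < rho -> (Q w <= a%:E)%E) ->
  (forall w, rho <= `|z - w| -> `|z - w| `^ (h - 1) <= b) ->
  (\int[mu]_w (Q w * (`|z - w| `^ (h - 1))%:E) <= (a * (2 * rho `^ h / h) + b)%:E)%E.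
Proof.
move=> mQ Q0 Q1 h0 rho0 a0 b0 Qa fb.
pose I : set R := `](z - rho), (z + rho)]%classic.
have mI : measurable I by exact: measurable_itv.
have mf : measurable_fun setT (fun w : R => (`|z - w| `^ (h - 1))%:E).
  by apply/measurable_EFinP; exact: measurable_sub_powR.
pose fI := (fun w : R => (`|z - w| `^ (h - 1))%:E) \_ I.
have mfI : measurable_fun setT fI.
  by apply/(measurable_restrictT _ _).1 => //; exact: measurable_funTS.
have fI0 w : (0 <= fI w)%E.
  by rewrite /fI patchE; case: ifP => // _; rewrite lee_fin powR_ge0.
apply: (@le_trans _ _ (\int[mu]_w (a%:E * fI w + b%:E * Q w))%E).
  apply: ge0_le_integral => //.
  - by move=> w _; rewrite mule_ge0// lee_fin powR_ge0.
  - exact: emeasurable_funM.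
  - by apply: emeasurable_funD; apply: emeasurable_funM => //; exact: measurable_cst.
  - move=> w _.
    have [zw|zw] := ltP `|z - w| rho.
      have -> : fI w = (`|z - w| `^ (h - 1))%:E.
        rewrite /fI patchE; case: ifPn => //; rewrite notin_setE /I/= in_itv/=.
        by case; move: zw; rewrite ltr_norml => /andP[? ?]; apply/andP; split; lra.
      rewrite -[leLHS]adde0; apply: leeD; last by rewrite mule_ge0.
      by apply: lee_wpmul2r; rewrite ?lee_fin ?powR_ge0//; exact: Qa.
    rewrite -[leLHS]add0e; apply: leeD; first by rewrite mule_ge0.
    by rewrite muleC; apply: lee_wpmul2r => //; rewrite lee_fin; exact: fb.
rewrite ge0_integralD//; last 4 first.
- by move=> w _; rewrite mule_ge0.
- by apply: emeasurable_funM => //; exact: measurable_cst.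
- by move=> w _; rewrite mule_ge0.
- by apply: emeasurable_funM => //; exact: measurable_cst.
rewrite !ge0_integralZl// EFinD; apply: leeD.
  by rewrite EFinM /fI -integral_mkcond integral_ball_powR.
by rewrite -[leRHS]mule1; apply: lee_wpmul2l.
Qed.

(** The radius is left free: 1 is enough for finiteness, while the standard deviation gives the
    correct scaling for a normal density. *)
Lemma integral_powR_bounded Q z h rho (K : R) :
  measurable_fun setT Q -> (forall w, 0 <= Q w)%E -> (\int[mu]_w Q w <= 1)%E ->
  0 < h -> h < 1 -> 0 < rho -> 0 <= K -> (forall w, Q w <= K%:E)%E ->
  (\int[mu]_w (Q w * (`|z - w| `^ (h - 1))%:E) <=
   (K * (2 * rho `^ h / h) + rho `^ (h - 1))%:E)%E.
Proof.
move=> mQ Q0 Q1 h0 h1 rho0 K0 QK.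
apply: integral_powR_split => //.
- exact: ltW.
- exact: powR_ge0.
- by move=> w zw; apply: powR_le_neg => //; lra.
Qed.

(** The bound of [integral_powR_split] at z = 0 with rho = |c| / 2, a = 4 / |c| and b = (|c| / 2)^(h
    - 1), divided by |c|^(h - 1). *)
Definition smoothing_const h : R := 8 * 2^-1 `^ h / h + 2^-1 `^ (h - 1).

Lemma smoothing_const_ge0 h : 0 < h -> 0 <= smoothing_const h.
Proof.
by move=> h0; rewrite addr_ge0// ?powR_ge0// divr_ge0// ?mulr_ge0// ?powR_ge0// ltW.
Qed.

(** Within |c| / 2 of the singularity the distance to [c] is at least |c| / 2, so the weighted bound
    gives Q <= 4 / |c| there; farther out the power itself is at most (|c| / 2)^(h - 1). Both
    contributions scale like |c|^(h - 1), whatever the width of [Q]. *)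
Lemma integral_powR_centered Q c h :
  measurable_fun setT Q -> (forall w, 0 <= Q w)%E -> (\int[mu]_w Q w <= 1)%E ->
  0 < h -> h < 1 -> c != 0 ->
  (forall w, `|w - c|%:E * Q w <= 2%:E)%E ->
  (\int[mu]_w (Q w * (`|w| `^ (h - 1))%:E) <=
   (smoothing_const h * `|c| `^ (h - 1))%:E)%E.
Proof.
move=> mQ Q0 Q1 h0 h1 c0 Qc.
have nc0 : 0 < `|c| by rewrite normr_gt0.
have := @integral_powR_split Q 0 h (`|c| * 2^-1) (4 / `|c|) ((`|c| * 2^-1) `^ (h - 1)) mQ Q0 Q1 h0.
under eq_integral => w _ do rewrite sub0r normrN.
move=> H; apply: (le_trans (H _ _ _ _ _)).
- by rewrite mulr_ge0.
- by rewrite divr_ge0.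
- exact: powR_ge0.
- move=> w; rewrite sub0r normrN => wc.
  have wc' : `|c| / 2 <= `|w - c|.
    by rewrite distrC; apply: le_trans (lerB_dist _ _); lra.
  have wc0 : 0 < `|w - c| by apply: lt_le_trans wc'; rewrite divr_gt0.
  move: (Qc w); case: (Q w) (Q0 w) => [r| |]//.
    rewrite !lee_fin => r0 Hr.
    rewrite ler_pdivlMr//; apply: (@le_trans _ _ (2 * (`|w - c| * r))); last lra.
    by rewrite mulrA mulrC ler_wpM2r//; lra.
  by rewrite gt0_muley ?lte_fin.
- by move=> w; rewrite sub0r normrN => wc; apply: powR_le_neg => //; [lra|rewrite mulr_gt0].
- have pM r : (`|c| * 2^-1) `^ r = `|c| `^ r * 2^-1 `^ r by rewrite powRM// invr_ge0.
  rewrite lee_fin /smoothing_const !pM.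
  rewrite (_ : `|c| `^ (h - 1) = `|c| `^ h / `|c|); last first.
    rewrite powRD; last by rewrite (gt_eqF nc0) implybT.
    by rewrite powRN powRr1// ltW.
  rewrite le_eqVlt; apply/orP; left; apply/eqP.
  by field; rewrite !gt_eqF.
Qed.

(** The Cauchy density centered at [c] serves as an integrable profile with the decay |w - c|^-2
    that the second weighted bound provides. *)
Lemma integral_cauchy c :
  (\int[mu]_w ((pi^-1 * (oneDsqr (w - c)%R)^-1)%R%:E) = 1)%E.
Proof.
have mg : measurable_fun setT (fun w : R => (oneDsqr w)^-1%:E).
  by apply/measurable_EFinP; apply: continuous_measurable_fun; exact: continuous_oneDsqrV.
have g0 w : (0 <= (oneDsqr w : R)^-1%:E)%E by rewrite lee_fin.
have pi0 := @pi_gt0 R.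
under eq_integral => w _ do rewrite EFinM.
rewrite ge0_integralZl//; last 2 first.
- apply/measurable_EFinP; apply: continuous_measurable_fun => w.
  apply: (@cvg_comp _ _ _ (fun w => w - c) (fun w => (oneDsqr w)^-1) _ (nbhs (w - c))).
    by apply: cvgB; [exact: cvg_id|exact: cvg_cst].
  exact: continuous_oneDsqrV.
- by rewrite lee_fin invr_ge0 ltW.
rewrite (ge0_integral_shift (- c) mg)//.
rewrite ge0_symfun_integralT//; last 2 first.
- exact: continuous_oneDsqrV.
- by move=> w /=; rewrite /oneDsqr sqrrN.
rewrite (_ : [set x | 0 <= x]%R = `[0%R, +oo[%classic); last first.
  by apply/seteqP; split=> w /=; rewrite in_itv/= andbT.
rewrite integral0y_oneDsqr -!EFinM; congr EFin.
by rewrite (mulrC pi) mulVKf ?pnatr_eq0// mulVf// gt_eqF.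
Qed.

(** Near [c] the power is within e / 2 of its value at [c] by continuity. Away from [c] the weighted
    bound makes [Q] at most [delta] times a multiple of the Cauchy density, against which the power
    is integrable, so a small [delta] absorbs the remainder uniformly in [Q]. *)
Lemma integral_powR_concentrated c h (e : R) : 0 < h -> h < 1 -> c != 0 -> 0 < e ->
  exists2 delta : R, 0 < delta & forall Q,
  measurable_fun setT Q -> (forall w, 0 <= Q w)%E -> (\int[mu]_w Q w = 1)%E ->
  (forall w, (`|w - c| ^+ 2)%:E * Q w <= delta%:E)%E ->
  ((`|c| `^ (h - 1) - e)%:E <= \int[mu]_w (Q w * (`|w| `^ (h - 1))%:E) <=
   (`|c| `^ (h - 1) + e)%:E)%E.
Proof.
move=> h0 h1 c0 e0.
pose f (w : R) : R := `|w| `^ (h - 1).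
have f0 w : 0 <= f w by exact: powR_ge0.
have mf : measurable_fun setT (EFin \o f).
  by apply/measurable_EFinP; exact: measurable_norm_powR.
have e20 : 0 < e / 2 by rewrite divr_gt0.
have [eta eta0 feta] : exists2 eta : R, 0 < eta &
    forall w, `|w - c| < eta -> `|f w - f c| <= e / 2.
  have cf : {for c, continuous f}.
    have [/derivable1_diffP/differentiable_continuous] := is_derive_norm_powR (h - 1) c0.
    by [].
  have /cvgrPdist_le/(_ _ e20)/nbhs_ballP[eta /= eta0 H] := cf.
  by exists eta => // w wc; rewrite distrC; apply: H; rewrite /ball/= distrC.
pose q (w : R) : R := pi^-1 * (oneDsqr (w - c))^-1.
(* Chosen so that |w - c|^-2 <= K q(w) as soon as |w - c| >= eta: the ratio (1 + r^2) / r^2 is at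
   most 1 + eta^-2 for r >= eta. *)
pose K : R := pi * (1 + eta ^- 2).
(* The sum f w + f c lets one error term serve twice: f w bounds the far part of the integral from
   above, f c the mass that the far part takes away from [c]. *)
pose g w : R := K * (q w * (f w + f c)).
have pi0 := @pi_gt0 R.
have q0 w : 0 <= q w by rewrite mulr_ge0// ?invr_ge0 ltW.
have mq : measurable_fun setT (EFin \o q).
  apply/measurable_EFinP; apply: continuous_measurable_fun => w.
  apply: cvgM; first exact: cvg_cst.
  apply: (@cvg_comp _ _ _ (fun w => w - c) (fun w => (oneDsqr w)^-1) _ (nbhs (w - c))).
    by apply: cvgB; [exact: cvg_id|exact: cvg_cst].
  exact: continuous_oneDsqrV.
have K0 : 0 <= K by rewrite mulr_ge0 ?(ltW pi0)// addr_ge0// invr_ge0 exprn_ge0 ?ltW.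
have fc0 w : 0 <= f w + f c by rewrite addr_ge0.
have g0 w : 0 <= g w by apply: mulr_ge0 => //; exact: mulr_ge0.
have mqf : measurable_fun setT (fun w => (q w * (f w + f c))%:E).
  rewrite (_ : (fun w => _) = (fun w => (EFin \o q) w * ((EFin \o f) w + (f c)%:E))%E)//.
  apply: emeasurable_funM => //; apply: emeasurable_funD => //.
have mg : measurable_fun setT (EFin \o g).
  rewrite (_ : EFin \o g = (fun w => K%:E * (q w * (f w + f c))%:E)%E)//.
  by apply: emeasurable_funM => //; exact: measurable_cst.
have [G G0 HG] : exists2 G : R, 0 <= G & (\int[mu]_w (g w)%:E <= G%:E)%E.
  have qI : (\int[mu]_w (q w)%:E = 1)%E by exact: integral_cauchy.
  have qK w : ((q w)%:E <= (pi^-1)%:E)%E.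
    by rewrite lee_fin -[leRHS]mulr1 ler_wpM2l ?invr_ge0 ?(ltW pi0)// oneDsqrV_le1.
  have pi0' : 0 <= (pi^-1 : R) by rewrite invr_ge0 ltW.
  have q0' w : (0 <= (q w)%:E)%E by rewrite lee_fin.
  have qI' : (\int[mu]_w (q w)%:E <= 1)%E by rewrite qI.
  have := @integral_powR_bounded _ 0 h 1 _ mq q0' qI' h0 h1 ltr01 pi0' qK.
  under eq_integral => w _ do rewrite sub0r normrN.
  set K1 := (pi^-1 * _ + _)%R => HK.
  exists (K * (K1 + f c)).
    rewrite mulr_ge0// addr_ge0// addr_ge0 ?powR_ge0// mulr_ge0//.
    by rewrite divr_ge0 ?(ltW h0)// mulr_ge0// powR_ge0.
  have -> : (\int[mu]_w (g w)%:E =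
      \int[mu]_w (K%:E * ((q w)%:E * (f w)%:E + (f c)%:E * (q w)%:E)))%E.
    by apply: eq_integral => w _; rewrite -!EFinM; congr EFin; rewrite /g; ring.
  have m1 : measurable_fun setT (fun w => (q w)%:E * (f w)%:E)%E by exact: emeasurable_funM.
  have m2 : measurable_fun setT (fun w => (f c)%:E * (q w)%:E)%E.
    by apply: emeasurable_funM => //; exact: measurable_cst.
  have p1 w : (0 <= (q w)%:E * (f w)%:E)%E by rewrite mule_ge0// lee_fin.
  have p2 w : (0 <= (f c)%:E * (q w)%:E)%E by rewrite mule_ge0// lee_fin.
  rewrite ge0_integralZl//; last 2 first.
  - exact: emeasurable_funD.
  - by move=> w _; exact: adde_ge0.
  rewrite [in leRHS]EFinM; apply: lee_wpmul2l; first by rewrite lee_fin.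
  rewrite ge0_integralD// [in leRHS]EFinD; apply: leeD => //.
  by rewrite ge0_integralZl// ?qI ?mule1// lee_fin.
(* [G] bounds the integral of [g], so delta G <= e / 2; the added 1 keeps the quotient defined when
   [G] is 0. *)
exists (e / 2 / (G + 1)); first by rewrite divr_gt0// ltr_wpDl.
set delta := e / 2 / (G + 1) => Q mQ Q0 Q1 Qd.
have delta0 : 0 <= delta by rewrite divr_ge0 ?(ltW e20)// addr_ge0.
have dG : delta * G <= e / 2.
  rewrite /delta mulrAC ler_pdivrMr ?ltr_wpDl// ler_pM2l//; lra.
have far w : eta <= `|w - c| -> (Q w <= (delta * (K * q w))%:E)%E.
  move=> ew; have w0 : 0 < `|w - c| := lt_le_trans eta0 ew.
  have qw : `|w - c| ^- 2 <= K * q w.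
    rewrite /K /q mulrACA mulfV ?gt_eqF// mul1r /oneDsqr -(real_normK (num_real (w - c))).
    rewrite -div1r ler_pdivrMr ?exprn_gt0//.
    have n2 : 1 <= eta ^- 2 * `|w - c| ^+ 2.
      rewrite mulrC ler_pdivlMr ?exprn_gt0// mul1r ler_pXn2r ?nnegrE//; exact: ltW.
    have X0 : 0 < 1 + `|w - c| ^+ 2 by rewrite ltr_pwDl// exprn_ge0.
    by rewrite mulrAC ler_pdivlMr// mul1r mulrDl mul1r addrC lerD2l.
  apply: (@le_trans _ _ (delta * `|w - c| ^- 2)%:E); last by rewrite lee_fin ler_wpM2l.
  have w2 : 0 < `|w - c| ^+ 2 by rewrite exprn_gt0.
  move: (Qd w); case: (Q w) (Q0 w) => [r| |]//.
    by rewrite !lee_fin => r0 Hr; rewrite ler_pdivlMr// mulrC.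
  by rewrite gt0_muley ?lte_fin.
have mQf : measurable_fun setT (fun w => Q w * (f w)%:E)%E by exact: emeasurable_funM.
have Qf0 w : (0 <= Q w * (f w)%:E)%E by rewrite mule_ge0// lee_fin.
have mdg : measurable_fun setT (fun w => delta%:E * (g w)%:E)%E.
  by apply: emeasurable_funM => //; exact: measurable_cst.
have dg0 w : (0 <= delta%:E * (g w)%:E)%E by rewrite mule_ge0// lee_fin.
have Idg : (\int[mu]_w (delta%:E * (g w)%:E) <= (e / 2)%:E)%E.
  rewrite ge0_integralZl//; last by move=> w _; rewrite lee_fin.
  apply: le_trans (lee_wpmul2l _ HG) _; first by rewrite lee_fin.
  by rewrite -EFinM lee_fin.
have IQ (k : R) : 0 <= k -> (\int[mu]_w (k%:E * Q w) = k%:E)%E.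
  by move=> k0; rewrite ge0_integralZl// Q1 mule1.
have mkQ (k : R) : measurable_fun setT (fun w => k%:E * Q w)%E.
  by apply: emeasurable_funM => //; exact: measurable_cst.
apply/andP; split; last first.
  rewrite (_ : f c + e = (f c + e / 2) + e / 2); last by field.
  have k0 : 0 <= f c + e / 2 by rewrite addr_ge0 ?(ltW e20).
  rewrite EFinD -[in leRHS](IQ _ k0).
  apply: le_trans (leeD (lexx _) Idg).
  have kQ0 w : (0 <= (f c + e / 2)%:E * Q w)%E by rewrite mule_ge0.
  have mk := mkQ (f c + e / 2).
  rewrite -ge0_integralD//.
  apply: ge0_le_integral => //; first exact: emeasurable_funD.
  move=> w _; have [/far Qw|wc] := leP eta `|w - c|.
    rewrite -[leLHS]add0e; apply: leeD; first by rewrite mule_ge0.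
    apply: le_trans (lee_wpmul2r _ Qw) _; first by rewrite lee_fin.
    rewrite -EFinM -EFinM lee_fin -mulrA; apply: ler_wpM2l => //.
    rewrite -mulrA; apply: ler_wpM2l => //; apply: ler_wpM2l => //.
    by rewrite lerDl.
  rewrite -[leLHS]adde0; apply: leeD => //.
  rewrite muleC; apply: lee_wpmul2r => //; rewrite lee_fin.
  by rewrite -/(f w) -lerBlDl; have := feta _ wc; rewrite ler_norml => /andP[].
(* If f c - e / 2 is not positive the lower bound is negative, hence trivial; otherwise this
   constant can be integrated against [Q]. *)
have [fce|fce] := leP (f c - e / 2) 0.
  apply: (@le_trans _ _ 0%E); first by rewrite lee_fin -/(f c); lra.
  exact: integral_ge0.
rewrite -(@leeD2rE _ (e / 2)%:E)// -EFinD -/(f c).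
rewrite (_ : f c - e + e / 2 = f c - e / 2); last by field.
rewrite -(IQ _ (ltW fce)).
apply: le_trans (leeD (lexx _) Idg).
have kQ0 w : (0 <= (f c - e / 2)%:E * Q w)%E by rewrite mule_ge0// lee_fin ltW.
have mk := mkQ (f c - e / 2).
rewrite -ge0_integralD//.
apply: ge0_le_integral => //; first exact: emeasurable_funD.
move=> w _; have [/far Qw|wc] := leP eta `|w - c|.
  rewrite -[leLHS]add0e; apply: leeD => //.
  apply: (@le_trans _ _ ((f c)%:E * Q w)%E).
    by apply: lee_wpmul2r => //; rewrite lee_fin lerBlDr lerDl ltW.
  apply: le_trans (lee_wpmul2l _ Qw) _; first by rewrite lee_fin.
  rewrite -EFinM -EFinM lee_fin mulrCA; apply: ler_wpM2l => //.
  rewrite mulrCA; apply: ler_wpM2l => //; rewrite mulrC; apply: ler_wpM2l => //.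
  by rewrite lerDr.
rewrite -[leLHS]adde0; apply: leeD => //.
rewrite [leRHS]muleC; apply: lee_wpmul2r => //; rewrite lee_fin.
rewrite -/(f w) -subr_ge0; have := feta _ wc; rewrite ler_norml => /andP[+ _].
by rewrite -subr_ge0 => H; rewrite (_ : _ - _ = f w - f c - - (e / 2))//; ring.
Qed.

End kernel_bounds.

(** * Smearing the kernel by two peaked functions *)

Section smoothing.
Context {R : realType}.
Local Notation mu := (@lebesgue_measure R).
Implicit Types (h u v s x y w : R) (q : R -> R).

(** An approximate unit at [u] of scale [s]. The mass is only bounded by 1 because the time window
    loses mass when it is cut to [0, t]; mass 1 is assumed separately where limits are taken. *)
Definition peaked u s q : Prop :=
  [/\ measurable_fun setT q, forall x, 0 <= q x, (\int[mu]_x (q x)%:E <= 1)%E,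
      forall x, `|x - u| * q x <= 1 & forall x, `|x - u| ^+ 2 * q x <= s].

Definition smear h q1 q2 : \bar R :=
  (\int[mu]_x \int[mu]_y (q1 x * q2 y * `|x - y| `^ (h - 1))%R%:E)%E.

(** The density of X - Y for independent X and Y of densities [q1] and [q2]. *)
Definition diff_conv q1 q2 w : \bar R :=
  (\int[mu]_y (q1 (w + y) * q2 y)%R%:E)%E.

Section two_kernels.
Variables (q1 q2 : R -> R) (u v s1 s2 : R).
Hypothesis p1 : peaked u s1 q1.
Hypothesis p2 : peaked v s2 q2.

Let m1 : measurable_fun setT q1. Proof. by case: p1. Qed.
Let m2 : measurable_fun setT q2. Proof. by case: p2. Qed.
Let q1_ge0 x : 0 <= q1 x. Proof. by case: p1. Qed.
Let q2_ge0 x : 0 <= q2 x. Proof. by case: p2. Qed.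

Let mshift (w : R) : measurable_fun setT (fun y => q1 (w + y)).
Proof.
by apply: (measurableT_comp m1); apply: measurable_funD => //; exact: measurable_cst.
Qed.

Let mshiftE (w : R) : measurable_fun setT (fun y => (q1 (w + y))%:E).
Proof. exact/measurable_EFinP. Qed.

Let mpair : measurable_fun [set: R * R] (fun z : R * R => (q1 (z.1 + z.2) * q2 z.2)%:E).
Proof.
apply/measurable_EFinP; apply: measurable_funM.
  by apply: (measurableT_comp m1); exact: measurable_funD.
exact: (measurableT_comp m2).
Qed.

Lemma measurable_diff_conv : measurable_fun setT (diff_conv q1 q2).
Proof.
have p0 (z : R * R) : (0 <= (q1 (z.1 + z.2) * q2 z.2)%:E)%E by rewrite lee_fin mulr_ge0.
exact: (@measurable_fun_fubini_tonelli_F _ _ _ _ R mu _ mpair p0).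
Qed.

Let mconv w : measurable_fun setT (fun y => (q1 (w + y) * q2 y)%:E).
Proof. by apply/measurable_EFinP; exact: measurable_funM. Qed.

Lemma diff_conv_ge0 w : (0 <= diff_conv q1 q2 w)%E.
Proof. by apply: integral_ge0 => y _; rewrite lee_fin mulr_ge0. Qed.

Lemma integral_diff_conv (F : R -> R) : measurable_fun setT F -> (forall w, 0 <= F w) ->
  (\int[mu]_x \int[mu]_y (q1 x * q2 y * F (x - y))%R%:E =
   \int[mu]_w (diff_conv q1 q2 w * (F w)%:E))%E.
Proof.
move=> mF F0.
pose g (z : R * R) : \bar R := (q1 z.1 * q2 z.2 * F (z.1 - z.2))%:E.
have mg : measurable_fun setT g.
  apply/measurable_EFinP; apply: measurable_funM; first apply: measurable_funM.
  - exact: (measurableT_comp m1).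
  - exact: (measurableT_comp m2).
  - by apply: (measurableT_comp mF); exact: measurable_funB.
have g0 z : (0 <= g z)%E by rewrite lee_fin !mulr_ge0.
transitivity (\int[mu]_y \int[mu]_x g (x, y))%E; first exact: fubini_tonelli.
pose k (z : R * R) : \bar R := (q1 (z.1 + z.2) * q2 z.2 * F z.1)%:E.
have mk : measurable_fun setT k.
  apply/measurable_EFinP; apply: measurable_funM; last exact: (measurableT_comp mF).
  exact/measurable_EFinP.
have k0 z : (0 <= k z)%E by rewrite lee_fin !mulr_ge0.
transitivity (\int[mu]_y \int[mu]_w k (w, y))%E.
  apply: eq_integral => y _.
  rewrite -(ge0_integral_shift y); last 2 first.
  - exact: (measurableT_comp mg (pair2_measurable _)).
  - by move=> x; exact: g0.
  by apply: eq_integral => w _; rewrite /g /k/= addrK.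
transitivity (\int[mu]_w \int[mu]_y k (w, y))%E; first by apply/esym; exact: fubini_tonelli.
apply: eq_integral => w _; rewrite /k/= /diff_conv -ge0_integralZr//.
- exact: mconv.
- by move=> y _; rewrite lee_fin mulr_ge0.
- by rewrite lee_fin.
Qed.

Let int_shift (w : R) : (\int[mu]_y (q1 (w + y))%:E = \int[mu]_y (q1 y)%:E)%E.
Proof.
rewrite -(ge0_integral_shift w (f := EFin \o q1))//=.
- by apply: eq_integral => y _; rewrite addrC.
- exact/measurable_EFinP.
Qed.

Lemma integral_diff_conv1 :
  (\int[mu]_w diff_conv q1 q2 w = (\int[mu]_x (q1 x)%:E) * (\int[mu]_y (q2 y)%:E))%E.
Proof.
have := integral_diff_conv (F := cst 1) (measurable_cst _) (fun _ => ler01).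
under [X in _ = X]eq_integral => w _ do rewrite mule1.
move=> <-.
have i20 : (0 <= \int[mu]_y (q2 y)%:E)%E by apply: integral_ge0 => y _; rewrite lee_fin.
rewrite -ge0_integralZr//; last 2 first.
- exact/measurable_EFinP.
- by move=> x _; rewrite lee_fin.
apply: eq_integral => x _; under eq_integral => y _ do rewrite mulr1 EFinM.
rewrite ge0_integralZl//.
- exact/measurable_EFinP.
- by move=> y _; rewrite lee_fin.
- by rewrite lee_fin.
Qed.

Lemma integral_diff_conv_le1 : (\int[mu]_w diff_conv q1 q2 w <= 1)%E.
Proof.
rewrite integral_diff_conv1 -[leRHS]mule1; apply: lee_pmul.
- by apply: integral_ge0 => y _; rewrite lee_fin.
- by apply: integral_ge0 => y _; rewrite lee_fin.
- by case: p1.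
- by case: p2.
Qed.

(* Moments of the convolution: the weight is split between the two factors. *)
Let conv_weight (k a b : R) w : 0 <= k -> 0 <= a -> 0 <= b ->
  (forall y, k * (q1 (w + y) * q2 y) <= a * q2 y + b * q1 (w + y)) ->
  (k%:E * diff_conv q1 q2 w <= (a + b)%:E)%E.
Proof.
move=> k0 a0 b0 H.
rewrite -ge0_integralZl//; last 2 first.
- exact: mconv.
- by move=> y _; rewrite lee_fin mulr_ge0.
apply: (@le_trans _ _ (\int[mu]_y (a%:E * (q2 y)%:E + b%:E * (q1 (w + y))%:E))%E).
  apply: ge0_le_integral => //.
  - by move=> y _; rewrite mule_ge0// lee_fin mulr_ge0.
  - by apply: emeasurable_funM => //; exact: mconv.
  - apply: emeasurable_funD; apply: emeasurable_funM => //.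
      exact/measurable_EFinP.
    exact: mshiftE.
  - by move=> y _; rewrite -!EFinM lee_fin; exact: H.
rewrite ge0_integralD//; last 4 first.
- by move=> y _; rewrite mule_ge0// lee_fin.
- by apply: emeasurable_funM => //; exact/measurable_EFinP.
- by move=> y _; rewrite mule_ge0// lee_fin.
- by apply: emeasurable_funM => //; exact: mshiftE.
rewrite ge0_integralZl//; last 2 first.
- exact/measurable_EFinP.
- by move=> y _; rewrite lee_fin.
rewrite ge0_integralZl//; last 2 first.
- exact: mshiftE.
- by move=> y _; rewrite lee_fin.
rewrite int_shift EFinD; apply: leeD.
- by rewrite -[leRHS]mule1; apply: lee_wpmul2l => //; case: p2.
- by rewrite -[leRHS]mule1; apply: lee_wpmul2l => //; case: p1.
Qed.

Lemma diff_conv_peak1 w : (`|w - (u - v)|%:E * diff_conv q1 q2 w <= 2%:E)%E.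
Proof.
rewrite (_ : 2%:E = (1 + 1)%:E)%E//; apply: conv_weight => // y.
rewrite !mul1r.
have [_ _ _ h1 _] := p1; have [_ _ _ h2 _] := p2.
have tri : `|w - (u - v)| <= `|w + y - u| + `|y - v|.
  by rewrite (_ : w - (u - v) = (w + y - u) - (y - v)) ?ler_normB//; ring.
apply: (@le_trans _ _ ((`|w + y - u| + `|y - v|) * (q1 (w + y) * q2 y))).
  by apply: ler_wpM2r => //; rewrite mulr_ge0.
rewrite mulrDl; apply: lerD.
  by rewrite mulrA; apply: ler_piMl.
by rewrite mulrCA; apply: ler_piMr.
Qed.

Lemma diff_conv_peak2 w :
  ((`|w - (u - v)| ^+ 2)%:E * diff_conv q1 q2 w <= (2 * (s1 + s2))%:E)%E.
Proof.
have [_ _ _ _ h1] := p1; have [_ _ _ _ h2] := p2.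
have s10 : 0 <= s1 by apply: le_trans (h1 0); rewrite mulr_ge0// exprn_ge0.
have s20 : 0 <= s2 by apply: le_trans (h2 0); rewrite mulr_ge0// exprn_ge0.
rewrite mulrDr; apply: conv_weight; rewrite ?mulr_ge0// => y.
have tri : `|w - (u - v)| ^+ 2 <= 2 * `|w + y - u| ^+ 2 + 2 * `|y - v| ^+ 2.
  rewrite !real_normK ?num_real//.
  by rewrite -subr_ge0 [leRHS](_ : _ = (w + y - u + (y - v)) ^+ 2) ?sqr_ge0//; ring.
apply: (@le_trans _ _ ((2 * `|w + y - u| ^+ 2 + 2 * `|y - v| ^+ 2) * (q1 (w + y) * q2 y))).
  by apply: ler_wpM2r => //; rewrite mulr_ge0.
rewrite mulrDl; apply: lerD.
  rewrite [leLHS](_ : _ = 2 * (`|w + y - u| ^+ 2 * q1 (w + y)) * q2 y); last by ring.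
  by apply: ler_wpM2r => //; apply: ler_wpM2l.
rewrite [leLHS](_ : _ = 2 * (`|y - v| ^+ 2 * q2 y) * q1 (w + y)); last by ring.
by apply: ler_wpM2r => //; apply: ler_wpM2l.
Qed.

Lemma smearE h : smear h q1 q2 =
  (\int[mu]_w (diff_conv q1 q2 w * (`|w| `^ (h - 1))%:E))%E.
Proof.
apply: (@integral_diff_conv (fun w => `|w| `^ (h - 1))) => [|w].
  exact: measurable_norm_powR.
exact: powR_ge0.
Qed.

Lemma smear_ge0 h : (0 <= smear h q1 q2)%E.
Proof.
apply: integral_ge0 => x _; apply: integral_ge0 => y _.
by rewrite lee_fin !mulr_ge0// powR_ge0.
Qed.

Lemma smear_le h : 0 < h -> h < 1 -> u != v ->
  (smear h q1 q2 <= (smoothing_const h * `|u - v| `^ (h - 1))%:E)%E.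
Proof.
move=> h0 h1 uv; rewrite smearE; apply: integral_powR_centered => //.
- exact: measurable_diff_conv.
- exact: diff_conv_ge0.
- exact: integral_diff_conv_le1.
- by rewrite subr_eq0.
- exact: diff_conv_peak1.
Qed.

End two_kernels.

Lemma smear_cvg h u v (e : R) : 0 < h -> h < 1 -> u != v -> 0 < e ->
  exists2 delta : R, 0 < delta & forall q1 q2 s1 s2,
    peaked u s1 q1 -> peaked v s2 q2 -> s1 <= delta -> s2 <= delta ->
    (\int[mu]_x (q1 x)%:E = 1)%E -> (\int[mu]_x (q2 x)%:E = 1)%E ->
    ((`|u - v| `^ (h - 1) - e)%:E <= smear h q1 q2 <= (`|u - v| `^ (h - 1) + e)%:E)%E.
Proof.
move=> h0 h1 uv e0.
have uv0 : u - v != 0 by rewrite subr_eq0.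
have [d d0 Hd] := integral_powR_concentrated h0 h1 uv0 e0.
(* The difference of the two points is concentrated at scale 2 (s1 + s2), hence the quarter. *)
exists (d / 4) => [|q1 q2 s1 s2 p1 p2 sd1 sd2 i1 i2]; first by rewrite divr_gt0.
rewrite (smearE p1 p2); apply: Hd.
- exact: measurable_diff_conv p1 p2.
- exact: diff_conv_ge0 p1 p2.
- by rewrite (integral_diff_conv1 p1 p2) i1 i2 mule1.
- by move=> w; apply: le_trans (diff_conv_peak2 p1 p2 w) _; rewrite lee_fin; lra.
Qed.

End smoothing.

Import HBNNSimple.
(** * Gaussian variables and square integrals *)

Section weighted_change_of_variables.
Local Open Scope ereal_scope.
Context d1 d2 d (T1 : measurableType d1) (T2 : measurableType d2) (T : measurableType d)
  (R : realType).
Variables (m1 : {measure set T1 -> \bar R}) (m2 : {measure set T2 -> \bar R}).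
Variables (Z1 : T1 -> R) (Z2 : T2 -> R) (X1 : T1 -> T) (X2 : T2 -> T).
Hypotheses (mZ1 : measurable_fun setT Z1) (mZ2 : measurable_fun setT Z2)
  (mX1 : measurable_fun setT X1) (mX2 : measurable_fun setT X2)
  (Z1_ge0 : forall w, (0 <= Z1 w)%R) (Z2_ge0 : forall w, (0 <= Z2 w)%R).
Hypothesis Z12 : forall A : set T, measurable A ->
  \int[m1]_w ((Z1 w)%:E * (\1_A (X1 w))%:E) = \int[m2]_w ((Z2 w)%:E * (\1_A (X2 w))%:E).

Let integral_weighted_nnsfun d' (T' : measurableType d') (m : {measure set T' -> \bar R})
    (Z : T' -> R) (X : T' -> T) (h : {nnsfun T >-> R}) :
  measurable_fun setT Z -> measurable_fun setT X -> (forall w, (0 <= Z w)%R) ->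
  \int[m]_w ((Z w)%:E * (h (X w))%:E) =
  \sum_(r \in range h) (r%:E * \int[m]_w ((Z w)%:E * (\1_(h @^-1` [set r]) (X w))%:E)).
Proof.
move=> mZ mX Z0.
have mI r : measurable_fun setT (fun w => (Z w)%:E * (\1_(h @^-1` [set r]) (X w))%:E).
  apply: emeasurable_funM; apply/measurable_EFinP => //.
  have mh : measurable (h @^-1` [set r]) by rewrite -[X in measurable X]setTI; exact: measurable_funP.
  have mi : measurable_fun setT (\1_(h @^-1` [set r]) : T -> R) by exact: measurable_indic.
  exact: (measurableT_comp mi mX).
transitivity (\int[m]_w (\sum_(r \in range h)
    (r%:E * ((Z w)%:E * (\1_(h @^-1` [set r]) (X w))%:E)))).
  apply: eq_integral => w _; rewrite (fimfunE h) -fsumEFin//.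
  rewrite ge0_mule_fsumr//.
    by apply: eq_fsbigr => r _; rewrite EFinM muleCA.
  by move=> r; rewrite EFinM; exact: nnfun_muleindic_ge0.
rewrite ge0_integral_fsum//; last 2 first.
- by move=> r; apply: emeasurable_funM => //; exact: measurable_cst.
- by move=> r w _; rewrite muleCA mule_ge0// ?lee_fin//; exact: nnfun_muleindic_ge0.
apply: eq_fsbigr => r; rewrite inE => -[z _ <-{r}].
rewrite ge0_integralZl//; last by rewrite lee_fin.
by move=> w _; apply: mule_ge0; rewrite lee_fin.
Qed.

(** Agreement on indicators extends to simple functions by linearity and then by monotone
    convergence. The weights are kept general for two uses: a law given by a density, and a product
    of independent factors in which one factor is varied. *)
Lemma weighted_change_of_variables (f : T -> \bar R) :
  measurable_fun setT f -> (forall x, 0 <= f x) ->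
  \int[m1]_w ((Z1 w)%:E * f (X1 w)) = \int[m2]_w ((Z2 w)%:E * f (X2 w)).
Proof.
move=> mf f0.
pose g := nnsfun_approx measurableT mf.
have cg x : (EFin \o g ^~ x) @ \oo --> f x by exact: cvg_nnsfun_approx.
have ndg : nondecreasing_seq (g : (T -> R)^nat) by exact: nd_nnsfun_approx.
have mono d' (T' : measurableType d') (m : {measure set T' -> \bar R})
    (Z : T' -> R) (X : T' -> T) : measurable_fun setT Z -> measurable_fun setT X ->
    (forall w, (0 <= Z w)%R) ->
    \int[m]_w ((Z w)%:E * (g n (X w))%:E) @[n --> \oo] --> \int[m]_w ((Z w)%:E * f (X w)).
  move=> mZ mX Z0.
  have cZ w : ((Z w)%:E * (g n (X w))%:E) @[n --> \oo] --> (Z w)%:E * f (X w).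
    by apply: cvgeZl => //; exact: cg.
  rewrite (_ : (fun w => _) = (fun w => limn (fun n => (Z w)%:E * (g n (X w))%:E))); last first.
    by apply/funext => w; apply/esym/cvg_lim => //; exact: cZ.
  apply: cvg_monotone_convergence => //.
  - move=> n; apply: emeasurable_funM; apply/measurable_EFinP => //.
    exact: (measurableT_comp (measurable_funP (g n)) mX).
  - by move=> n w _; apply: mule_ge0; rewrite lee_fin//; exact: (@fun_ge0 _ _ (g n)).
  - move=> w _ a b ab; apply: lee_wpmul2l; rewrite lee_fin//.
    exact/lefP/ndg.
have c1 := mono _ _ m1 _ _ mZ1 mX1 Z1_ge0.
have c2 := mono _ _ m2 _ _ mZ2 mX2 Z2_ge0.
rewrite -(cvg_lim _ c1)// -(cvg_lim _ c2)//; congr (lim (_ @ \oo)); apply/funext => n.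
rewrite !integral_weighted_nnsfun//; apply: eq_fsbigr => r _.
by rewrite Z12//; exact: measurable_sfunP.
Qed.
End weighted_change_of_variables.

(** * The second moment of the normal density *)

Section normal_moments.
Context {R : realType}.
Local Notation mu := (@lebesgue_measure R).

Let gk (s x : R) : R := expR (- x ^+ 2 / (s ^+ 2 *+ 2)).

Let gkE (s x : R) : gk s x = normal_fun 0 s x.
Proof. by rewrite /normal_fun subr0. Qed.

Let mgk s : measurable_fun setT (gk s).
Proof.
rewrite (_ : gk s = normal_fun 0 s); last by apply/funext => x; exact: gkE.
exact: measurable_normal_fun.
Qed.

Let dgk (s x : R) : s != 0 ->
  is_derive x 1 (fun x => - (s ^+ 2) * gk s x) (x * gk s x).
Proof.
move=> s0.
have d1 : is_derive x 1 (fun x : R => - x ^+ 2 / (s ^+ 2 *+ 2)) (- x / s ^+ 2).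
  have d2 := @is_deriveX _ _ id 2 x 1 _ (is_derive_id x 1).
  have d3 := @is_deriveZ _ _ _ _ (- (s ^+ 2 *+ 2)^-1) _ _ _ d2.
  rewrite (_ : (fun _ => _) = (- (s ^+ 2 *+ 2)^-1 \*: (fun x : R => id x ^+ 2))); last first.
    apply/funext => y.
    by change (- y ^+ 2 / (s ^+ 2 *+ 2) = - (s ^+ 2 *+ 2)^-1 * y ^+ 2 :> R); ring.
  apply: (is_derive_eq d3).
  change (- (s ^+ 2 *+ 2)^-1 * (2 * x ^+ 1 * 1) = - x / s ^+ 2 :> R).
  by rewrite -mulr_natr; field.
have d4 := is_derive_expR (- x ^+ 2 / (s ^+ 2 *+ 2)).
have d5 := @is_derive1_comp _ expR (fun x => - x ^+ 2 / (s ^+ 2 *+ 2)) x _ _ d4 d1.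
have d6 := @is_deriveZ _ _ _ _ (- s ^+ 2) _ _ _ d5.
apply: (is_derive_eq d6).
change (- s ^+ 2 * (gk s x * (- x / s ^+ 2)) = x * gk s x :> R).
by field.
Qed.

Let gk_cvg0 s : s != 0 -> gk s x @[x --> +oo] --> (0 : R).
Proof.
move=> s0.
have s2 : 0 < (s ^+ 2 *+ 2)^-1 by rewrite invr_gt0 pmulrn_lgt0// exprn_even_gt0.
apply/cvgr0Pnorm_lt => e e0.
have := @cvgr_expR R => /cvgr0Pnorm_lt/(_ _ e0) [M [Mr HM]].
near=> x.
have : M < x ^+ 2 / (s ^+ 2 *+ 2).
  rewrite -ltr_pdivrMr//.
  near: x; exists (Num.max 1 (M / (s ^+ 2 *+ 2)^-1)); split; first exact: num_real.
  move=> x; rewrite gt_max => /andP[x1 xM]; apply: (lt_le_trans xM).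
  by rewrite expr2 ler_peMr// ltW// (lt_trans ltr01).
by move=> /HM; rewrite /gk mulNr.
Unshelve. all: by end_near. Qed.

Let integral_tail s y : s != 0 -> 0 <= y ->
  (\int[mu]_(x in `[y, +oo[) (x * gk s x)%:E = (s ^+ 2 * gk s y)%:E)%E.
Proof.
move=> s0 y0.
have cgk : continuous (fun x : R => - (s ^+ 2) * gk s x).
  by move=> x; apply: differentiable_continuous; apply/derivable1_diffP; case: (dgk x s0).
have cxg : continuous (fun x : R => x * gk s x).
  move=> x; apply: cvgM; first exact: cvg_id.
  rewrite (_ : gk s = (fun x => - (s ^+ 2)^-1 * (- (s ^+ 2) * gk s x))); last first.
    by apply/funext => z; field.
  by apply: cvgM; [exact: cvg_cst|exact: cgk].
rewrite (@ge0_continuous_FTC2y _ _ (fun x => - (s ^+ 2) * gk s x) y 0).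
- by rewrite -EFinB sub0r mulNr opprK.
- by move=> x yx; rewrite mulr_ge0 ?expR_ge0// (le_trans y0).
- exact: continuous_subspaceT.
- by rewrite -(mulr0 (- s ^+ 2)); apply: cvgM; [exact: cvg_cst|exact: gk_cvg0].
- by move=> x _; case: (dgk x s0).
- by apply: cvg_at_right_filter; exact: cgk.
- by move=> x _; rewrite derive1E; have := dgk x s0 => ?; exact: derive_val.
Qed.

(* Fubini applied to [x * (x k(x)) = \int_0^x (x k(x)) dy], where
   [x k(x)] is minus the derivative of [s^2 k]. *)
Lemma integral_sqr_normal_fun s : s != 0 ->
  (\int[mu]_(x in `[0%R, +oo[) (x ^+ 2 * gk s x)%:E =
   (s ^+ 2)%:E * \int[mu]_(x in `[0%R, +oo[) (gk s x)%:E)%E.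
Proof.
move=> s0.
pose F (z : R * R) : \bar R := ((\1_`[0, +oo[ z.2 * \1_`[0, +oo[ (z.1 - z.2)) * (z.1 * gk s z.1))%:E.
have m0y : measurable (`[0, +oo[%classic : set R) by exact: measurable_itv.
have m1 : measurable_fun setT (\1_`[0, +oo[ : R -> R) by exact: measurable_indic.
have mF : measurable_fun setT F.
  apply/measurable_EFinP; apply: measurable_funM; apply: measurable_funM.
  - exact: (measurableT_comp m1).
  - by apply: (measurableT_comp m1); exact: measurable_funB.
  - exact: measurable_fst.
  - exact: (measurableT_comp (mgk s)).
have F0 z : (0 <= F z)%E.
  rewrite lee_fin /F !indicE !mem_setE !in_itv/= !andbT.
  have [y0|] := leP 0 z.2; last by rewrite !mul0r.
  have [yx|] := leP 0 (z.1 - z.2); last by rewrite mulr0 mul0r.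
  by rewrite !mul1r mulr_ge0 ?expR_ge0//; lra.
have := @fubini_tonelli _ _ _ _ R mu mu F mF F0.
rewrite (_ : (\int[mu]_x _)%E = (\int[mu]_(x in `[0%R, +oo[) (x ^+ 2 * gk s x)%:E)%E); last first.
  rewrite [RHS]integral_mkcond; apply: eq_integral => x _.
  rewrite patchE mem_setE in_itv/= andbT.
  have [x0|x0] := leP 0 x; last first.
    rewrite integral0_eq// => y _; rewrite /F/= !indicE !mem_setE !in_itv/= !andbT.
    have [y0|] := leP 0 y; last by rewrite !mul0r.
    by rewrite (_ : (0 <= x - y) = false) ?mulr0 ?mul0r//; apply/negbTE; rewrite -ltNge; lra.
  transitivity (\int[mu]_(y in `[0%R, x]) (x * gk s x)%:E)%E.
    rewrite [RHS]integral_mkcond; apply: eq_integral => y _.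
    rewrite patchE /F/= !indicE !mem_setE !in_itv/= !andbT subr_ge0.
    by case: (0 <= y); case: (y <= x); rewrite /= ?mul0r ?mulr0 ?mul0r ?mul1r.
  have -> : (\int[mu]_(_ in `[0%R, x]) (x * gk s x)%:E = (x * gk s x)%:E * mu `[0%R, x]%classic)%E.
    by rewrite integral_cst.
  rewrite lebesgue_measure_itv/= lte_fin.
  move: x0; rewrite le_eqVlt => /predU1P[<-|x0]; first by rewrite ltxx mule0 expr0n mul0r.
  by rewrite x0 oppr0 adde0 -EFinM; congr EFin; ring.
move=> ->.
transitivity (\int[mu]_(y in `[0%R, +oo[) ((s ^+ 2)%:E * (gk s y)%:E))%E.
  rewrite [RHS]integral_mkcond; apply: eq_integral => y _.
  rewrite patchE mem_setE in_itv/= andbT.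
  have [y0|y0] := leP 0 y; last first.
    rewrite integral0_eq// => x _; rewrite /F/= !indicE !mem_setE !in_itv/= !andbT.
    by rewrite leNgt y0 !mul0r.
  rewrite -EFinM -integral_tail// [RHS]integral_mkcond; apply: eq_integral => x _.
  rewrite patchE /F/= !indicE !mem_setE !in_itv/= !andbT subr_ge0 y0 mul1r.
  by case: (y <= x); rewrite /= ?mul0r ?mul1r.
rewrite ge0_integralZl//.
- have mgE : measurable_fun setT (EFin \o gk s) by exact/measurable_EFinP.
  exact: measurable_funTS mgE.
- by move=> x _; rewrite lee_fin expR_ge0.
- by rewrite lee_fin sqr_ge0.
Qed.

(** Evenness reduces both integrals to the half-line, where [integral_sqr_normal_fun] relates them;
    the normalizing factor then disappears because the density has mass 1. *)
Lemma integral_sqr_normal_pdf s : s != 0 ->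
  (\int[mu]_x (x ^+ 2 * normal_pdf 0 s x)%:E = (s ^+ 2)%:E)%E.
Proof.
move=> s0.
have pk0 := normal_peak_ge0 s.
have cgk : continuous (gk s).
  move=> x; have := @continuous_normal_pdf R 0 s s0.
  have -> : gk s = (fun x => (normal_peak s)^-1 * normal_pdf 0 s x).
    apply/funext => z; rewrite normal_pdfE// -gkE mulrA mulVf ?mul1r//.
    by rewrite gt_eqF// normal_peak_gt0.
  by move=> c; apply: cvgM; [exact: cvg_cst|exact: c].
have half (f : R -> R) : (forall x, 0 <= f x) -> continuous f -> f =1 f \o -%R ->
    (\int[mu]_x (f x)%:E = 2%:E * \int[mu]_(x in `[0%R, +oo[) (f x)%:E)%E.
  move=> f0 cf sf; rewrite ge0_symfun_integralT//.
  congr (_ * _)%E; congr integral.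
  by apply/seteqP; split=> w /=; rewrite in_itv/= andbT.
have gks : gk s =1 gk s \o -%R by move=> x; rewrite /gk/= sqrrN.
rewrite (_ : (\int[mu]_x _)%E = ((normal_peak s)%:E * \int[mu]_x (x ^+ 2 * gk s x)%:E)%E); last first.
  rewrite -ge0_integralZl//.
  - by apply: eq_integral => x _; rewrite normal_pdfE// -gkE -EFinM; congr EFin; ring.
  - apply/measurable_EFinP.
    by apply: (@measurable_funM _ R R setT (fun x => x ^+ 2) (gk s)) => //; exact: exprn_measurable.
  - by move=> x _; rewrite lee_fin mulr_ge0 ?expR_ge0 ?sqr_ge0.
rewrite half; last 3 first.
- by move=> x; rewrite mulr_ge0 ?expR_ge0 ?sqr_ge0.
- by move=> x; apply: cvgM; [exact: sqr_continuous|exact: cgk].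
- by move=> x; rewrite /= sqrrN gks.
rewrite integral_sqr_normal_fun// (muleCA 2%:E) (muleCA (normal_peak s)%:E).
rewrite -[RHS]mule1; congr (_ * _)%E.
rewrite -[RHS](integral_normal_pdf 0 s) -half//; last by move=> x; exact: expR_ge0.
rewrite -ge0_integralZl//.
- by apply: eq_integral => x _; rewrite normal_pdfE// -gkE.
- have mgE : measurable_fun setT (EFin \o gk s) by exact/measurable_EFinP.
  exact: mgE.
- by move=> x _; rewrite lee_fin expR_ge0.
Qed.

End normal_moments.

Lemma probability_eq_cdf (R : realType) (m1 m2 : {measure set (measurableTypeR R) -> \bar R}) :
  (forall x : R, m1 `]-oo, x]%classic = m2 `]-oo, x]%classic) ->
  (forall x : R, m1 `]-oo, x]%classic < +oo)%E ->
  forall A : set R, measurable A -> m1 A = m2 A.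
Proof.
move=> m12 m1oo A mA.
pose G : set (set R) := [set A | exists x : R, A = `]-oo, x]%classic].
apply: (@g_sigma_algebra_measure_unique _ R (measurableTypeR R) G _ (fun k : nat => `]-oo, k%:R]%classic)).
- by move=> _ [x ->]; exact: measurable_itv.
- by move=> k; exists k%:R.
- apply/seteqP; split => // x _; exists (Num.truncn x).+1 => //=.
  by rewrite in_itv/= ltW// truncnS_gt.
- move=> _ _ [x ->] [y ->]; exists (Num.min x y).
  apply/seteqP; split=> z /=; rewrite !in_itv/= le_min; first by case=> -> ->.
  by move=> /andP.
- by move=> _ [x ->].
- by move=> k.
- move: A mA; apply: smallest_sub; first exact: smallest_sigma_algebra.
  move=> _ [[a b] /= _ <-].
  rewrite (_ : `]a, b]%classic = `]-oo, b]%classic `\` `]-oo, a]%classic).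
    pose GT : ringOfSetsType G.-sigma := g_sigma_algebraType G.
    by apply: (@measurableD _ GT); apply: sub_sigma_algebra; [exists b|exists a].
  apply/seteqP; split=> z /=; rewrite !in_itv/=.
    by move=> /andP[az ->]; split => //; apply/negP; rewrite -ltNge.
  by move=> [-> /negP]; rewrite -ltNge => ->.
Qed.

Section real_sequences.
Context {R : realType}.

(* The two hypotheses are what the parallelogram-type inequality
   [|x + y|^2 <= (1 + t) |x|^2 + (1 + t^-1) |y|^2] gives for two quadratic
   quantities whose difference has small square [e n]. *)
Lemma quadratic_cvg (q e : R^nat) (l : R) : (forall n, 0 <= q n) -> 0 <= l ->
  e @ \oo --> 0 ->
  (forall n (t : R), 0 < t -> q n <= (1 + t) * l + (1 + t^-1) * e n) ->
  (forall n (t : R), 0 < t -> l <= (1 + t) * q n + (1 + t^-1) * e n) ->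
  q @ \oo --> l.
Proof.
move=> q0 l0 e0 ql lq.
apply/cvgrPdist_le => eps eps0.
(* The first bound, t <= 1, gives q n <= 2 l + 1 a priori once the error terms are at most 1. The
   second makes t (l + 1) at most eps / 8, so replacing the factor 1 + t by 1 costs at most eps / 8
   on [l] and eps / 4 on q n. *)
pose t : R := Num.min 1 (eps / (4 * (l + 1) * 2)).
have l1 : 0 < l + 1 by rewrite ltr_wpDl.
have t0 : 0 < t by rewrite lt_min ltr01/= divr_gt0// mulr_gt0// mulr_gt0.
have t1 : t <= 1 by rewrite ge_min lexx.
have tl : t * (l + 1) <= eps / 8.
  rewrite -ler_pdivlMr// ge_min; apply/orP; right.
  by rewrite le_eqVlt; apply/orP; left; apply/eqP; field; rewrite gt_eqF.
have ti : 0 < 1 + t^-1 by rewrite addr_gt0// invr_gt0.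
near=> n.
have en : (1 + t^-1) * `|e n| <= Num.min 1 (eps / 8).
  rewrite mulrC -ler_pdivlMr//; near: n.
  have := e0 => /cvgr0Pnorm_le; apply.
  by rewrite divr_gt0// lt_min ltr01 divr_gt0.
have en' : (1 + t^-1) * e n <= Num.min 1 (eps / 8).
  by apply: le_trans en; rewrite ler_wpM2l ?(ltW ti)// ler_norm.
move: en'; rewrite le_min => /andP[en1 en2].
have := ql n _ t0; have := lq n _ t0.
have h1 : (1 + t) * l <= l + eps / 8 by nra.
have qb : q n <= 2 * l + 1 by have := ql n _ t0; nra.
have h2 : (1 + t) * q n <= q n + eps / 4 by nra.
move=> h3 h4; rewrite ler_norml; apply/andP; split; lra.
Unshelve. all: by end_near. Qed.

End real_sequences.

(** * Second moments and mean-square convergence *)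

Section square_integrals.
Context d (T : measurableType d) (R : realType) (P : {measure set T -> \bar R}).
Implicit Types f g : T -> R.

(** The squared norm as an extended real: it is defined without integrability conditions and is a
    plain integral, so Tonelli, Fatou and domination apply directly. *)
Definition sqint f : \bar R := (\int[P]_w ((f w) ^+ 2)%:E)%E.

Arguments sqint f%_ring_scope.

Lemma sqint_ge0 f : (0 <= sqint f)%E.
Proof. by apply: integral_ge0 => w _; rewrite lee_fin sqr_ge0. Qed.

Lemma measurable_sqr f : measurable_fun setT f -> measurable_fun setT (fun w => ((f w) ^+ 2)%:E).
Proof. by move=> mf; apply/measurable_EFinP; exact: measurable_funX. Qed.

(** Pointwise the gap is (t f - g)^2 / t. The parameter stays free because [quadratic_cvg] lets it
    depend on the required precision. *)
Lemma sqintD f g (t : R) : measurable_fun setT f -> measurable_fun setT g -> 0 < t ->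
  (sqint (f \+ g) <= (1 + t)%:E * sqint f + (1 + t^-1)%:E * sqint g)%E.
Proof.
move=> mf mg t0.
have ti0 : 0 < t^-1 by rewrite invr_gt0.
have mf2 := measurable_sqr mf; have mg2 := measurable_sqr mg.
rewrite /sqint -ge0_integralZl//; last 2 first.
- by move=> w _; rewrite lee_fin sqr_ge0.
- by rewrite lee_fin addr_ge0// ltW.
rewrite -ge0_integralZl//; last 2 first.
- by move=> w _; rewrite lee_fin sqr_ge0.
- by rewrite lee_fin addr_ge0// ltW.
rewrite -ge0_integralD//; last 4 first.
- by move=> w _; rewrite -EFinM lee_fin mulr_ge0 ?sqr_ge0// addr_ge0// ltW.
- by apply: emeasurable_funM.
- by move=> w _; rewrite -EFinM lee_fin mulr_ge0 ?sqr_ge0// addr_ge0// ltW.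
- by apply: emeasurable_funM.
apply: ge0_le_integral => //.
- by move=> w _; rewrite lee_fin sqr_ge0.
- by apply: measurable_sqr; exact: measurable_funD.
- by apply: emeasurable_funD; apply: emeasurable_funM.
move=> w _; rewrite -!EFinM -EFinD lee_fin /=.
rewrite -subr_ge0 [leRHS](_ : _ = t^-1 * (t * f w - g w) ^+ 2).
  by rewrite mulr_ge0 ?sqr_ge0// ltW.
by field; rewrite gt_eqF.
Qed.

Lemma sqintD2 f g : measurable_fun setT f -> measurable_fun setT g ->
  (sqint (f \+ g) <= 2%:E * sqint f + 2%:E * sqint g)%E.
Proof.
by move=> mf mg; have := sqintD mf mg ltr01; rewrite invr1 (_ : 1 + 1 = 2)%R.
Qed.

Lemma sqintN f : sqint (fun w => - f w) = sqint f.
Proof. by apply: eq_integral => w _; rewrite sqrrN. Qed.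

Lemma sqintB2 f g : measurable_fun setT f -> measurable_fun setT g ->
  (sqint (f \- g) <= 2%:E * sqint f + 2%:E * sqint g)%E.
Proof.
move=> mf mg; rewrite -(sqintN g).
by apply: (@sqintD2 f (fun w => - g w)) => //; exact: measurable_funN.
Qed.

Lemma eq_sqint f g : (forall w, f w = g w) -> sqint f = sqint g.
Proof. by move=> fg; apply: eq_integral => w _; rewrite fg. Qed.

Lemma sqint_sub_tri f g h : measurable_fun setT f -> measurable_fun setT g ->
  measurable_fun setT h ->
  (sqint (f \- h) <= 2%:E * sqint (f \- g) + 2%:E * sqint (g \- h))%E.
Proof.
move=> mf mg mh.
rewrite (@eq_sqint (f \- h) ((f \- g) \+ (g \- h))) => [|w /=]; last by ring.
by apply: sqintD2; exact: measurable_funB.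
Qed.

(** Finiteness of the limit comes from a single index at distance less than 1; after that all second
    moments are real numbers and [quadratic_cvg] applies with the squared distance as error. *)
Lemma sqint_cvg (f : nat -> T -> R) g : (forall n, measurable_fun setT (f n)) ->
  measurable_fun setT g -> (forall n, sqint (f n) < +oo)%E ->
  sqint (f n \- g) @[n --> \oo] --> 0%E ->
  (sqint g < +oo)%E /\ fine (sqint (f n)) @[n --> \oo] --> fine (sqint g).
Proof.
move=> mf mg foo fg.
have [N _ HN] : \forall n \near \oo, (sqint (f n \- g) < 1%:E)%E.
  move/fine_cvgP : fg => [fin /cvgr0Pnorm_lt/(_ _ ltr01) lt1].
  near=> n.
  have fn : sqint (f n \- g) \is a fin_num by near: n; exact: fin.
  rewrite -(fineK fn) lte_fin -[ltLHS]ger0_norm ?fine_ge0 ?sqint_ge0//.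
  by near: n; exact: lt1.
have subC h k : sqint (h \- k) = sqint (k \- h).
  by rewrite -sqintN; apply: eq_sqint => w /=; rewrite opprB.
have goo : (sqint g < +oo)%E.
  apply: (@le_lt_trans _ _ (2%:E * sqint (g \- f N) + 2%:E * sqint (f N))%E).
    rewrite (@eq_sqint g ((g \- f N) \+ f N)) => [|w /=]; last by ring.
    by apply: sqintD2 => //; exact: measurable_funB.
  apply: lte_add_pinfty; apply: lte_mul_pinfty; rewrite ?lee_fin ?fin_numE//.
  by rewrite subC; apply: lt_trans (HN N _) (ltry _) => /=.
split => //.
have dfin n : sqint (f n \- g) \is a fin_num.
  rewrite ge0_fin_numE ?sqint_ge0//; apply: le_lt_trans (sqintB2 (mf n) mg) _.
  by apply: lte_add_pinfty; apply: lte_mul_pinfty; rewrite ?lee_fin ?fin_numE.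
have ffin n : sqint (f n) \is a fin_num by rewrite ge0_fin_numE ?sqint_ge0.
have gfin : sqint g \is a fin_num by rewrite ge0_fin_numE ?sqint_ge0.
apply: (@quadratic_cvg _ _ (fun n => fine (sqint (f n \- g)))).
- by move=> n; rewrite fine_ge0 ?sqint_ge0.
- by rewrite fine_ge0 ?sqint_ge0.
- by have /fine_cvgP[] := fg.
- move=> n t t0.
  rewrite -lee_fin EFinD !EFinM !fineK//.
  rewrite (@eq_sqint (f n) (g \+ (f n \- g))) => [|w /=]; last by ring.
  by apply: sqintD => //; exact: measurable_funB.
- move=> n t t0.
  rewrite -lee_fin EFinD !EFinM !fineK// subC.
  rewrite (@eq_sqint g (f n \+ (g \- f n))) => [|w /=]; last by ring.
  by apply: sqintD => //; exact: measurable_funB.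
Unshelve. all: by end_near. Qed.

Lemma chebyshev_sqint f (e : R) : measurable_fun setT f -> 0 < e ->
  ((e ^+ 2)%:E * P [set w | (e <= `|f w|)%R] <= sqint f)%E.
Proof.
move=> mf e0.
have := @le_integral_abse _ _ _ P setT measurableT (fun w => ((f w) ^+ 2)%:E) (e ^+ 2)
  (measurable_sqr mf) (exprn_gt0 2 e0).
rewrite setTI => H; apply: le_trans (le_trans H _).
  apply: lee_wpmul2l; first by rewrite lee_fin exprn_ge0// ltW.
  rewrite le_eqVlt; apply/orP; left; apply/eqP; congr (P _).
  have E w : (((e ^+ 2)%:E <= `|(f w ^+ 2)%:E|)%E = (e <= `|f w|)).
    rewrite gee0_abs ?lee_fin ?sqr_ge0// -(real_normK (num_real (f w))).
    by rewrite ler_pXn2r// nnegrE// ltW.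
  by apply/seteqP; split => w /=; rewrite E.
by rewrite le_eqVlt; apply/orP; left; apply/eqP; apply: eq_integral => w _; rewrite gee0_abs// lee_fin sqr_ge0.
Qed.

End square_integrals.
Arguments sqint {d T R} P f%_ring_scope.

(** * Centered Gaussian variables and their mean-square limits *)

Section gaussian_variables.
Context d (T : measurableType d) (R : realType) (P : probability T R).
Local Notation mu := (@lebesgue_measure R).
Implicit Types (X : T -> R) (v : R).

Lemma gaussian_ge0_integral X v (f : R -> \bar R) : is_gaussian P X 0 v -> v != 0 ->
  measurable_fun setT f -> (forall x, 0 <= f x)%E ->
  (\int[P]_w f (X w) = \int[mu]_x ((normal_pdf 0 (Num.sqrt v) x)%:E * f x))%E.
Proof.
move=> [mX v0 HX] vn0 mf f0.
have := @weighted_change_of_variables _ _ _ T (measurableTypeR R) R R P mu (cst 1)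
  (normal_pdf 0 (Num.sqrt v)) X id (measurable_cst _) (measurable_normal_pdf _ _) mX
  (@measurable_id _ _ _) (fun _ => ler01) (normal_pdf_ge0 _ _) _ f mf f0.
move=> H; rewrite -H.
  by apply: eq_integral => w _; rewrite mul1e.
move=> A mA.
under eq_integral => w _ do rewrite mul1e.
transitivity (P (X @^-1` A)).
  have mXA : measurable (X @^-1` A) by rewrite -[X in measurable X]setTI; exact: mX.
  by rewrite (_ : (fun w => _) = (fun w => (\1_(X @^-1` A) w)%:E))// integral_indic// setIT.
rewrite HX// /gaussian_law (negbTE vn0) /normal_prob [LHS]integral_mkcond.
by apply: eq_integral => x _; rewrite patchE indicE; case: ifP => _; rewrite ?mule1 ?mule0.
Qed.

Lemma gaussian0_ae X : is_gaussian P X 0 0 -> {ae P, forall w, X w = 0}.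
Proof.
move=> [mX _ HX].
exists (X @^-1` [set~ 0]); split.
- by rewrite -[X in measurable X]setTI; apply: mX => //; exact: measurableC.
- rewrite HX; last exact: measurableC.
  by rewrite /gaussian_law eqxx diracE memNset//; apply.
- by move=> w /= ?.
Qed.

Lemma gaussian_sqint X v : is_gaussian P X 0 v -> sqint P X = v%:E.
Proof.
move=> gX; have [mX v0 _] := gX.
have [v00|vn0] := eqVneq v 0.
  rewrite v00 in gX *.
  rewrite /sqint (ae_eq_integral (cst 0%E))//.
  - by rewrite integral0.
  - exact: measurable_sqr.
  - by have := gaussian0_ae gX; apply: filterS => w -> _; rewrite expr0n.
have mq : measurable_fun setT (fun x : R => (x ^+ 2)%:E).
  by apply/measurable_EFinP; exact: exprn_measurable.
rewrite /sqint (gaussian_ge0_integral (f := fun x => (x ^+ 2)%:E) gX)//; last first.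
  by move=> x; rewrite lee_fin sqr_ge0.
have s0 : Num.sqrt v != 0 by rewrite sqrtr_eq0 -ltNge lt_neqAle eq_sym vn0.
transitivity ((Num.sqrt v ^+ 2)%:E)%E; last by rewrite sqr_sqrtr.
rewrite -integral_sqr_normal_pdf//.
by apply: eq_integral => x _; rewrite -EFinM mulrC.
Qed.

Lemma gaussian_mean0 X v : is_gaussian P X 0 v -> ('E_P[X] = 0)%E.
Proof.
move=> gX; have [mX v0 _] := gX.
have mXE : measurable_fun setT (EFin \o X) by exact/measurable_EFinP.
rewrite unlock.
have [v00|vn0] := eqVneq v 0.
  rewrite v00 in gX *.
  rewrite (ae_eq_integral (cst 0%E))//.
  - by rewrite integral0.
  - by have := gaussian0_ae gX; apply: filterS => w /= -> _.
(* The normal density is even, so positive and negative parts have equal integrals; subtracting them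
   is legitimate because max(x, 0) <= 1 + x^2. *)
have sym (f : R -> \bar R) : measurable_fun setT f -> (forall x, 0 <= f x)%E ->
    (\int[P]_w f (X w) = \int[P]_w f (- X w)%R)%E.
  move=> mf f0; rewrite (gaussian_ge0_integral (f := f) gX)//.
  have mfN : measurable_fun setT (fun x : R => f (- x)).
    by apply: (measurableT_comp mf); exact: measurable_funN.
  rewrite (gaussian_ge0_integral (f := fun x : R => f (- x)) gX)//.
  rewrite -ge0_integral_opp.
  - apply: eq_integral => x _; congr (_%:E * _)%E.
    have s0 : Num.sqrt v != 0 by rewrite sqrtr_eq0 -ltNge lt_neqAle eq_sym vn0.
    by rewrite !normal_pdfE// /normal_fun !subr0 sqrrN.
  - by apply: emeasurable_funM => //; apply/measurable_EFinP; exact: measurable_normal_pdf.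
  - by move=> x; rewrite mule_ge0// lee_fin normal_pdf_ge0.
rewrite integralE.
have mpos : measurable_fun setT (fun x : R => (Num.max x 0)%:E).
  by apply/measurable_EFinP; apply: measurable_maxr => //; exact: measurable_cst.
have := sym _ mpos => H.
rewrite (_ : (\int[P]_w (_^\+)%E w)%E = (\int[P]_w (Num.max (X w) 0)%:E)%E); last first.
  by apply: eq_integral => w _; rewrite funeposE/= EFin_max.
rewrite (_ : (\int[P]_w (_^\-)%E w)%E = (\int[P]_w (Num.max (- X w) 0)%:E)%E); last first.
  by apply: eq_integral => w _; rewrite funenegE/= EFin_max.
rewrite H; last by move=> x; rewrite lee_fin le_max lexx orbT.
rewrite subee// ge0_fin_numE; last by apply: integral_ge0 => w _; rewrite lee_fin le_max lexx orbT.
apply: (@le_lt_trans _ _ (\int[P]_w (1 + (X w ^+ 2)%:E))%E).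
  apply: ge0_le_integral => //.
  - by move=> w _; rewrite lee_fin le_max lexx orbT.
  - by apply/measurable_EFinP; apply: measurable_maxr => //; exact: measurable_funN.
  - by apply: emeasurable_funD => //; exact: measurable_sqr.
  - move=> w _; rewrite -EFinD lee_fin ge_max; apply/andP; split; last by rewrite addr_ge0// sqr_ge0.
    by rewrite -subr_ge0 (_ : _ - _ = (X w + 2^-1) ^+ 2 + 3 / 4) ?addr_ge0// ?sqr_ge0//; field.
rewrite ge0_integralD//; last 2 first.
- by move=> w _; rewrite lee_fin sqr_ge0.
- exact: measurable_sqr.
have -> : (\int[P]_w 1 = 1 * P setT)%E by rewrite integral_cst.
rewrite mul1e probability_setT -/(sqint P X) (gaussian_sqint gX).
by rewrite -EFinD ltry.
Qed.

Section gaussian_limit.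
Variables (X : nat -> T -> R) (v : R^nat) (Y : T -> R).
Hypothesis gX : forall n, is_gaussian P (X n) 0 (v n).
Hypothesis mY : measurable_fun setT Y.
Hypothesis XY : sqint P (X n \- Y) @[n --> \oo] --> 0%E.

Let mX n : measurable_fun setT (X n). Proof. by have [] := gX n. Qed.

Let sqX n : sqint P (X n) = (v n)%:E. Proof. exact: gaussian_sqint. Qed.

Let limits : (sqint P Y < +oo)%E /\ v @ \oo --> fine (sqint P Y).
Proof.
have [|Yoo cv] := @sqint_cvg _ _ _ P X Y mX mY _ XY; first by move=> n; rewrite sqX ltry.
split=> //; move: cv; rewrite (_ : (fun n => _) = v)//.
by apply/funext => n; rewrite sqX.
Qed.

Lemma gaussian_limit_degenerate : fine (sqint P Y) = 0 -> is_gaussian P Y 0 0.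
Proof.
have [Yoo _] := limits => Y0.
have fY : sqint P Y \is a fin_num by rewrite ge0_fin_numE ?sqint_ge0.
have {}Y0 : sqint P Y = 0%E by rewrite -(fineK fY) Y0.
have Yae : {ae P, forall w, Y w = 0}.
  have := (@ae_eq_integral_abs _ _ _ P setT measurableT _ (measurable_sqr mY)).1.
  move=> H; have {H} : ae_eq P setT (fun w => ((Y w) ^+ 2)%:E) (cst 0%E).
    apply: H; rewrite -[RHS]Y0; apply: eq_integral => w _.
    by rewrite gee0_abs// lee_fin sqr_ge0.
  by apply: filterS => w /= /(_ I) [] /eqP; rewrite sqrf_eq0 => /eqP.
split=> // A mA; rewrite /gaussian_law eqxx.
have mYA : measurable (Y @^-1` A) by rewrite -[X in measurable X]setTI; exact: mY.
have neg (B : set R) : measurable B -> ~ B 0 -> P (Y @^-1` B) = 0%E.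
  move=> mB B0; apply: measure_negligible.
    by rewrite -[X in measurable X]setTI; exact: mY.
  by apply: negligibleS Yae => w /= Bw; rewrite /setC/= => Yw0; apply: B0; rewrite -Yw0.
rewrite diracE; have [|A0] := boolP (0 \in A); rewrite ?inE; last first.
  by rewrite notin_setE in A0; rewrite neg.
move=> A0; rewrite -[Y @^-1` A]setCK probability_setC; last exact: measurableC.
by rewrite (neg (~` A)) ?sube0//; exact: measurableC.
Qed.

Let N (s : R) (y : R) : \bar R := normal_prob 0 (Num.sqrt s) `]-oo, y]%classic.

(** Dominated convergence of the densities: once the variances lie in [s / 2, 2 s], each density is
    at most a constant times the density of variance 2 s. *)
Let N_cvg (s : R) (y : R) : 0 < s -> v @ \oo --> s -> N (v n) y @[n --> \oo] --> N s y.
Proof.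
move=> s0 vs.
have pi0 := @pi_gt0 R.
have [M _ HM] : \forall n \near \oo, s / 2 <= v n <= 2 * s.
  near=> n; apply/andP; split; near: n.
    by apply: (cvgr_ge s) => //; lra.
  by apply: (cvgr_le s) => //; lra.
pose q (r x : R) : R := (Num.sqrt (r * pi *+ 2))^-1 * expR (- x ^+ 2 / (r *+ 2)).
have qE r x : 0 < r -> normal_pdf 0 (Num.sqrt r) x = q r x.
  move=> r0; rewrite normal_pdfE ?sqrtr_eq0 -?ltNge//.
  by rewrite /normal_peak /normal_fun subr0 sqr_sqrtr// ltW.
have q0 r x : 0 <= q r x by rewrite mulr_ge0 ?invr_ge0 ?sqrtr_ge0 ?expR_ge0.
have mq r : 0 < r -> measurable_fun setT (q r).
  move=> r0; rewrite (_ : q r = normal_pdf 0 (Num.sqrt r)); first exact: measurable_normal_pdf.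
  by apply/funext => x; rewrite qE.
have s20 : 0 < s / 2 by rewrite divr_gt0.
have s2' : 0 < 2 * s by rewrite mulr_gt0.
(* The prefactor of the density of variance s / 2 divided by that of variance 2 s, the two extreme
   values allowed by [HM]. *)
pose C : R := (Num.sqrt (s / 2 * pi *+ 2))^-1 * Num.sqrt (2 * s * pi *+ 2).
have C0 : 0 <= C by rewrite mulr_ge0 ?invr_ge0 ?sqrtr_ge0.
have qC r x : s / 2 <= r <= 2 * s -> q r x <= C * q (2 * s) x.
  move=> /andP[r1 r2]; have r0 := lt_le_trans s20 r1.
  have p2 : 0 < Num.sqrt (2 * s * pi *+ 2) by rewrite sqrtr_gt0 pmulrn_lgt0// !mulr_gt0.
  rewrite /C /q mulrA mulfK ?gt_eqF//; apply: ler_pM; rewrite ?invr_ge0 ?sqrtr_ge0 ?expR_ge0//.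
    rewrite lef_pV2 ?posrE ?sqrtr_gt0 ?pmulrn_lgt0// ?mulr_gt0//.
    by rewrite ler_wsqrtr// lerMn2r/= ler_wpM2r// ltW.
  rewrite ler_expR !mulNr lerN2 ler_wpM2l ?sqr_ge0// lef_pV2 ?posrE ?pmulrn_lgt0//.
  by rewrite lerMn2r.
have mD : measurable (`]-oo, y]%classic : set R) by exact: measurable_itv.
have cvN := @dominated_convergence _ (measurableTypeR R) R mu _ mD
  (fun n x => (q (v (n + M)%N) x)%:E) (fun x => (q s x)%:E) (fun x => (C * q (2 * s) x)%:E).
have vM n : s / 2 <= v (n + M)%N <= 2 * s by apply: HM; rewrite /= leq_addl.
have vM0 n : 0 < v (n + M)%N by have /andP[+ _] := vM n; exact: lt_le_trans.
have [] := cvN.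
- by move=> n; apply: measurable_funTS; apply/measurable_EFinP; exact: mq.
- by apply: measurable_funTS; apply/measurable_EFinP; exact: mq.
- apply/aeW => x _; apply: cvg_EFin; first by near=> n.
  have vsM : v (n + M)%N @[n --> \oo] --> s by rewrite cvg_shiftn.
  have csq : Num.sqrt (v (n + M)%N * pi *+ 2) @[n --> \oo] --> Num.sqrt (s * pi *+ 2).
    apply: (@cvg_comp _ _ _ (fun n => v (n + M)%N * pi *+ 2) Num.sqrt _ (nbhs (s * pi *+ 2))).
      by apply: cvgMn; apply: cvgM => //; exact: cvg_cst.
    exact: sqrt_continuous.
  apply: cvgM.
    by apply: cvgV => //; rewrite sqrtr_eq0 -ltNge pmulrn_lgt0// mulr_gt0.
  apply: (@cvg_comp _ _ _ (fun n => - x ^+ 2 / (v (n + M)%N *+ 2)) expR _ (nbhs (- x ^+ 2 / (s *+ 2)))).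
    apply: cvgM; first exact: cvg_cst.
    by apply: cvgV; [rewrite gt_eqF// pmulrn_lgt0|exact: cvgMn].
  exact: continuous_expR.
- apply/integrableP; split.
    apply: measurable_funTS; apply/measurable_EFinP; apply: measurable_funM => //; exact: mq.
  under eq_integral => x _ do rewrite gee0_abs ?lee_fin ?mulr_ge0// EFinM.
  rewrite ge0_integralZl//; last 2 first.
  + by apply: measurable_funTS; apply/measurable_EFinP; exact: mq.
  + by move=> x _; rewrite lee_fin.
  apply: lte_mul_pinfty; rewrite ?lee_fin//.
  apply: (@le_lt_trans _ _ (\int[mu]_x (normal_pdf 0 (Num.sqrt (2 * s)) x)%:E)%E).
    apply: (@le_trans _ _ (\int[mu]_x (q (2 * s) x)%:E)%E).
      apply: ge0_subset_integral => //.
      + by apply/measurable_EFinP; exact: mq.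
      + by move=> x _; rewrite lee_fin.
    by rewrite le_eqVlt; apply/orP; left; apply/eqP; apply: eq_integral => x _; rewrite qE.
  by rewrite integral_normal_pdf ltry.
- by apply/aeW => n x _; rewrite gee0_abs ?lee_fin// qC.
move=> _ _ lim.
rewrite -(cvg_shiftn M).
rewrite (_ : N s y = \int[mu]_(x in `]-oo, y]) (q s x)%:E)%E; last first.
  by rewrite /N /normal_prob; apply: eq_integral => x _; rewrite qE.
rewrite (_ : (fun n => _) = (fun n => \int[mu]_(x in `]-oo, y]) (q (v (n + M)%N) x)%:E)%E)//.
by apply/funext => n; rewrite /N /normal_prob; apply: eq_integral => x _; rewrite qE.
Unshelve. all: by end_near. Qed.

(** The variances converge to the second moment of [Y]. If that is positive, the distribution
    functions of X n converge to a normal one, and Chebyshev encloses the distribution function of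
    [Y] between normal ones shifted by eta; as the normal density is bounded by its peak, the shift
    vanishes with eta. A zero second moment means a Dirac mass and is treated apart. *)
Lemma gaussian_limit : is_gaussian P Y 0 (fine (sqint P Y)).
Proof.
have [s0|s0] := eqVneq (fine (sqint P Y)) 0; first by rewrite s0; exact: gaussian_limit_degenerate.
have [Yoo cv] := limits.
set s := fine _ in s0 cv *.
have s0' : 0 < s by rewrite lt_neqAle eq_sym s0 fine_ge0// sqint_ge0.
have [M _ HM] : \forall n \near \oo, 0 < v n by apply: (cvgr_gt s).
have XP n y : 0 < v n -> P (X n @^-1` `]-oo, y]%classic) = N (v n) y.
  move=> vn; have [_ _ ->] := gX n; last exact: measurable_itv.
  by rewrite /gaussian_law gt_eqF.
have N_cv y := @N_cvg s y s0' cv.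
have sq0 : Num.sqrt s != 0 by rewrite sqrtr_eq0 -ltNge.
have N_lip y eta : 0 < eta -> (N s (y + eta) <= N s y + (normal_peak (Num.sqrt s) * eta)%:E)%E.
  move=> eta0; rewrite /N /normal_prob.
  rewrite (_ : `]-oo, y + eta]%classic = `]-oo, y]%classic `|` `]y, y + eta]%classic); last first.
    by rewrite -itv_bndbnd_setU// bnd_simp lerDl ltW.
  have mp (D : set R) : measurable_fun D (fun x => (normal_pdf 0 (Num.sqrt s) x)%:E).
    by apply: measurable_funTS; apply/measurable_EFinP; exact: measurable_normal_pdf.
  rewrite ge0_integral_setU//; last 3 first.
  - exact: mp.
  - by move=> x _; rewrite lee_fin normal_pdf_ge0.
  - apply/disj_setPLR => w /=; rewrite !in_itv/= => wy.
    by apply/negP; rewrite negb_and -leNgt wy.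
  apply: leeD => //.
  apply: (@le_trans _ _ (\int[mu]_(x in `]y, (y + eta)%R]) (normal_peak (Num.sqrt s))%:E)%E).
    apply: ge0_le_integral => //.
    - by move=> x _; rewrite lee_fin normal_pdf_ge0.
    - exact: mp.
    - by move=> x _; rewrite lee_fin normal_pdf_ub.
  have -> : (\int[mu]_(x in `]y, (y + eta)%R]) (normal_peak (Num.sqrt s))%:E =
      (normal_peak (Num.sqrt s))%:E * mu `]y, (y + eta)%R]%classic)%E by rewrite integral_cst.
  rewrite lebesgue_measure_itv/= lte_fin ltrDl eta0 -EFinB -EFinM lee_fin.
  by rewrite (addrC y) addrK.
have close (n : nat) eta : 0 < eta ->
    (P [set w | (eta <= `|(X n \- Y) w|)%R] <= (eta ^- 2)%:E * sqint P (X n \- Y))%E.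
  move=> eta0; rewrite lee_pdivlMl ?exprn_gt0//.
  by apply: chebyshev_sqint => //; exact: measurable_funB.
have mle (Z : T -> R) y : measurable_fun setT Z -> measurable (Z @^-1` `]-oo, y]%classic).
  by move=> mZ; rewrite -[X in measurable X]setTI; apply: mZ => //; exact: measurable_itv.
have mfar (n : nat) eta : measurable [set w | (eta <= `|(X n \- Y) w|)%R].
  have mXY : measurable_fun setT (fun w => `|(X n \- Y) w|).
    by apply: measurableT_comp => //; exact: measurable_funB.
  rewrite (_ : [set w | _] = setT `&` (fun w => `|(X n \- Y) w|) @^-1` `[eta, +oo[%classic); last first.
    by rewrite setTI; apply/seteqP; split => w /=; rewrite in_itv/= andbT.
  by apply: mXY => //; exact: measurable_itv.
have transfer (A B : T -> R) (n : nat) y eta : 0 < eta ->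
    measurable_fun setT A -> measurable_fun setT B ->
    (forall w, `|A w - B w| = `|(X n \- Y) w|) ->
    (P (A @^-1` `]-oo, y]%classic) <=
     P (B @^-1` `]-oo, (y + eta)%R]%classic) + (eta ^- 2)%:E * sqint P (X n \- Y))%E.
  move=> eta0 mA mB AB.
  apply: le_trans (leeD (lexx _) (close n eta eta0)).
  apply: le_trans (measureU2 _ _ _); rewrite ?le_measure ?inE//; try exact: mle.
    by apply: measurableU; [exact: mle|exact: mfar].
  move=> w /=; rewrite !in_itv/= => Ay.
  have [far|near] := leP eta `|A w - B w|; first by right; rewrite -AB.
  by left; move: near; rewrite ltr_norml => /andP[? ?]; lra.
have err eta : 0 < eta -> ((eta ^- 2)%:E * sqint P (X n \- Y))%E @[n --> \oo] --> 0%E.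
  by move=> eta0; rewrite -[X in _ --> X](mule0 (eta ^- 2)%:E); exact: cvgeZl.
have errD (u : (\bar R)^nat) (l : \bar R) eta : 0 < eta -> u @ \oo --> l ->
    (0 <= l)%E -> (u n + (eta ^- 2)%:E * sqint P (X n \- Y))%E @[n --> \oo] --> l.
  move=> eta0 ul l0; rewrite -[X in _ --> X]adde0; apply: cvgeD => //; last exact: err.
  by rewrite fin_num_adde_defl.
have N0 y : (0 <= N s y)%E by exact: measure_ge0.
have up y eta : 0 < eta -> (P (Y @^-1` `]-oo, y]%classic) <= N s (y + eta))%E.
  move=> eta0.
  have cvu := errD _ _ _ eta0 (N_cv (y + eta)) (N0 _).
  rewrite -(cvg_lim _ cvu)//; apply: lime_ge; first by apply/cvg_ex; exists (N s (y + eta)).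
  exists M => // n /= Mn; rewrite -XP; last exact: HM.
  by apply: transfer => // w /=; rewrite distrC.
have down y eta : 0 < eta -> (N s y <= P (Y @^-1` `]-oo, (y + eta)%R]%classic))%E.
  move=> eta0.
  have cvu := N_cv y.
  have cvr : (P (Y @^-1` `]-oo, (y + eta)%R]%classic) +
      (eta ^- 2)%:E * sqint P (X n \- Y))%E @[n --> \oo] -->
      P (Y @^-1` `]-oo, (y + eta)%R]%classic).
    by apply: errD => //; exact: cvg_cst.
  apply: (lee_cvg_to cvu cvr).
  exists M => // n /= Mn; rewrite -XP; last exact: HM.
  exact: transfer.
have cdfE y : P (Y @^-1` `]-oo, y]%classic) = N s y.
  have pk0 := normal_peak_ge0 (Num.sqrt s).
  have sh (e : R) : 0 < e -> exists2 eta : R, 0 < eta & normal_peak (Num.sqrt s) * eta <= e.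
    move=> e0; exists (e / (normal_peak (Num.sqrt s) + 1)).
      by rewrite divr_gt0// ltr_wpDl.
    by rewrite mulrCA ler_piMr ?(ltW e0)// ler_pdivrMr ?ltr_wpDl// mul1r lerDl.
  apply/eqP; rewrite eq_le; apply/andP; split; apply/lee_addgt0Pr => e e0.
    have [eta eta0 He] := sh e e0.
    apply: le_trans (up y eta eta0) (le_trans (N_lip y eta eta0) _).
    by apply: leeD => //; rewrite lee_fin.
  have [eta eta0 He] := sh e e0.
  have := down (y - eta) eta eta0; rewrite subrK => dn.
  have := N_lip (y - eta) eta eta0; rewrite subrK => lp.
  by apply: le_trans lp _; apply: leeD => //; rewrite lee_fin.
split=> //; first exact: ltW.
move=> A mA; rewrite /gaussian_law gt_eqF//.
apply: (@probability_eq_cdf R (pushforward P (Y : T -> measurableTypeR R)) (normal_prob 0 (Num.sqrt s))) => //.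
by move=> y; rewrite /pushforward; apply: le_lt_trans (probability_le1 _ _) (ltry _); exact: mle.
Qed.

End gaussian_limit.

End gaussian_variables.

(** * Energies, step functions and the Wiener integral *)

Section rectangles.
Context {R : realType} (d : nat).
Variables (H0 : R) (H : 'I_d -> R).
Hypotheses (hH0 : 2^-1 < H0 < 1) (hH : forall i, 2^-1 < H i < 1).
Local Notation mu := (@lebesgue_measure R).
Local Notation spacetime := (measurableTypeR R * d.-tuple R)%type.
Local Notation M := (prodm (lebesgue_spacetime R d) (lebesgue_spacetime R d)).
Local Notation half2 := (@halfspace R d `*` @halfspace R d).

Lemma measurable_halfspace : measurable (@halfspace R d).
Proof.
rewrite (_ : @halfspace R d = setT `&` fst @^-1` `[0, +oo[%classic).
  have mfst := @measurable_fst _ _ (measurableTypeR R) (d.-tuple R).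
  by apply: mfst => //; exact: measurable_itv.
by rewrite setTI; apply/seteqP; split => p; rewrite /halfspace/= in_itv/= andbT.
Qed.

Lemma measurable_half2 : measurable half2.
Proof. by apply: measurableX; exact: measurable_halfspace. Qed.

Lemma measurable_kernelH : measurable_fun [set: spacetime * spacetime]
  (fun pq => kernelH H0 H pq.1 pq.2).
Proof.
apply: measurable_funM.
  have m1 : measurable_fun [set: spacetime * spacetime] (fun pq => pq.1.1 - pq.2.1).
    apply: measurable_funB.
      exact: (measurableT_comp measurable_fst measurable_fst).
    exact: (measurableT_comp measurable_fst measurable_snd).
  exact: (measurableT_comp (measurable_norm_powR _) m1).
apply: measurable_prod => i _.
have m1 : measurable_fun [set: spacetime * spacetime]
    (fun pq => tnth pq.1.2 i - tnth pq.2.2 i).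
  apply: measurable_funB.
    exact: (measurableT_comp (measurable_tnth i) (measurableT_comp measurable_snd measurable_fst)).
  exact: (measurableT_comp (measurable_tnth i) (measurableT_comp measurable_snd measurable_snd)).
exact: (measurableT_comp (measurable_norm_powR _) m1).
Qed.

Lemma kernelH_ge0 p q : 0 <= kernelH H0 H p q.
Proof. by rewrite mulr_ge0 ?powR_ge0// prodr_ge0// => i _; exact: powR_ge0. Qed.

Lemma integral_tensor_kernelH (f0 g0 : R -> R) (f g : 'I_d -> R -> R) :
  measurable_fun setT f0 -> measurable_fun setT g0 ->
  (forall i, measurable_fun setT (f i)) -> (forall i, measurable_fun setT (g i)) ->
  (forall x, 0 <= f0 x) -> (forall x, 0 <= g0 x) ->
  (forall i x, 0 <= f i x) -> (forall i x, 0 <= g i x) ->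
  (\int[M]_pq ((f0 pq.1.1 * \prod_(i < d) f i (tnth pq.1.2 i)) *
    (g0 pq.2.1 * \prod_(i < d) g i (tnth pq.2.2 i)) * kernelH H0 H pq.1 pq.2)%R%:E =
  (\int[mu]_x \int[mu]_y (f0 x * g0 y * `|x - y| `^ (2 * H0 - 2))%R%:E) *
   \prod_(i < d) \int[mu]_x \int[mu]_y (f i x * g i y * `|x - y| `^ (2 * H i - 2))%R%:E)%E.
Proof.
move=> mf0 mg0 mf mg f00 g00 f_ge0 g_ge0.
have m2 (a b : R -> R) (r : R) : measurable_fun setT a -> measurable_fun setT b ->
    measurable_fun [set: R * R] (fun z : R * R => (a z.1 * b z.2 * `|z.1 - z.2| `^ r)%:E).
  move=> ma mb; apply/measurable_EFinP; apply: measurable_funM; first apply: measurable_funM.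
  - exact: (measurableT_comp ma).
  - exact: (measurableT_comp mb).
  - apply: (measurableT_comp (measurable_norm_powR r)); exact: measurable_funB.
rewrite -(@integral_spacetime_pairs R d
  (fun z => (f0 z.1 * g0 z.2 * `|z.1 - z.2| `^ (2 * H0 - 2))%:E)
  (fun i z => (f i z.1 * g i z.2 * `|z.1 - z.2| `^ (2 * H i - 2))%:E)).
- apply: eq_integral => -[[t x] [s y]] _ /=.
  rewrite prodEFin -EFinM; congr EFin.
  rewrite /kernelH/= !big_split/=; ring.
- exact: m2.
- by move=> z; rewrite lee_fin !mulr_ge0// powR_ge0.
- by move=> i; exact: m2.
- by move=> i z; rewrite lee_fin !mulr_ge0// powR_ge0.
Qed.

(** The covariance of the increments over ]a, b] and ]c, e] of a fractional Brownian motion of Hurst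
    parameter [h]. *)
Definition fbm_rect (h a b c e : R) : R :=
  2^-1 * (`|e - a| `^ (2 * h) - `|e - b| `^ (2 * h) - `|c - a| `^ (2 * h) + `|c - b| `^ (2 * h)).

Lemma integral_fbm_rect (h a b c e : R) : 2^-1 < h < 1 -> a <= b -> c <= e ->
  (\int[mu]_x \int[mu]_y
     (\1_`]a, b] x * \1_`]c, e] y * `|x - y| `^ (2 * h - 2))%R%:E =
   ((h * (2 * h - 1))^-1 * fbm_rect h a b c e)%:E)%E.
Proof.
move=> /andP[h1 h2] ab ce.
have hp : 0 < 2 * h - 1 by lra.
have e1 : 2 * h - 2 = 2 * h - 1 - 1 by ring.
have e2 : 2 * h - 1 + 1 = 2 * h by ring.
transitivity (\int[mu]_(x in `]a, b]) \int[mu]_(y in `]c, e]) (`|x - y| `^ (2 * h - 1 - 1))%:E)%E.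
  rewrite [RHS]integral_mkcond; apply: eq_integral => x _.
  rewrite patchE indicE; case: ifP => xab.
    rewrite [RHS]integral_mkcond; apply: eq_integral => y _.
    by rewrite patchE indicE -e1; case: ifP; rewrite ?mul1r ?mul0r.
  by rewrite integral0_eq// => y _; rewrite !mul0r.
rewrite integral_sub_powR_rect// e2; congr EFin; rewrite /fbm_rect.
by field; rewrite !gt_eqF//; lra.
Qed.

Lemma alphaH_gt0 : 0 < alphaH H0 H.
Proof.
have pos (h : R) : 2^-1 < h < 1 -> 0 < h * (2 * h - 1).
  by move=> /andP[? ?]; rewrite mulr_gt0//; lra.
by rewrite /alphaH mulr_gt0 ?pos// prodr_gt0// => i _; exact: pos.
Qed.

Lemma indic_rect (r : rectangle d) (p : spacetime) :
  \1_(rect_set r) p = \1_`]rs r, rt r] p.1 *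
    \prod_(i < d) \1_`]tnth (rx r) i, tnth (ry r) i] (tnth p.2 i) :> R.
Proof.
rewrite indicE; case: (boolP (p \in rect_set r)) => [|]; rewrite ?inE.
  move=> [pt px]; rewrite indicE mem_set/= ?in_itv//= mul1r big1// => i _.
  by rewrite indicE mem_set//= in_itv/= px.
rewrite notin_setE => np.
have [pt|pt] := boolP (rs r < p.1 <= rt r); last first.
  by rewrite indicE memNset ?mul0r//= in_itv/=; exact/negP.
rewrite indicE mem_set/= ?in_itv//= mul1r; apply/esym/eqP.
have [i ni] : exists i, ~ (tnth (rx r) i < tnth p.2 i <= tnth (ry r) i).
  by apply/not_existsP => all; apply: np; split => // i; apply: contrapT; exact: all.
by apply/eqP; rewrite (bigD1 i)//= indicE memNset ?mul0r//= in_itv/=.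
Qed.

Lemma measurable_indic_rect (r : rectangle d) :
  measurable_fun [set: spacetime] (\1_(rect_set r) : _ -> R).
Proof.
rewrite (_ : \1_(rect_set r) = (fun p : spacetime => \1_`]rs r, rt r] p.1 *
    \prod_(i < d) \1_`]tnth (rx r) i, tnth (ry r) i] (tnth p.2 i))); last first.
  by apply/funext => p; exact: indic_rect.
apply: measurable_funM.
  have m1 : measurable_fun setT (\1_`]rs r, rt r] : R -> R) by exact: measurable_indic.
  exact: (measurableT_comp m1 measurable_fst).
apply: measurable_prod => i _.
have m1 : measurable_fun setT (\1_`]tnth (rx r) i, tnth (ry r) i] : R -> R) by exact: measurable_indic.
exact: (measurableT_comp m1 (measurableT_comp (measurable_tnth i) measurable_snd)).
Qed.

(** Each direction contributes the covariance of one-dimensional increments divided by h (2 h - 1);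
    the normalization [alphaH] is exactly the product of these denominators. *)
Lemma innerH_rect (r r' : rectangle d) :
  innerH H0 H (\1_(rect_set r)) (\1_(rect_set r')) =
  fbm_rect H0 (rs r) (rt r) (rs r') (rt r') *
  \prod_(i < d) fbm_rect (H i) (tnth (rx r) i) (tnth (ry r) i) (tnth (rx r') i) (tnth (ry r') i).
Proof.
rewrite /innerH /Rintegral.
have -> : (\int[M]_(pq in half2)
    (\1_(rect_set r) pq.1 * \1_(rect_set r') pq.2 * kernelH H0 H pq.1 pq.2)%:E =
  \int[M]_pq ((\1_`]rs r, rt r] pq.1.1 *
      \prod_(i < d) \1_`]tnth (rx r) i, tnth (ry r) i] (tnth pq.1.2 i)) *
    (\1_`]rs r', rt r'] pq.2.1 *
      \prod_(i < d) \1_`]tnth (rx r') i, tnth (ry r') i] (tnth pq.2.2 i)) *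
    kernelH H0 H pq.1 pq.2)%R%:E)%E.
  rewrite integral_mkcond; apply: eq_integral => pq _.
  rewrite patchE -!indic_rect; case: ifPn => //.
  rewrite notin_setE => npq; congr EFin; apply/esym.
  have [h1|h1] := boolP (pq.1 \in rect_set r); last by rewrite indicE (negbTE h1) !mul0r.
  have [h2|h2] := boolP (pq.2 \in rect_set r'); last by rewrite [X in _ * X * _]indicE (negbTE h2) mulr0 mul0r.
  case: npq; move: h1 h2; rewrite !inE => -[/andP[h1 _] _] [/andP[h2 _] _].
  split; rewrite /halfspace/= ltW//.
    exact: le_lt_trans (rs_ge0 _) h1.
  exact: le_lt_trans (rs_ge0 _) h2.
have mi (a b : R) : measurable_fun setT (\1_`]a, b] : R -> R) by exact: measurable_indic.
have i0 (a b x : R) : (0 : R) <= \1_`]a, b] x by rewrite indicE.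
rewrite (@integral_tensor_kernelH (\1_`]rs r, rt r]) (\1_`]rs r', rt r'])
  (fun i => \1_`]tnth (rx r) i, tnth (ry r) i])
  (fun i => \1_`]tnth (rx r') i, tnth (ry r') i]))//.
rewrite integral_fbm_rect ?rs_le_rt//.
under eq_bigr => i _ do rewrite integral_fbm_rect ?rx_le_ry//.
rewrite prodEFin -EFinM/= big_split/= /alphaH.
have pos (h : R) : 2^-1 < h < 1 -> h * (2 * h - 1) != 0.
  by move=> /andP[? ?]; rewrite gt_eqF// mulr_gt0//; lra.
have pp : \prod_(i < d) (H i * (2 * H i - 1)) != 0.
  by apply/prodf_neq0 => i _; exact: pos.
have -> : \prod_(i < d) (H i * (2 * H i - 1))^-1 = (\prod_(i < d) (H i * (2 * H i - 1)))^-1.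
  by rewrite prodfV.
set a := H0 * _; have a0 : a != 0 by exact: pos.
by field; rewrite a0 pp.
Qed.

End rectangles.

Section square_integrable.
Context d (T : measurableType d) (R : realType) (P : {measure set T -> \bar R}).
Implicit Types X Y : T -> R.

Lemma Lfun2_measurable X : X \in Lfun P 2%:E -> measurable_fun setT X.
Proof. by move=> /sub_Lfun_mfun; rewrite inE. Qed.

Lemma Lfun2P X : measurable_fun setT X -> (sqint P X < +oo)%E <-> X \in Lfun P 2%:E.
Proof.
move=> mX.
have e : ('N[P]_2%:E[EFin \o X] `^ 2 = sqint P X)%E.
  rewrite powR_Lnorm//; apply: eq_integral => w _ /=.
  by rewrite powR_mulrn// real_normK// num_real.
split.
  move=> Xoo; rewrite inE; apply/andP; split; rewrite inE//=.
  rewrite /finite_norm; move: Xoo; rewrite -e.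
  have := @Lnorm_ge0 _ _ R P 2%:E (EFin \o X).
  by case: ('N[P]_2%:E[EFin \o X])%E => [r _ _|_|//]; [rewrite ltry|rewrite poweRyr].
rewrite inE => /andP[_]; rewrite inE/= /finite_norm -e.
have := @Lnorm_ge0 _ _ R P 2%:E (EFin \o X).
case: ('N[P]_2%:E[EFin \o X])%E => [r| |]//= _ _.
by rewrite ltry.
Qed.

End square_integrable.

Section inner_product_L2.
Context d (T : measurableType d) (R : realType) (P : probability T R).
Implicit Types X Y : T -> R.

Definition L2ip X Y : R := \int[P]_w (X w * Y w).

Lemma L2ip_integrable X Y : X \in Lfun P 2%:E -> Y \in Lfun P 2%:E ->
  P.-integrable setT (fun w => (X w * Y w)%:E).
Proof.
by move=> X2 Y2; have /Lfun1_integrable := Lfun2_mul_Lfun1 X2 Y2.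
Qed.

Lemma L2ipC X Y : L2ip X Y = L2ip Y X.
Proof. by apply: eq_Rintegral => w _; rewrite mulrC. Qed.

Lemma Lfun2_sum (I : Type) (s : seq I) (a : I -> R) (X : I -> T -> R) :
  (forall i, X i \in Lfun P 2%:E) -> (fun w => \sum_(i <- s) a i * X i w) \in Lfun P 2%:E.
Proof.
move=> X2; elim: s => [|i s IH].
  by under eq_fun => w do rewrite big_nil; exact: Lfun_cst.
under eq_fun => w do rewrite big_cons.
have l12 : (1 <= 2%:E :> \bar R)%E by rewrite lee_fin ler1n.
apply: (@rpredD _ (Lfun P 2%:E) (fun w => a i * X i w)) => //.
rewrite (_ : (fun w => _) = a i \o* X i); last by apply/funext => w /=; rewrite mulrC.
by apply: Lfun_scale => //; rewrite ler1n.
Qed.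

Lemma L2ip_suml (I : Type) (s : seq I) (a : I -> R) (X : I -> T -> R) Y :
  (forall i, X i \in Lfun P 2%:E) -> Y \in Lfun P 2%:E ->
  L2ip (fun w => \sum_(i <- s) a i * X i w) Y = \sum_(i <- s) a i * L2ip (X i) Y.
Proof.
move=> X2 Y2; elim: s => [|i s IH].
  rewrite big_nil /L2ip; under eq_Rintegral => w _ do rewrite big_nil mul0r.
  by rewrite Rintegral_cst// mul0r.
rewrite big_cons -IH /L2ip.
under eq_Rintegral => w _ do rewrite big_cons mulrDl -mulrA.
rewrite RintegralD//.
- by rewrite RintegralZl//; exact: L2ip_integrable.
- have := integrableZl measurableT (a i) (L2ip_integrable (X2 i) Y2).
  by under eq_fun do rewrite -EFinM.
- exact: L2ip_integrable (Lfun2_sum _ _ X2) Y2.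
Qed.

Lemma L2ip_sumr (I : Type) (s : seq I) (a : I -> R) (X : I -> T -> R) Y :
  (forall i, X i \in Lfun P 2%:E) -> Y \in Lfun P 2%:E ->
  L2ip Y (fun w => \sum_(i <- s) a i * X i w) = \sum_(i <- s) a i * L2ip Y (X i).
Proof.
move=> X2 Y2; rewrite L2ipC L2ip_suml//.
by apply: eq_bigr => i _; rewrite L2ipC.
Qed.

Lemma L2ip_sqint X : X \in Lfun P 2%:E -> (L2ip X X)%:E = sqint P X.
Proof.
move=> X2; rewrite /L2ip /Rintegral fineK.
  by apply: eq_integral => w _; rewrite -expr2.
rewrite -integral_fin_num_abs//; first by have /integrableP[] := L2ip_integrable X2 X2.
by apply: measurable_funM; exact: (Lfun2_measurable X2).
Qed.

End inner_product_L2.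

(** * Signed sums over the corners of a box *)

Section sum_over_subsets.
Context {R : comPzRingType} (d : nat).

(** A subset is a choice of one of two values in each direction, so the sum over subsets is the
    expansion of a product of two-term sums. *)
Lemma sum_subsets_prod (G : 'I_d -> bool -> R) :
  \sum_(S : {set 'I_d}) \prod_(i < d) G i (i \in S) = \prod_(i < d) (G i true + G i false).
Proof.
rewrite bigA_distr; apply: eq_bigr => S _; apply: eq_bigr => i _.
by case: (i \in S).
Qed.

Lemma sign_subset (S : {set 'I_d}) :
  (-1) ^+ #|~: S| = \prod_(i < d) (if i \in S then 1 else -1) :> R.
Proof.
rewrite -prodr_const big_mkcond/=; apply: eq_bigr => i _.
by rewrite inE; case: (i \in S).
Qed.

Lemma sum_subsets2_prod (G : 'I_d -> bool -> bool -> R) :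
  \sum_(S : {set 'I_d}) \sum_(S' : {set 'I_d}) \prod_(i < d) G i (i \in S) (i \in S') =
  \prod_(i < d) (G i true true + G i true false + (G i false true + G i false false)).
Proof.
under eq_bigr => S _ do rewrite (sum_subsets_prod (fun i => G i (i \in S))).
exact: (sum_subsets_prod (fun i b => G i b true + G i b false)).
Qed.

End sum_over_subsets.

(** * Covariances of rectangular increments of the sheet *)

Section isometry.
Context {R : realType} (d : nat).
Variables (H0 : R) (H : 'I_d -> R).
Hypotheses (hH0 : 2^-1 < H0 < 1) (hH : forall i, 2^-1 < H i < 1).
Context dO (Omega : measurableType dO) (P : probability Omega R).
Variable W : R -> d.-tuple R -> {RV P >-> R}.
Hypothesis hW : fractional_brownian_sheet H0 H W.

Lemma sheet_Lfun2 t x : 0 <= t -> (W t x : Omega -> R) \in Lfun P 2%:E.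
Proof.
move=> t0; have [_ cov] := hW.
apply/Lfun2P => //.
rewrite (_ : sqint P (W t x) = 'E_P[(W t x \* W t x)%R])%E; first by rewrite cov// ltry.
by rewrite unlock; apply: eq_integral => w _ /=; rewrite expr2.
Qed.

Lemma sheet_L2ip t s x y : 0 <= t -> 0 <= s ->
  L2ip P (W t x) (W s y) =
  fbm_cov H0 s t * \prod_(i < d) fbm_cov (H i) (tnth x i) (tnth y i).
Proof.
move=> t0 s0; have [_ cov] := hW.
by have := cov t s x y t0 s0; rewrite unlock /L2ip /Rintegral => ->.
Qed.

Lemma incrementE (r : @rectangle R d) w :
  increment W r w = \sum_(k : {set 'I_d} * bool)
    (-1) ^+ #|~: k.1| * (if k.2 then 1 else -1) *
      W (if k.2 then rt r else rs r) (corner r k.1) w.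
Proof.
rewrite -(pair_bigA _ (fun S (b : bool) => (-1) ^+ #|~: S| * (if b then 1 else -1) *
  W (if b then rt r else rs r) (corner r S) w))/=.
by apply: eq_bigr => S _; rewrite big_bool/=; ring.
Qed.

Lemma rt_ge0 (r : @rectangle R d) : 0 <= rt r.
Proof. exact: le_trans (rs_ge0 r) (rs_le_rt r). Qed.

Lemma increment_Lfun2 r : increment W r \in Lfun P 2%:E.
Proof.
rewrite (_ : increment W r = fun w => \sum_(k : {set 'I_d} * bool)
    (-1) ^+ #|~: k.1| * (if k.2 then 1 else -1) *
      W (if k.2 then rt r else rs r) (corner r k.1) w); last first.
  by apply/funext => w; exact: incrementE.
apply: Lfun2_sum => -[S b] /=; apply: sheet_Lfun2.
by case: b; [exact: rt_ge0|exact: rs_ge0].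
Qed.

(** The sign of a corner and the covariance at two corners are both products over the directions, so
    the sum over pairs of corners factorizes into second differences of [fbm_cov]. In each of them
    the terms in |t|^(2 h) and |s|^(2 h) cancel and [fbm_rect] remains. *)
Lemma increment_L2ip (r r' : @rectangle R d) :
  L2ip P (increment W r) (increment W r') =
  fbm_rect H0 (rs r) (rt r) (rs r') (rt r') *
  \prod_(i < d) fbm_rect (H i) (tnth (rx r) i) (tnth (ry r) i) (tnth (rx r') i) (tnth (ry r') i).
Proof.
have tm_ge0 (q : @rectangle R d) (b : bool) : 0 <= (if b then rt q else rs q).
  by case: b; [exact: rt_ge0|exact: rs_ge0].
have W2 (q : @rectangle R d) (k : {set 'I_d} * bool) :
    (W (if k.2 then rt q else rs q) (corner q k.1) : Omega -> R) \in Lfun P 2%:E.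
  exact: sheet_Lfun2.
rewrite (_ : increment W r = fun w => \sum_(k : {set 'I_d} * bool)
    (-1) ^+ #|~: k.1| * (if k.2 then 1 else -1) *
      W (if k.2 then rt r else rs r) (corner r k.1) w); last first.
  by apply/funext => w; exact: incrementE.
rewrite L2ip_suml//; last exact: increment_Lfun2.
rewrite (_ : increment W r' = fun w => \sum_(k : {set 'I_d} * bool)
    (-1) ^+ #|~: k.1| * (if k.2 then 1 else -1) *
      W (if k.2 then rt r' else rs r') (corner r' k.1) w); last first.
  by apply/funext => w; exact: incrementE.
under eq_bigr => k _ do rewrite L2ip_sumr//.
under eq_bigr => k _.
  under eq_bigr => k' _ do rewrite sheet_L2ip//.
  over.
(* The Boolean selects the upper end, with sign +1, or the lower end, with sign -1; time is handled
   like a further direction, but its Boolean is summed separately from the subset of space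
   directions. *)
pose sg (b : bool) : R := if b then 1 else -1.
pose F (b b' : bool) := sg b * sg b' *
  fbm_cov H0 (if b' then rt r' else rs r') (if b then rt r else rs r).
pose G i (b b' : bool) := sg b * sg b' *
  fbm_cov (H i) (if b then tnth (ry r) i else tnth (rx r) i)
     (if b' then tnth (ry r') i else tnth (rx r') i).
transitivity (\sum_(k : {set 'I_d} * bool) \sum_(k' : {set 'I_d} * bool)
   F k.2 k'.2 * \prod_(i < d) G i (i \in k.1) (i \in k'.1)).
  apply: eq_bigr => -[S b] _ /=; rewrite big_distrr/=; apply: eq_bigr => -[S' b'] _ /=.
  have -> : \prod_(i < d) fbm_cov (H i) (tnth (corner r S) i) (tnth (corner r' S') i) =
     \prod_(i < d) fbm_cov (H i) (if i \in S then tnth (ry r) i else tnth (rx r) i)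
       (if i \in S' then tnth (ry r') i else tnth (rx r') i).
    by apply: eq_bigr => i _; rewrite !tnth_mktuple.
  rewrite /F /G !sign_subset.
  rewrite [in RHS]big_split/= [in RHS]big_split/= -/(sg b) -/(sg b').
  by rewrite /sg; ring.
rewrite -(pair_bigA _ (fun (S : {set 'I_d}) (b : bool) => \sum_(k' : {set 'I_d} * bool)
   F b k'.2 * \prod_(i < d) G i (i \in S) (i \in k'.1)))/=.
transitivity ((F true true + F true false + (F false true + F false false)) *
   \sum_(S : {set 'I_d}) \sum_(S' : {set 'I_d}) \prod_(i < d) G i (i \in S) (i \in S')).
  rewrite big_distrr/=; apply: eq_bigr => S _.
  rewrite big_distrr/= big_bool/=.
  rewrite -(pair_bigA _ (fun (S' : {set 'I_d}) (b' : bool) => F true b' * \prod_(i < d) G i (i \in S) (i \in S'))).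
  rewrite -(pair_bigA _ (fun (S' : {set 'I_d}) (b' : bool) => F false b' * \prod_(i < d) G i (i \in S) (i \in S'))).
  by rewrite -big_split/=; apply: eq_bigr => S' _; rewrite !big_bool/=; ring.
rewrite sum_subsets2_prod.
congr (_ * _).
  rewrite /F /sg /fbm_cov /fbm_rect (distrC (rt r) (rt r')) (distrC (rs r) (rt r'))
    (distrC (rt r) (rs r')) (distrC (rs r) (rs r')); ring.
apply: eq_bigr => i _; rewrite /G /sg /fbm_cov /fbm_rect; ring.
Qed.

End isometry.

Section double_integral_finite.
Context {R : realType}.
Local Notation mu := (@lebesgue_measure R).

(** Since [q2] is bounded, its integral against the kernel centered at x is bounded uniformly in x;
    the mass of [q1] then bounds the outer integral. Dividing [q2] by [A] brings its mass below 1,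
    as [integral_powR_bounded] requires. *)
Lemma double_integral_powR_lty (q1 q2 : R -> R) (h A : R) :
  measurable_fun setT q1 -> measurable_fun setT q2 ->
  (forall x, 0 <= q1 x) -> (forall x, 0 <= q2 x <= 1) ->
  (\int[mu]_x (q1 x)%:E <= A%:E)%E -> (\int[mu]_x (q2 x)%:E <= A%:E)%E ->
  0 < A -> 0 < h -> h < 1 ->
  (\int[mu]_x \int[mu]_y (q1 x * q2 y * `|x - y| `^ (h - 1))%R%:E < +oo)%E.
Proof.
move=> m1 m2 q10 q201 I1 I2 A0 h0 h1.
have q20 x : 0 <= q2 x by have /andP[] := q201 x.
pose Q y := (A^-1%:E * (q2 y)%:E)%E.
have mQ : measurable_fun setT Q.
  by apply: emeasurable_funM => //; exact/measurable_EFinP.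
have Ai : 0 <= A^-1 by rewrite invr_ge0 ltW.
have Q0 y : (0 <= Q y)%E by rewrite mule_ge0 ?lee_fin.
have QI : (\int[mu]_y Q y <= 1)%E.
  rewrite ge0_integralZl//; last 2 first.
  - exact/measurable_EFinP.
  - by move=> y _; rewrite lee_fin.
  apply: le_trans (lee_wpmul2l _ I2) _; first by rewrite lee_fin.
  by rewrite -EFinM mulVf ?gt_eqF.
have QA y : (Q y <= A^-1%:E)%E.
  by rewrite /Q -EFinM lee_fin ler_piMr//; have /andP[] := q201 y.
pose K : R := A^-1 * (2 * 1 `^ h / h) + 1 `^ (h - 1).
have K0 : 0 <= K.
  by rewrite addr_ge0 ?powR_ge0// mulr_ge0// divr_ge0 ?(ltW h0)// mulr_ge0// powR_ge0.
have inner x : (\int[mu]_y (q1 x * q2 y * `|x - y| `^ (h - 1))%R%:E <= (A * K)%:E * (q1 x)%:E)%E.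
  have := @integral_powR_bounded R Q x h 1 A^-1 mQ Q0 QI h0 h1 ltr01 Ai QA.
  rewrite -/K => HK.
  have -> : (\int[mu]_y (q1 x * q2 y * `|x - y| `^ (h - 1))%R%:E =
      (A * q1 x)%:E * \int[mu]_y (Q y * (`|x - y| `^ (h - 1))%:E))%E.
    rewrite -ge0_integralZl//.
    - by apply: eq_integral => y _; rewrite /Q -!EFinM; congr EFin; field; rewrite gt_eqF.
    - by apply: emeasurable_funM => //; apply/measurable_EFinP; exact: measurable_sub_powR.
    - by move=> y _; rewrite mule_ge0// lee_fin powR_ge0.
    - by rewrite lee_fin mulr_ge0// ltW.
  apply: le_trans (lee_wpmul2l _ HK) _; first by rewrite lee_fin mulr_ge0// ltW.
  by rewrite -!EFinM lee_fin mulrAC.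
have msm : measurable_fun [set: R * R] (fun z : R * R => (q1 z.1 * q2 z.2 * `|z.1 - z.2| `^ (h - 1))%:E).
  apply/measurable_EFinP; apply: measurable_funM; first apply: measurable_funM.
  - exact: (measurableT_comp m1).
  - exact: (measurableT_comp m2).
  - apply: (measurableT_comp (measurable_norm_powR _)); exact: measurable_funB.
have msm0 (z : R * R) : (0 <= (q1 z.1 * q2 z.2 * `|z.1 - z.2| `^ (h - 1))%:E)%E.
  by rewrite lee_fin !mulr_ge0// powR_ge0.
have mE1 : measurable_fun setT (EFin \o q1) by exact/measurable_EFinP.
apply: (@le_lt_trans _ _ (\int[mu]_x ((A * K)%:E * (q1 x)%:E))%E).
  apply: ge0_le_integral => //.
  - by move=> x _; apply: integral_ge0 => y _; exact: (msm0 (x, y)).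
  - exact: (@measurable_fun_fubini_tonelli_F _ _ _ _ R mu _ msm msm0).
  - by apply: emeasurable_funM.
rewrite ge0_integralZl//; last 2 first.
- by move=> x _; rewrite lee_fin.
- by rewrite lee_fin mulr_ge0// ltW.
apply: lte_mul_pinfty; rewrite ?lee_fin ?mulr_ge0 ?(ltW A0)//.
exact: le_lt_trans I1 (ltry _).
Qed.

Definition gauss_tail (l x : R) : R := expR (- x ^+ 2 / l).

Lemma measurable_gauss_tail l : measurable_fun setT (gauss_tail l).
Proof.
apply: measurableT_comp => //; apply: measurable_funM => //.
by apply: measurable_funN; exact: measurable_funX.
Qed.

Lemma gauss_tail_ge0 l x : 0 <= gauss_tail l x. Proof. exact: expR_ge0. Qed.

Lemma gauss_tail_le1 l x : 0 < l -> gauss_tail l x <= 1.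
Proof.
move=> l0; rewrite -[leRHS]expR0 ler_expR mulNr oppr_le0 mulr_ge0 ?sqr_ge0//.
by rewrite invr_ge0 ltW.
Qed.

Lemma integral_gauss_tail l : 0 < l ->
  (\int[mu]_x (gauss_tail l x)%:E = ((normal_peak (Num.sqrt (l / 2)))^-1)%:E)%E.
Proof.
move=> l0; have l20 : 0 < l / 2 by rewrite divr_gt0.
have s0 : Num.sqrt (l / 2) != 0 by rewrite sqrtr_eq0 -ltNge.
have pk := normal_peak_gt0 s0.
have e x : gauss_tail l x = (normal_peak (Num.sqrt (l / 2)))^-1 * normal_pdf 0 (Num.sqrt (l / 2)) x.
  rewrite normal_pdfE// mulrA mulVf ?gt_eqF// mul1r /normal_fun subr0 sqr_sqrtr ?(ltW l20)//.
  by congr (expR (_ / _)); rewrite -mulr_natr divfK.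
under eq_integral => x _ do rewrite e EFinM.
rewrite ge0_integralZl//.
- by rewrite integral_normal_pdf mule1.
- by apply/measurable_EFinP; exact: measurable_normal_pdf.
- by move=> x _; rewrite lee_fin normal_pdf_ge0.
- by rewrite lee_fin invr_ge0 ltW.
Qed.

End double_integral_finite.

(** * Functions dominated by a Gaussian envelope *)

Section controlled_functions.
Context {R : realType} (d : nat).
Variables (H0 : R) (H : 'I_d -> R).
Hypotheses (hH0 : 2^-1 < H0 < 1) (hH : forall i, 2^-1 < H i < 1).
Local Notation mu := (@lebesgue_measure R).
Local Notation spacetime := (measurableTypeR R * d.-tuple R)%type.
Local Notation M := (prodm (lebesgue_spacetime R d) (lebesgue_spacetime R d)).
Local Notation half2 := (@halfspace R d `*` @halfspace R d).
Local Notation K pq := (kernelH H0 H pq.1 pq.2).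
Implicit Types (C t l : R) (p q : spacetime).

(** Bounded support in time and Gaussian decay in space. The tensor form makes the energy a product
    of one-dimensional integrals, and enlarging the parameters makes the dominated functions stable
    under linear combinations, so bilinearity only ever concerns absolutely convergent integrals. *)
Definition envelope C t l p : R :=
  C * \1_`[0, t] p.1 * \prod_(i < d) gauss_tail l (tnth p.2 i).

Lemma envelope_ge0 C t l p : 0 <= C -> 0 <= envelope C t l p.
Proof.
move=> C0; rewrite mulr_ge0 ?prodr_ge0// => [|i _]; last exact: gauss_tail_ge0.
by rewrite mulr_ge0// indicE.
Qed.

Lemma envelope_le C t l C' t' l' p : 0 <= C -> C <= C' -> t <= t' -> 0 < l -> l <= l' ->
  envelope C t l p <= envelope C' t' l' p.
Proof.
move=> C0 CC tt l0 ll; apply: ler_pM.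
- by rewrite mulr_ge0// indicE.
- by rewrite prodr_ge0// => i _; exact: gauss_tail_ge0.
- apply: ler_pM => //.
  rewrite !indicE ler_nat !mem_setE !in_itv/=.
  by case: (0 <= p.1) => //=; case: leP => // p1; rewrite (le_trans p1 tt).
- apply: ler_prod => i _; rewrite gauss_tail_ge0/= /gauss_tail ler_expR !mulNr lerN2.
  by rewrite ler_wpM2l ?sqr_ge0// lef_pV2 ?posrE// (lt_le_trans l0).
Qed.

Lemma measurable_envelope C t l : measurable_fun [set: spacetime] (envelope C t l).
Proof.
apply: measurable_funM; first apply: measurable_funM => //.
  have m1 : measurable_fun setT (\1_`[0, t] : R -> R) by exact: measurable_indic.
  exact: (measurableT_comp m1 measurable_fst).
apply: measurable_prod => i _.
exact: (measurableT_comp (measurable_gauss_tail l) (measurableT_comp (measurable_tnth i) measurable_snd)).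
Qed.

Lemma envelope_energy C t l : 0 <= C -> 0 < t -> 0 < l ->
  (\int[M]_pq (envelope C t l pq.1 * envelope C t l pq.2 * K pq)%R%:E < +oo)%E.
Proof.
move=> C0 t0 l0.
pose f0 x : R := C * \1_`[0, t] x.
have mi : measurable_fun setT (\1_`[0, t] : R -> R) by exact: measurable_indic.
have i0 x : (0 : R) <= \1_`[0, t] x by rewrite indicE.
have mf0 : measurable_fun setT f0 by apply: measurable_funM.
have f00 x : 0 <= f0 x by rewrite mulr_ge0.
have := @integral_tensor_kernelH R d H0 H f0 f0 (fun=> gauss_tail l) (fun=> gauss_tail l)
  mf0 mf0 (fun=> measurable_gauss_tail l) (fun=> measurable_gauss_tail l) f00 f00
  (fun=> gauss_tail_ge0 l) (fun=> gauss_tail_ge0 l).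
rewrite /envelope/f0 => ->.
have It : (\int[mu]_x (\1_`[0, t] x)%:E = t%:E)%E.
  have -> : (\int[mu]_x (\1_`[0%R, t] x)%:E = mu `[0%R, t]%classic)%E.
    by rewrite integral_indic// setIT.
  by rewrite lebesgue_measure_itv/= lte_fin t0 oppr0 adde0.
apply: lte_mul_pinfty.
- by apply: integral_ge0 => x _; apply: integral_ge0 => y _; rewrite lee_fin !mulr_ge0// powR_ge0.
- rewrite ge0_fin_numE; last first.
    by apply: integral_ge0 => x _; apply: integral_ge0 => y _; rewrite lee_fin !mulr_ge0// powR_ge0.
  have -> : (\int[mu]_x \int[mu]_y (C * \1_`[0, t] x * (C * \1_`[0, t] y) *
      `|x - y| `^ (2 * H0 - 2))%R%:E =
     (\int[mu]_x \int[mu]_y ((C ^+ 2 * \1_`[0, t] x) * \1_`[0, t] y * `|x - y| `^ (2 * H0 - 1 - 1))%R%:E))%E.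
    apply: eq_integral => x _; apply: eq_integral => y _; congr EFin.
    by rewrite (_ : 2 * H0 - 2 = 2 * H0 - 1 - 1); ring.
  have /andP[hH01 hH02] := hH0.
  have [h0 h1] : 0 < 2 * H0 - 1 /\ 2 * H0 - 1 < 1 by split; lra.
  (* A single constant has to bound the masses C^2 t and t of the two factors, and it must be
     positive even if C = 0. *)
  apply: (@double_integral_powR_lty _ _ _ _ (C ^+ 2 * t + t)) => //.
  - by apply: measurable_funM.
  - by move=> x; rewrite mulr_ge0// exprn_ge0.
  - by move=> x; rewrite i0/= indicE lern1 leq_b1.
  - under eq_integral => x _ do rewrite EFinM.
    rewrite ge0_integralZl//.
    + by rewrite It -EFinM lee_fin lerDl ltW.
    + exact/measurable_EFinP.
    + by rewrite lee_fin exprn_ge0.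
  - by rewrite It lee_fin lerDr mulr_ge0 ?exprn_ge0// ltW.
  - by rewrite ltr_wpDl// mulr_ge0 ?exprn_ge0// ltW.
- have hh i : (\int[mu]_x \int[mu]_y (gauss_tail l x * gauss_tail l y *
      `|x - y| `^ (2 * H i - 2))%R%:E < +oo)%E.
    have s0 : Num.sqrt (l / 2) != 0 by rewrite sqrtr_eq0 -ltNge divr_gt0.
    have pk := normal_peak_gt0 s0.
    have -> : 2 * H i - 2 = 2 * H i - 1 - 1 by ring.
    have /andP[hH01 hH02] := hH i.
    have [h0 h1] : 0 < 2 * H i - 1 /\ 2 * H i - 1 < 1 by split; lra.
    apply: (@double_integral_powR_lty _ _ _ _ ((normal_peak (Num.sqrt (l / 2)))^-1)) => //.
    - exact: measurable_gauss_tail.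
    - exact: measurable_gauss_tail.
    - by move=> x; exact: gauss_tail_ge0.
    - by move=> x; rewrite gauss_tail_ge0 gauss_tail_le1.
    - by rewrite integral_gauss_tail.
    - by rewrite integral_gauss_tail.
    - by rewrite invr_gt0.
  have hpos i : (0 <= \int[mu]_x \int[mu]_y (gauss_tail l x * gauss_tail l y *
      `|x - y| `^ (2 * H i - 2))%R%:E)%E.
    by apply: integral_ge0 => x _; apply: integral_ge0 => y _; rewrite lee_fin !mulr_ge0 ?gauss_tail_ge0// powR_ge0.
  suff /andP[] : (0 <= \prod_(i < d) \int[mu]_x \int[mu]_y (gauss_tail l x * gauss_tail l y *
      `|x - y| `^ (2 * H i - 2))%R%:E < +oo)%E by [].
  apply: (big_ind (fun x : \bar R => 0 <= x < +oo)%E) => [|x y|i _]; last by rewrite hpos hh.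
    by rewrite lee_fin ler01 ltry.
  move=> /andP[x0 xoo] /andP[y0 yoo]; rewrite mule_ge0//=.
  by apply: lte_mul_pinfty => //; rewrite ge0_fin_numE.
Qed.

Definition controlled C t l (phi : spacetime -> R) : Prop :=
  measurable_fun setT phi /\ forall p, `|phi p| <= envelope C t l p.

Lemma controlled_le C t l C' t' l' phi : 0 <= C -> C <= C' -> t <= t' -> 0 < l -> l <= l' ->
  controlled C t l phi -> controlled C' t' l' phi.
Proof.
move=> C0 CC tt l0 ll [mphi cphi]; split=> // p.
exact: le_trans (cphi p) (envelope_le _ C0 CC tt l0 ll).
Qed.

Lemma measurable_pairing (phi psi : spacetime -> R) : measurable_fun setT phi ->
  measurable_fun setT psi ->
  measurable_fun [set: spacetime * spacetime] (fun pq => phi pq.1 * psi pq.2 * K pq).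
Proof.
move=> mphi mpsi; apply: measurable_funM; last exact: measurable_kernelH.
by apply: measurable_funM; [exact: (measurableT_comp mphi)|exact: (measurableT_comp mpsi)].
Qed.

Lemma integrable_envelope C t l : 0 <= C -> 0 < t -> 0 < l ->
  M.-integrable half2 (fun pq => (envelope C t l pq.1 * envelope C t l pq.2 * K pq)%:E).
Proof.
move=> C0 t0 l0.
apply: (@integrableS _ _ _ M setT half2) => //; first exact: measurable_half2.
apply/integrableP; split.
  apply/measurable_EFinP; apply: measurable_pairing; exact: measurable_envelope.
apply: le_lt_trans (envelope_energy C0 t0 l0).
rewrite le_eqVlt; apply/orP; left; apply/eqP; apply: eq_integral => pq _.
by rewrite gee0_abs// lee_fin mulr_ge0 ?kernelH_ge0// mulr_ge0 ?envelope_ge0.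
Qed.

Lemma pairing_le C t l phi psi pq : controlled C t l phi -> controlled C t l psi ->
  `|phi pq.1 * psi pq.2 * K pq| <= envelope C t l pq.1 * envelope C t l pq.2 * K pq.
Proof.
move=> [_ cphi] [_ cpsi].
rewrite normrM (ger0_norm (kernelH_ge0 H0 H pq.1 pq.2)) ler_wpM2r ?kernelH_ge0//.
by rewrite normrM ler_pM.
Qed.

Lemma integrable_pairing C t l phi psi : 0 <= C -> 0 < t -> 0 < l ->
  controlled C t l phi -> controlled C t l psi ->
  M.-integrable half2 (fun pq => (phi pq.1 * psi pq.2 * K pq)%:E).
Proof.
move=> C0 t0 l0 cphi cpsi.
apply: (le_integrable (@measurable_half2 R d) _ _ (integrable_envelope C0 t0 l0)).
  apply/measurable_EFinP; apply: measurable_funTS; apply: measurable_pairing.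
    by case: cphi.
  by case: cpsi.
move=> pq _; rewrite !abse_EFin lee_fin; apply: le_trans (pairing_le pq cphi cpsi) _.
exact: ler_norm.
Qed.

Lemma controlled_finite_energy C t l phi : 0 <= C -> 0 < t -> 0 < l ->
  controlled C t l phi -> finite_energy H0 H phi.
Proof.
move=> C0 t0 l0 cphi; split; first by apply: measurable_funTS; case: cphi.
have cn : controlled C t l (fun p => `|phi p|).
  case: cphi => mphi cphi; split; first exact: measurableT_comp.
  by move=> p; rewrite normr_id.
have /integrableP[_] := integrable_pairing C0 t0 l0 cn cn.
apply: le_lt_trans; rewrite le_eqVlt; apply/orP; left; apply/eqP.
apply: eq_integral => pq _.
by rewrite gee0_abs// lee_fin mulr_ge0 ?kernelH_ge0// mulr_ge0.
Qed.

Lemma innerH_addl C t l phi phi' psi (a : R) : 0 <= C -> 0 < t -> 0 < l ->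
  controlled C t l phi -> controlled C t l phi' -> controlled C t l psi ->
  innerH H0 H (fun p => phi p + a * phi' p) psi =
  innerH H0 H phi psi + a * innerH H0 H phi' psi.
Proof.
move=> C0 t0 l0 c1 c2 c3.
have i1 := integrable_pairing C0 t0 l0 c1 c3.
have i2 := integrable_pairing C0 t0 l0 c2 c3.
rewrite /innerH mulrCA -mulrDr; congr (_ * _).
rewrite -RintegralZl//; last exact: measurable_half2.
rewrite -RintegralD//; last 2 first.
- exact: measurable_half2.
- apply: eq_integrable (integrableZl (@measurable_half2 R d) a i2).
    exact: measurable_half2.
  by move=> pq _; rewrite /= EFinM.
by apply: eq_Rintegral => pq _; ring.
Qed.

Lemma innerH_addr C t l phi psi psi' (a : R) : 0 <= C -> 0 < t -> 0 < l ->
  controlled C t l phi -> controlled C t l psi -> controlled C t l psi' ->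
  innerH H0 H phi (fun p => psi p + a * psi' p) =
  innerH H0 H phi psi + a * innerH H0 H phi psi'.
Proof.
move=> C0 t0 l0 c1 c2 c3.
have i1 := integrable_pairing C0 t0 l0 c1 c2.
have i2 := integrable_pairing C0 t0 l0 c1 c3.
rewrite /innerH mulrCA -mulrDr; congr (_ * _).
rewrite -RintegralZl//; last exact: measurable_half2.
rewrite -RintegralD//; last 2 first.
- exact: measurable_half2.
- apply: eq_integrable (integrableZl (@measurable_half2 R d) a i2).
    exact: measurable_half2.
  by move=> pq _; rewrite /= EFinM.
by apply: eq_Rintegral => pq _; ring.
Qed.

(** Rectangles are open on the left, so step functions vanish at time 0 whatever they approximate
    there. As this set is null, [innerH_dominated] asks for pointwise convergence at positive times
    only. *)
Lemma negligible_boundary :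
  M.-negligible [set pq : spacetime * spacetime | pq.1.1 = 0 \/ pq.2.1 = 0].
Proof.
pose Z : set spacetime := [set p | p.1 = 0].
have ZE : Z = [set (0:R)] `*` setT by apply/seteqP; split => -[a b] //=; case.
have mZ : measurable Z by rewrite ZE; exact: measurableX.
have Z0 : lebesgue_spacetime R d Z = 0%E.
  by rewrite ZE /lebesgue_spacetime/= /prodm product_measure1E//= lebesgue_measure_set1 mul0e.
have e1 : M (Z `*` setT) = 0%E.
  by apply: etrans (product_measure1E _ _ _ _) _ => //; rewrite [X in (X * _)%E]Z0 mul0e.
have e2 : M (setT `*` Z) = 0%E.
  by apply: etrans (product_measure1E _ _ _ _) _ => //; rewrite [X in (_ * X)%E]Z0 mule0.
apply: (@negligibleS _ _ _ _ ((Z `*` setT) `|` (setT `*` Z))).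
  by move=> pq [h|h]; [left|right].
apply: negligibleU.
  by exists (Z `*` setT); split; [exact: measurableX|exact: e1|exact: subset_refl].
by exists (setT `*` Z); split; [exact: measurableX|exact: e2|exact: subset_refl].
Qed.

Lemma innerH_dominated C t l (phi psi : nat -> spacetime -> R) phi' psi' :
  0 <= C -> 0 < t -> 0 < l ->
  (forall n, controlled C t l (phi n)) -> (forall n, controlled C t l (psi n)) ->
  controlled C t l phi' -> controlled C t l psi' ->
  (forall p, 0 < p.1 -> phi n p @[n --> \oo] --> phi' p) ->
  (forall p, 0 < p.1 -> psi n p @[n --> \oo] --> psi' p) ->
  innerH H0 H (phi n) (psi n) @[n --> \oo] --> innerH H0 H phi' psi'.
Proof.
move=> C0 t0 l0 cphi cpsi cphi' cpsi' phiE psiE.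
have mm (f g : spacetime -> R) : controlled C t l f -> controlled C t l g ->
    measurable_fun half2 (fun pq => (f pq.1 * g pq.2 * K pq)%:E).
  move=> [mf _] [mg _]; apply/measurable_EFinP; apply: measurable_funTS.
  exact: measurable_pairing.
have ae1 : {ae M, forall pq, half2 pq ->
    (phi n pq.1 * psi n pq.2 * K pq)%:E @[n --> \oo] --> (phi' pq.1 * psi' pq.2 * K pq)%:E}.
  apply: (negligibleS _ negligible_boundary) => pq /=; apply: contra_notP.
  move=> /not_orP[n1 n2] [h1 h2]; apply: cvg_EFin; first exact: nearW.
  have p1 : 0 < pq.1.1 by rewrite lt_neqAle eq_sym h1 andbT; exact/eqP.
  have p2 : 0 < pq.2.1 by rewrite lt_neqAle eq_sym h2 andbT; exact/eqP.
  by apply: cvgM; [apply: cvgM; [exact: phiE|exact: psiE]|exact: cvg_cst].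
have ae2 : {ae M, forall pq n, half2 pq -> (`|(phi n pq.1 * psi n pq.2 * K pq)%:E| <=
    (envelope C t l pq.1 * envelope C t l pq.2 * K pq)%:E)%E}.
  by apply: aeW => pq n _; rewrite abse_EFin lee_fin; exact: pairing_le.
have [i1 _ cv] := @dominated_convergence _ _ R M _ (@measurable_half2 R d) _ _ _
  (fun n => mm _ _ (cphi n) (cpsi n)) (mm _ _ cphi' cpsi') ae1
  (integrable_envelope C0 t0 l0) ae2.
rewrite /innerH; apply: cvgM; first exact: cvg_cst.
rewrite /Rintegral; apply: fine_cvg; rewrite fineK//.
exact: (@integrable_fin_num _ _ R M half2 (@measurable_half2 R d) _ i1).
Qed.

End controlled_functions.

Section norm_two.
Context d (T : measurableType d) (R : realType) (P : {measure set T -> \bar R}).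

Lemma ge0_cvg0P (I : Type) (F : set_system I) {FF : Filter F} (f : I -> \bar R) :
  (forall i, (0 <= f i)%E) ->
  (f i @[i --> F] --> 0%E) <-> (forall e : R, 0 < e -> \forall i \near F, (f i < e%:E)%E).
Proof.
move=> f0; split => [fF e e0|h].
  by apply: (fF [set y | (y < e%:E)%E]); apply: open_nbhs_nbhs; split => //; exact: open_ereal_lt_ereal.
apply/fine_cvgP; split.
  near=> i; rewrite ge0_fin_numE//; apply: (lt_trans (y := 1%:E)); last exact: ltry.
  by near: i; exact: h.
apply/cvgr0Pnorm_lt => e e0; near=> i.
rewrite /= ger0_norm ?fine_ge0// -lte_fin fineK; last first.
  rewrite ge0_fin_numE//; apply: (lt_trans (y := e%:E)); last exact: ltry.
  by near: i; exact: h.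
by near: i; exact: h.
Unshelve. all: by end_near. Qed.

Lemma cvge0_double (f g : nat -> \bar R) : f @ \oo --> 0%E -> g @ \oo --> 0%E ->
  (2%:E * f n + 2%:E * g n)%E @[n --> \oo] --> 0%E.
Proof.
move=> f0 g0; rewrite -[X in _ --> X](_ : 2%:E * 0 + 2%:E * 0 = 0)%E; last by rewrite mule0 adde0.
by apply: cvgeD; [rewrite mule0|apply: cvgeZl|apply: cvgeZl].
Qed.

Lemma Lnorm2_sqint (f : T -> R) :
  ('N[P]_2%:E[EFin \o f] * 'N[P]_2%:E[EFin \o f] = sqint P f)%E.
Proof.
have <- : ('N[P]_2%:E[EFin \o f] `^ 2 = sqint P f)%E.
  rewrite powR_Lnorm//; apply: eq_integral => w _ /=.
  by rewrite powR_mulrn// real_normK// num_real.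
have := @Lnorm_ge0 _ _ R P 2%:E (EFin \o f).
case: ('N[P]_2%:E[EFin \o f])%E => [r r0| _|//].
  by rewrite poweR_EFin powR_mulrn// expr2.
by rewrite poweRyr ?pnatr_eq0// mulyy.
Qed.

Lemma Lnorm2_lt (f : T -> R) (e : R) : 0 < e ->
  ('N[P]_2%:E[EFin \o f] < e%:E)%E = (sqint P f < (e ^+ 2)%:E)%E.
Proof.
move=> e0; rewrite -Lnorm2_sqint.
have := @Lnorm_ge0 _ _ R P 2%:E (EFin \o f).
case: ('N[P]_2%:E[EFin \o f])%E => [r| |//]; last by rewrite mulyy !ltNge !leey.
by rewrite lee_fin => r0; rewrite -EFinM !lte_fin -expr2 ltr_pXn2r// ?nnegrE// ltW.
Qed.

Lemma Lnorm2_cvg0 (I : Type) (F : set_system I) {FF : Filter F} (f : I -> T -> R) :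
  ('N[P]_2%:E[EFin \o f i] @[i --> F] --> 0)%E <-> (sqint P (f i) @[i --> F] --> 0%E).
Proof.
rewrite (ge0_cvg0P (fun i => Lnorm_ge0 P 2%:E (EFin \o f i))).
rewrite (ge0_cvg0P (fun i => sqint_ge0 P (f i))); split => h e e0.
  have s0 : 0 < Num.sqrt e by rewrite sqrtr_gt0.
  apply: filterS (h _ s0) => i; rewrite Lnorm2_lt// sqr_sqrtr//; exact: ltW.
by apply: filterS (h _ (exprn_gt0 2 e0)) => i; rewrite -Lnorm2_lt.
Qed.

End norm_two.

(** * The span of the indicators of rectangles *)

Section step_functions.
Context {R : realType} (d : nat).
Variables (H0 : R) (H : 'I_d -> R).
Hypotheses (hH0 : 2^-1 < H0 < 1) (hH : forall i, 2^-1 < H i < 1).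
Local Notation spacetime := (measurableTypeR R * d.-tuple R)%type.
Local Notation inner := (innerH H0 H).
Implicit Types phi psi : spacetime -> R.
Implicit Types f g : @step R d.

Definition controllable phi : Prop :=
  exists C t l, [/\ 0 <= C, 0 < t, 0 < l & controlled C t l phi].

Lemma controlled_lin C t l C' phi psi (a : R) :
  controlled C t l phi -> controlled C' t l psi ->
  controlled (C + `|a| * C') t l (fun p => phi p + a * psi p).
Proof.
move=> [m1 c1] [m2 c2]; split.
  by apply: measurable_funD => //; exact: measurable_funM.
move=> p; rewrite /envelope -mulrA mulrDl -mulrA !mulrA.
apply: le_trans (ler_normD _ _) _; apply: lerD; first exact: c1.
by rewrite normrM -!mulrA ler_wpM2l// mulrA; exact: c2.
Qed.

Lemma controllable3 phi psi chi : controllable phi -> controllable psi -> controllable chi ->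
  exists C t l, [/\ 0 <= C, 0 < t, 0 < l &
    [/\ controlled C t l phi, controlled C t l psi & controlled C t l chi]].
Proof.
move=> [C1 [t1 [l1 [C10 t10 l10 c1]]]] [C2 [t2 [l2 [C20 t20 l20 c2]]]] [C3 [t3 [l3 [C30 t30 l30 c3]]]].
exists (C1 + C2 + C3), (t1 + t2 + t3), (l1 + l2 + l3); split; try lra.
by split; [apply: controlled_le c1|apply: controlled_le c2|apply: controlled_le c3] => //; lra.
Qed.

Lemma controllable2 phi psi : controllable phi -> controllable psi ->
  exists C t l, [/\ 0 <= C, 0 < t, 0 < l & controlled C t l phi /\ controlled C t l psi].
Proof.
move=> c1 c2; have [C [t [l [? ? ? [? ? _]]]]] := controllable3 c1 c2 c2.
by exists C, t, l.
Qed.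

Lemma controllable_lin phi psi (a : R) : controllable phi -> controllable psi ->
  controllable (fun p => phi p + a * psi p).
Proof.
move=> c1 c2; have [C [t [l [? ? ? [h1 h2]]]]] := controllable2 c1 c2.
exists (C + `|a| * C), t, l; split => //; last exact: controlled_lin.
by rewrite addr_ge0// mulr_ge0.
Qed.

Lemma controllable0 : controllable (fun=> 0).
Proof.
exists 0, 1, 1; split => //; split; first exact: measurable_cst.
by move=> p; rewrite normr0 envelope_ge0.
Qed.

Lemma inner_linl phi psi chi (a : R) : controllable phi -> controllable psi -> controllable chi ->
  inner (fun p => phi p + a * psi p) chi = inner phi chi + a * inner psi chi.
Proof.
move=> c1 c2 c3; have [C [t [l [C0 t0 l0 [h1 h2 h3]]]]] := controllable3 c1 c2 c3.
exact: (innerH_addl hH0 hH a C0 t0 l0).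
Qed.

Lemma inner_linr phi psi chi (a : R) : controllable phi -> controllable psi -> controllable chi ->
  inner chi (fun p => phi p + a * psi p) = inner chi phi + a * inner chi psi.
Proof.
move=> c1 c2 c3; have [C [t [l [C0 t0 l0 [h1 h2 h3]]]]] := controllable3 c1 c2 c3.
exact: (innerH_addr hH0 hH a C0 t0 l0).
Qed.

Lemma inner0l phi : inner (fun=> 0) phi = 0.
Proof.
rewrite /innerH; under eq_Rintegral => pq _ do rewrite !mul0r.
by rewrite /Rintegral integral0 mulr0.
Qed.

Lemma inner_quad phi psi (a : R) : controllable phi -> controllable psi ->
  inner (fun p => phi p + a * psi p) (fun p => phi p + a * psi p) =
  inner phi phi + a * (inner phi psi + inner psi phi) + a ^+ 2 * inner psi psi.
Proof.
move=> c1 c2; have c3 := controllable_lin a c1 c2.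
by rewrite inner_linl// !inner_linr//; ring.
Qed.

Lemma controllable_rect (r : @rectangle R d) : controllable (\1_(rect_set r)).
Proof.
pose m i : R := Num.max `|tnth (rx r) i| `|tnth (ry r) i|.
have g0 i : 0 < gauss_tail 1 (m i) by exact: expR_gt0.
(* On the rectangle the i-th coordinate is at most m i in absolute value, so the tail there is at
   least its value at m i. The time bound is increased by 1 because rt r may be 0. *)
exists (\prod_(i < d) (gauss_tail 1 (m i))^-1), (rt r + 1), 1; split => //.
- by apply: prodr_ge0 => i _; rewrite invr_ge0 ltW.
- by rewrite ltr_wpDl// rt_ge0.
split; first exact: measurable_indic_rect.
move=> p; rewrite ger0_norm// indic_rect /envelope mulrAC [leRHS]mulrC -big_split/=.
apply: ler_pM => //.
- by apply: prodr_ge0.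
- rewrite !indicE ler_nat !mem_setE !in_itv/=; case: ltP => //= p1.
  rewrite (ltW (le_lt_trans (rs_ge0 r) p1))/=; case: leP => // p2.
  by rewrite (le_trans p2)// lerDl.
- apply: ler_prod => i _; rewrite indicE ler0n/= mem_setE in_itv/=.
  case: andP => [[h1 h2]|_]; last by rewrite mulr_ge0 ?gauss_tail_ge0// invr_ge0 ltW.
  rewrite mulrC ler_pdivlMr// mul1r /gauss_tail ler_expR ler_wpM2r// lerN2.
  rewrite -(real_normK (num_real (tnth _ _))) ler_pXn2r ?nnegrE//.
    have ma : `|tnth (rx r) i| <= m i by rewrite /m le_max lexx.
    have mb : `|tnth (ry r) i| <= m i by rewrite /m le_max lexx orbT.
    have := ler_norm (tnth (ry r) i); have := ler_norm (- tnth (rx r) i).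
    by rewrite normrN ler_norml => ? ?; apply/andP; split; lra.
  by rewrite /m le_max normr_ge0.
Qed.

Lemma step_fun_cons (a : R) r f : step_fun ((a, r) :: f) = (fun p => step_fun f p + a * \1_(rect_set r) p).
Proof. by apply/funext => p; rewrite /step_fun big_cons addrC. Qed.

Lemma controllable_step f : controllable (step_fun f).
Proof.
elim: f => [|[a r] f IH]; last by rewrite step_fun_cons; exact: controllable_lin (controllable_rect r).
by rewrite (_ : step_fun _ = fun=> 0); [exact: controllable0|apply/funext => p; rewrite /step_fun big_nil].
Qed.

Lemma inner_step f g : inner (step_fun f) (step_fun g) =
  \sum_(cr <- f) cr.1 * \sum_(cr' <- g) cr'.1 * inner (\1_(rect_set cr.2)) (\1_(rect_set cr'.2)).
Proof.
have cr r := controllable_rect r; have cs h := controllable_step h.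
elim: f => [|[a r] f IH].
  rewrite big_nil (_ : step_fun _ = fun=> 0) ?inner0l//.
  by apply/funext => p; rewrite /step_fun big_nil.
rewrite step_fun_cons inner_linl// IH big_cons/= addrC; congr (_ * _ + _).
elim: g {IH} => [|[b r'] g IH].
  rewrite big_nil (_ : step_fun _ = fun=> 0).
    by have := inner_linr 1 controllable0 controllable0 (cr r); under eq_fun do rewrite mulr0 addr0; lra.
  by apply/funext => p; rewrite /step_fun big_nil.
by rewrite step_fun_cons inner_linr// IH big_cons/= addrC.
Qed.

Definition step_lin (a : R) f g : @step R d := f ++ [seq (a * cr.1, cr.2) | cr <- g].

Lemma step_fun_lin a f g : step_fun (step_lin a f g) = (fun p => step_fun f p + a * step_fun g p).
Proof.
apply/funext => p; rewrite /step_fun big_cat big_map/= big_distrr/=; congr (_ + _).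
by apply: eq_bigr => cr _; rewrite mulrA.
Qed.

End step_functions.

(** * Dominated pointwise approximation by step functions *)

Section step_convergence.
Context {R : realType} (d : nat).
Variables (H0 : R) (H : 'I_d -> R).
Hypotheses (hH0 : 2^-1 < H0 < 1) (hH : forall i, 2^-1 < H i < 1).
Local Notation spacetime := (measurableTypeR R * d.-tuple R)%type.
Local Notation inner := (innerH H0 H).
Implicit Types phi psi : spacetime -> R.
Implicit Types f g : @step R d.

(** A pointwise sufficient condition for [cvg_calH]: the common envelope turns pointwise convergence
    into convergence of all inner products. *)
Definition stepcvg (u : nat -> @step R d) phi : Prop :=
  exists C t l, [/\ 0 <= C, 0 < t, 0 < l &
    [/\ controlled C t l phi, forall n, controlled C t l (step_fun (u n)) &
        forall p, 0 < p.1 -> step_fun (u n) p @[n --> \oo] --> phi p]].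

Lemma stepcvg_controllable u phi : stepcvg u phi -> controllable phi.
Proof. by move=> [C [t [l [? ? ? [? _ _]]]]]; exists C, t, l. Qed.

Lemma stepcvg_common u v phi psi : stepcvg u phi -> stepcvg v psi ->
  exists C t l, [/\ 0 <= C, 0 < t, 0 < l &
    [/\ controlled C t l phi, forall n, controlled C t l (step_fun (u n)),
        controlled C t l psi & forall n, controlled C t l (step_fun (v n))]].
Proof.
move=> [C1 [t1 [l1 [C10 t10 l10 [c1 c1' _]]]]] [C2 [t2 [l2 [C20 t20 l20 [c2 c2' _]]]]].
exists (C1 + C2), (t1 + t2), (l1 + l2); split; try lra.
by split=> [|n||n]; [apply: controlled_le c1|apply: controlled_le (c1' n)|
  apply: controlled_le c2|apply: controlled_le (c2' n)] => //; lra.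
Qed.

Lemma stepcvg_pointwise u phi p : stepcvg u phi -> 0 < p.1 ->
  step_fun (u n) p @[n --> \oo] --> phi p.
Proof. by move=> [C [t [l [_ _ _ [_ _]]]]]; exact. Qed.

Lemma stepcvg_lin u v phi psi (a : R) : stepcvg u phi -> stepcvg v psi ->
  stepcvg (fun n => step_lin a (u n) (v n)) (fun p => phi p + a * psi p).
Proof.
move=> uphi vpsi; have [C [t [l [C0 t0 l0 [c1 c1' c2 c2']]]]] := stepcvg_common uphi vpsi.
exists (C + `|a| * C), t, l; split => //; first by rewrite addr_ge0// mulr_ge0.
split => [|n|p p0]; first exact: controlled_lin.
  by rewrite step_fun_lin; exact: controlled_lin.
under eq_fun do rewrite step_fun_lin.
apply: cvgD; first exact: stepcvg_pointwise uphi p0.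
by apply: cvgM; [exact: cvg_cst|exact: stepcvg_pointwise vpsi p0].
Qed.

Lemma stepcvg_step f : stepcvg (fun=> f) (step_fun f).
Proof.
have [C [t [l [C0 t0 l0 c]]]] := controllable_step f.
by exists C, t, l; split => //; split => // p _; exact: cvg_cst.
Qed.

Lemma stepcvg_inner u v phi psi : stepcvg u phi -> stepcvg v psi ->
  inner (step_fun (u n)) (step_fun (v n)) @[n --> \oo] --> inner phi psi.
Proof.
move=> uphi vpsi; have [C [t [l [C0 t0 l0 [c1 c1' c2 c2']]]]] := stepcvg_common uphi vpsi.
apply: (innerH_dominated hH0 hH C0 t0 l0) => // p p0.
  exact: stepcvg_pointwise uphi p0.
exact: stepcvg_pointwise vpsi p0.
Qed.

Lemma sub_linE phi psi : (fun p => phi p - psi p) = (fun p => phi p + (-1) * psi p).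
Proof. by apply/funext => p; rewrite mulN1r. Qed.

Lemma stepcvg_calH u phi : stepcvg u phi -> cvg_calH H0 H u phi.
Proof.
move=> uphi; have [C [t [l [C0 t0 l0 [c1 c1' cu]]]]] := uphi.
pose z := (fun=> 0) : spacetime -> R.
(* The limit 0 is rewritten as the energy of the zero function, so that [innerH_dominated] applies
   to the differences. *)
rewrite /cvg_calH -(inner0l H0 H z) -/z.
have c (n : nat) : controlled (C + `|-1| * C) t l (fun p => step_fun (u n) p - phi p).
  by rewrite sub_linE; exact: controlled_lin.
have c0 : controlled (C + `|-1| * C) t l z.
  split; first exact: measurable_cst.
  by move=> p; rewrite normr0 envelope_ge0// addr_ge0// mulr_ge0.
have cv (p : spacetime) : 0 < p.1 -> (step_fun (u n) p - phi p) @[n --> \oo] --> (0 : R).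
  by move=> p0; rewrite -(subrr (phi p)); apply: cvgB; [exact: cu|exact: cvg_cst].
have C'0 : 0 <= C + `|-1| * C by rewrite addr_ge0// mulr_ge0.
exact: (innerH_dominated hH0 hH C'0 t0 l0 c c c0 c0 cv cv).
Qed.

Lemma stepcvg_in_calH u phi : stepcvg u phi -> in_calH H0 H phi.
Proof.
move=> uphi; split; last by exists u; exact: stepcvg_calH.
by have [C [t [l [C0 t0 l0 [c _ _]]]]] := uphi; exact: (controlled_finite_energy hH0 hH C0 t0 l0).
Qed.

End step_convergence.

(** * Isometry, Gaussian law and linearity of Wiener integrals *)

Section wiener_integrals.
Context {R : realType} (d : nat).
Variables (H0 : R) (H : 'I_d -> R).
Hypotheses (hH0 : 2^-1 < H0 < 1) (hH : forall i, 2^-1 < H i < 1).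
Context dO (Omega : measurableType dO) (P : probability Omega R).
Variable W : R -> d.-tuple R -> {RV P >-> R}.
Hypothesis hW : fractional_brownian_sheet H0 H W.
Local Notation spacetime := (measurableTypeR R * d.-tuple R)%type.
Local Notation inner := (innerH H0 H).
Implicit Types phi psi : spacetime -> R.
Implicit Types f g : @step R d.

Lemma step_integral_Lfun2 f : step_integral W f \in Lfun P 2%:E.
Proof. by apply: Lfun2_sum => -[a r] /=; exact: (increment_Lfun2 hW). Qed.

Lemma step_integral_lin a f g w : step_integral W (step_lin a f g) w =
  step_integral W f w + a * step_integral W g w.
Proof.
rewrite /step_integral big_cat big_map/= big_distrr/=; congr (_ + _).
by apply: eq_bigr => cr _; rewrite mulrA.
Qed.

Lemma step_isometry f g : L2ip P (step_integral W f) (step_integral W g) =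
  inner (step_fun f) (step_fun g).
Proof.
rewrite (inner_step hH0 hH) /step_integral.
rewrite (@L2ip_suml _ _ _ P _ _ (fun cr : R * rectangle d => cr.1) (fun cr => increment W cr.2)).
- apply: eq_bigr => cr _; congr (_ * _).
  rewrite (@L2ip_sumr _ _ _ P _ _ (fun cr : R * rectangle d => cr.1) (fun cr => increment W cr.2)).
  + by apply: eq_bigr => cr' _; rewrite (increment_L2ip hW) (innerH_rect hH0 hH).
  + by move=> ?; exact: (increment_Lfun2 hW).
  + exact: (increment_Lfun2 hW).
- by move=> ?; exact: (increment_Lfun2 hW).
- exact: step_integral_Lfun2.
Qed.

Lemma sqint_step_integral f : sqint P (step_integral W f) = (inner (step_fun f) (step_fun f))%:E.
Proof. by rewrite -step_isometry L2ip_sqint//; exact: step_integral_Lfun2. Qed.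

(** The normal form in which [fbs_gaussian] is stated. Closure under linear combinations brings the
    nested sums of a step integral into it without computing coefficients. *)
Let lincomb (X : Omega -> R) : Prop := exists (n : nat) (c t : 'I_n -> R) (x : 'I_n -> d.-tuple R),
  (forall k, 0 <= t k) /\ X = fun w => \sum_(k < n) c k * W (t k) (x k) w.

Let lincomb0 : lincomb (fun=> 0).
Proof.
exists 0%N, (fun=> 0), (fun=> 0), (fun=> [tuple 0 | _ < d]); split => //.
by apply/funext => w; rewrite big_ord0.
Qed.

Let lincombD X Y (a : R) : lincomb X -> lincomb Y -> lincomb (fun w => X w + a * Y w).
Proof.
move=> [n [c [t [x [t0 ->]]]]] [m [c' [t' [x' [t'0 ->]]]]].
pose sel (U : Type) (f : 'I_n -> U) (g : 'I_m -> U) (k : 'I_(n + m)) := match fintype.split k with inl i => f i | inr j => g j end.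
exists (n + m)%N, (sel _ c (fun j => a * c' j)), (sel _ t t'), (sel _ x x'); split.
  by move=> k; rewrite /sel; case: fintype.split.
apply/funext => w; rewrite big_split_ord/= big_distrr/=; congr (_ + _); apply: eq_bigr => i _.
  by rewrite /sel; case: splitP => [j /= /val_inj <-//|j /= ij]; have := ltn_ord i; rewrite ij ltnNge leq_addr.
rewrite /sel; case: splitP => [j /= ij|j /= /addnI /val_inj <-]; last by rewrite mulrA.
by have := ltn_ord j; rewrite -ij ltnNge leq_addr.
Qed.

Let lincombW t x : 0 <= t -> lincomb (W t x).
Proof.
move=> t0; exists 1%N, (fun=> 1), (fun=> t), (fun=> x); split => //.
by apply/funext => w; rewrite big_ord1 mul1r.
Qed.

Let lincomb_sum (I : Type) (s : seq I) (a : I -> R) (X : I -> Omega -> R) :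
  (forall i, lincomb (X i)) -> lincomb (fun w => \sum_(i <- s) a i * X i w).
Proof.
move=> h; elim: s => [|i s IH].
  by under eq_fun => w do rewrite big_nil; exact: lincomb0.
by under eq_fun => w do rewrite big_cons addrC; exact: lincombD.
Qed.

Lemma step_integral_gaussian f : exists v, is_gaussian P (step_integral W f) 0 v.
Proof.
suff [n [c [t [x [t0 ->]]]]] : lincomb (step_integral W f) by exact: (fbs_gaussian hW).
apply: lincomb_sum => -[a r] /=; apply: lincomb_sum => S.
under eq_fun do rewrite -mulN1r.
by apply: lincombD; apply: lincombW; [exact: rt_ge0|exact: rs_ge0].
Qed.

Definition approximable phi : Prop := exists u, stepcvg u phi.

Lemma approximable_lin a phi psi : approximable phi -> approximable psi ->
  approximable (fun p => phi p + a * psi p).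
Proof. by move=> [u up] [v vp]; exists (fun n => step_lin a (u n) (v n)); exact: stepcvg_lin. Qed.

Lemma approximable_step f : approximable (step_fun f).
Proof. by exists (fun=> f); exact: stepcvg_step. Qed.

Lemma approximable_controllable phi : approximable phi -> controllable phi.
Proof. by move=> [u]; exact: stepcvg_controllable. Qed.

(* A limit of second moments: this is where the kernel is seen to be positive definite. *)
Lemma inner_ge0 phi : approximable phi -> 0 <= inner phi phi.
Proof.
move=> [u up]; have cv := stepcvg_inner hH0 hH up up.
rewrite -(cvg_lim _ cv)//; apply: limr_ge; first by apply/cvg_ex; eexists; exact: cv.
by apply: nearW => n; rewrite -lee_fin -sqint_step_integral sqint_ge0.
Qed.

(** The gap is t^-1 times the energy of phi - (1 + t) psi, so positivity of the energy is the only
    input. *)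
Lemma inner_young phi psi (t : R) : approximable phi -> approximable psi -> 0 < t ->
  inner phi phi <= (1 + t) * inner psi psi +
    (1 + t^-1) * inner (fun p => phi p - psi p) (fun p => phi p - psi p).
Proof.
move=> aphi apsi t0.
have [c1 c2] := (approximable_controllable aphi, approximable_controllable apsi).
have := inner_ge0 (approximable_lin (- (1 + t)) aphi apsi).
rewrite sub_linE !(inner_quad hH0 hH)//.
set a := inner phi phi; set b := inner phi psi + _; set c := inner psi psi => h.
rewrite -subr_ge0 (_ : _ - a = t^-1 * (a + - (1 + t) * b + (- (1 + t)) ^+ 2 * c)).
  by rewrite mulr_ge0// invr_ge0 ltW.
by field; rewrite gt_eqF.
Qed.

Lemma inner_subC phi psi : approximable phi -> approximable psi ->
  inner (fun p => phi p - psi p) (fun p => phi p - psi p) =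
  inner (fun p => psi p - phi p) (fun p => psi p - phi p).
Proof.
move=> aphi apsi.
have [c1 c2] := (approximable_controllable aphi, approximable_controllable apsi).
by rewrite !sub_linE !(inner_quad hH0 hH)//; ring.
Qed.

Lemma cvg_calH_energy u phi : approximable phi -> cvg_calH H0 H u phi ->
  inner (step_fun (u n)) (step_fun (u n)) @[n --> \oo] --> inner phi phi.
Proof.
move=> aphi uphi; apply: (quadratic_cvg _ _ uphi) => [n||n t t0|n t t0].
- exact: inner_ge0 (approximable_step _).
- exact: inner_ge0.
- by apply: inner_young => //; exact: approximable_step.
- rewrite inner_subC//; last exact: approximable_step.
  by apply: inner_young => //; exact: approximable_step.
Qed.

(** The second moments of the step integrals tend to that of [X] by mean-square convergence and to
    the energy of [phi] by [cvg_calH_energy]; hence the variance does not depend on the version or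
    on the sequence that defines it. *)
Lemma wiener_gaussian phi X : approximable phi -> is_wiener_integral H0 H W phi X ->
  is_gaussian P X 0 (inner phi phi).
Proof.
move=> aphi [_ X2 [u uphi /Lnorm2_cvg0 uX]].
have mX := Lfun2_measurable X2.
pose v n := inner (step_fun (u n)) (step_fun (u n)).
have gu n : is_gaussian P (step_integral W (u n)) 0 (v n).
  have [s gs] := step_integral_gaussian (u n).
  by have := gaussian_sqint gs; rewrite sqint_step_integral => -[vs]; rewrite /v vs.
have mu n := Lfun2_measurable (step_integral_Lfun2 (u n)).
have uoo n : (sqint P (step_integral W (u n)) < +oo)%E by exact/Lfun2P/step_integral_Lfun2.
have [_ cX] := sqint_cvg mu mX uoo uX.
suff -> : inner phi phi = fine (sqint P X) by exact: gaussian_limit gu mX uX.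
apply: (cvg_unique _ (cvg_calH_energy aphi uphi)) => //.
by move: cX; under eq_fun do rewrite sqint_step_integral/=.
Qed.

Lemma wiener_sub phi X psi Y : approximable phi -> approximable psi ->
  is_wiener_integral H0 H W phi X -> is_wiener_integral H0 H W psi Y ->
  is_wiener_integral H0 H W (fun p => phi p - psi p) (X \- Y).
Proof.
move=> aphi apsi [_ X2 [u uphi /Lnorm2_cvg0 uX]] [_ Y2 [v vpsi /Lnorm2_cvg0 vY]].
split.
- by rewrite sub_linE; have [w aw] := approximable_lin (-1) aphi apsi; exact: (stepcvg_in_calH hH0 hH aw).
- have l12 : (1 <= 2%:E :> \bar R)%E by rewrite lee_fin ler1n.
  exact: rpredB.
exists (fun n => step_lin (-1) (u n) (v n)).
  apply: (@squeeze_cvgr _ _ _ _ (cst 0) (fun n =>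
     2 * inner (fun p => step_fun (u n) p - phi p) (fun p => step_fun (u n) p - phi p) +
     2 * inner (fun p => step_fun (v n) p - psi p) (fun p => step_fun (v n) p - psi p))).
  - apply: nearW => n.
    have a1 : approximable (fun p => step_fun (u n) p - phi p).
      by rewrite sub_linE; apply: approximable_lin => //; exact: approximable_step.
    have a2 : approximable (fun p => step_fun (v n) p - psi p).
      by rewrite sub_linE; apply: approximable_lin => //; exact: approximable_step.
    have -> : (fun p => step_fun (step_lin (-1) (u n) (v n)) p - (phi p - psi p)) =
        (fun p => (step_fun (u n) p - phi p) + (-1) * (step_fun (v n) p - psi p)).
      by apply/funext => p; rewrite step_fun_lin; ring.
    rewrite inner_ge0/=; last exact: approximable_lin.
    (* Parallelogram law: the energy of the sum is nonnegative, so that of the difference is at most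
       twice the sum of the two energies. *)
    have := inner_ge0 (approximable_lin 1 a1 a2).
    have [c1 c2] := (approximable_controllable a1, approximable_controllable a2).
    by rewrite !(inner_quad hH0 hH)//; lra.
  - exact: cvg_cst.
  - rewrite -[X in _ --> X](_ : 2 * 0 + 2 * 0 = 0 :> R); last by rewrite !mulr0 addr0.
    by apply: cvgD; apply: cvgM => //; exact: cvg_cst.
apply/Lnorm2_cvg0.
have [mX mY] := (Lfun2_measurable X2, Lfun2_measurable Y2).
have mu n := Lfun2_measurable (step_integral_Lfun2 (u n)).
have mv n := Lfun2_measurable (step_integral_Lfun2 (v n)).
apply: (@squeeze_cvge _ _ _ _ (cst 0%E) _ (fun n =>
   2%:E * sqint P (step_integral W (u n) \- X) + 2%:E * sqint P (step_integral W (v n) \- Y))%E).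
- apply: nearW => n; rewrite sqint_ge0/=.
  rewrite (@eq_sqint _ _ _ P _ ((step_integral W (u n) \- X) \- (step_integral W (v n) \- Y))); last first.
    by move=> w; rewrite /= step_integral_lin; ring.
  by apply: sqintB2; exact: measurable_funB.
- exact: cvg_cst.
- exact: cvge0_double.
Qed.

End wiener_integrals.

(** * The approximating functions *)

Section heat_kernel_1d.
Context {R : realType}.
Local Notation mu := (@lebesgue_measure R).
Implicit Types (eps delta z : R).

Definition heat1 eps z : R := (2 * pi * eps) `^ (- 2^-1) * gauss_tail (2 * eps) z.

Lemma heat_kernelE d eps (z : d.-tuple R) : 0 < eps ->
  heat_kernel eps z = \prod_(i < d) heat1 eps (tnth z i).
Proof.
move=> e0; rewrite /heat_kernel big_split/= prodr_const card_ord.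
have -> : - (d%:R / 2) = - 2^-1 * d%:R :> R by rewrite mulNr mulrC.
rewrite powRrM powR_mulrn ?powR_ge0//; congr (_ * _).
rewrite -expR_sum; congr expR; rewrite mulNr mulr_suml -sumrN.
by apply: eq_bigr => i _; rewrite mulNr.
Qed.

Lemma heat1_ge0 eps z : 0 <= heat1 eps z.
Proof. by rewrite mulr_ge0 ?powR_ge0// gauss_tail_ge0. Qed.

Lemma heat1_le eps z : 0 < eps -> heat1 eps z <= (2 * pi * eps) `^ (- 2^-1).
Proof. by move=> e0; rewrite ler_piMr ?powR_ge0// gauss_tail_le1// mulr_gt0. Qed.

Lemma measurable_heat1 eps : measurable_fun setT (heat1 eps).
Proof. by apply: measurable_funM => //; exact: measurable_gauss_tail. Qed.

Lemma continuous_heat1 eps : continuous (heat1 eps).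
Proof.
move=> z; apply: cvgM; first exact: cvg_cst.
apply: continuous_comp; last exact: continuous_expR.
apply: cvgM; last exact: cvg_cst.
by apply: cvgN; exact: exprn_continuous.
Qed.

Lemma heat1_normal_pdf eps z : 0 < eps -> heat1 eps z = normal_pdf 0 (Num.sqrt eps) z.
Proof.
move=> e0; have s0 : Num.sqrt eps != 0 by rewrite sqrtr_eq0 -ltNge.
rewrite normal_pdfE// /normal_peak /normal_fun subr0 sqr_sqrtr ?(ltW e0)//.
rewrite /heat1 /gauss_tail powRN -powR12_sqrt; last first.
  by rewrite mulrn_wge0// mulr_ge0 ?pi_ge0// ltW.
congr (_^-1 * expR (_ / _)); last by rewrite mulr_natl.
by congr (_ `^ _); rewrite -mulr_natl; ring.
Qed.

Lemma integral_heat1 eps : 0 < eps -> (\int[mu]_z (heat1 eps z)%:E = 1)%E.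
Proof.
by move=> e0; under eq_integral => z _ do rewrite heat1_normal_pdf//; exact: integral_normal_pdf.
Qed.

Lemma integral_heat1_sub eps u : 0 < eps -> (\int[mu]_y (heat1 eps (u - y))%:E = 1)%E.
Proof.
move=> e0; rewrite -(integral_heat1 e0).
have me : measurable_fun setT (EFin \o heat1 eps).
  by apply/measurable_EFinP; exact: measurable_heat1.
rewrite -(@ge0_integral_shift _ (- u) _ me) => [|y]; last by rewrite lee_fin heat1_ge0.
by apply: eq_integral => y _; rewrite /heat1 /gauss_tail -sqrrN opprB.
Qed.

(** With k the square root of [eps], the kernel is at most the rational profile (2 k)^-1 / (1 + z^2
    / (2 k^2)). For this profile both weighted bounds are quadratic inequalities, and the second one
    yields exactly the scale k. *)
Lemma heat1_peaked eps u : 0 < eps -> peaked u (Num.sqrt eps) (fun y => heat1 eps (u - y)).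
Proof.
move=> e0; set k := Num.sqrt eps.
have k0 : 0 < k by rewrite sqrtr_gt0.
have ek : eps = k ^+ 2 by rewrite sqr_sqrtr// ltW.
(* [expR (- w) <= 1 / (1 + w)], and the normalizing constant is at most [1 / (2 k)] *)
have bnd z : heat1 eps z <= k^-1 / 2 * (1 + z ^+ 2 / (2 * k ^+ 2))^-1.
  apply: ler_pM; rewrite ?powR_ge0 ?gauss_tail_ge0//.
    rewrite powRN powR12_sqrt; last by rewrite !mulr_ge0 ?pi_ge0// ltW.
    rewrite -invfM lef_pV2 ?posrE ?mulr_gt0 ?sqrtr_gt0 ?mulr_gt0 ?pi_gt0//.
    rewrite -(@ler_pXn2r _ 2) ?nnegrE ?mulr_ge0 ?sqrtr_ge0 ?(ltW k0)//.
    rewrite sqr_sqrtr ?mulr_ge0 ?pi_ge0 ?(ltW e0)// ek exprMn mulrC ler_wpM2r ?sqr_ge0//.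
    by have := pi_ge2 R; lra.
  rewrite /gauss_tail mulNr expRN lef_pV2 ?posrE ?expR_gt0//.
    by rewrite ek; exact: expR_ge1Dx.
  by rewrite ltr_pwDl// divr_ge0 ?sqr_ge0// mulr_ge0// sqr_ge0.
have den z : 0 < 1 + z ^+ 2 / (2 * k ^+ 2).
  by rewrite ltr_pwDl// divr_ge0 ?sqr_ge0// mulr_ge0// sqr_ge0.
have mh : measurable_fun setT (fun y : R => heat1 eps (u - y)).
  by apply: (measurableT_comp (measurable_heat1 eps)); exact: measurable_funB.
split => //.
- by move=> y; exact: heat1_ge0.
- by rewrite integral_heat1_sub.
- move=> y; rewrite distrC; apply: le_trans (ler_wpM2l (normr_ge0 _) (bnd _)) _.
  rewrite -(real_normK (num_real (u - y))); set z := `|u - y|.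
  rewrite mulrA ler_pdivrMr ?mul1r; last by rewrite /z real_normK ?num_real.
  rewrite -subr_ge0 (_ : _ - _ = ((z / k - 2^-1) ^+ 2 + 7 / 4) / 2); last by field; rewrite gt_eqF.
  by rewrite divr_ge0// addr_ge0// sqr_ge0.
- move=> y; rewrite -normrN opprB; apply: le_trans (ler_wpM2l _ (bnd _)) _; first exact: exprn_ge0.
  rewrite real_normK ?num_real//; set z := (u - y).
  rewrite mulrA ler_pdivrMr//.
  rewrite -subr_ge0 (_ : _ - _ = k); last by field; rewrite gt_eqF.
  exact: ltW.
Qed.

End heat_kernel_1d.

(** * The approximating function as an integral along the path *)

Section weights.
Context {R : realType} (d : nat).
Variables (t : R) (x : d.-tuple R) (eps delta : R).
Hypotheses (t0 : 0 < t) (eps0 : 0 < eps) (delta0 : 0 < delta).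
Local Notation mu := (@lebesgue_measure R).
Local Notation spacetime := (measurableTypeR R * d.-tuple R)%type.
Implicit Types (p : spacetime) (b : 'I_d -> R -> R).

(** In the variable [r], the box kernel carried by [t - s - delta, t - s], cut to [0, t] since A is
    extended by 0. *)
Definition window (s r : R) : R := \1_`[0, t] r * box_kernel delta (t - s - r).

Definition weight b p s : R := \1_`[0, t] s *
  (window s p.1 * \prod_(i < d) heat1 eps (b i s + tnth x i - tnth p.2 i)).

Lemma window_ge0 s r : 0 <= window s r.
Proof. by rewrite mulr_ge0// mulr_ge0// invr_ge0 ltW. Qed.

Lemma window_le s r : window s r <= \1_`[0, t] r * delta^-1.
Proof. by rewrite ler_wpM2l// ler_piMr ?invr_ge0 ?(ltW delta0)// indicE lern1 leq_b1. Qed.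

Lemma weight_ge0 b p s : 0 <= weight b p s.
Proof.
by rewrite mulr_ge0// mulr_ge0 ?window_ge0// prodr_ge0// => i _; exact: heat1_ge0.
Qed.

Lemma approx_funE b p :
  approx_fun b t x eps delta p = fine (\int[mu]_s (weight b p s)%:E).
Proof.
rewrite /approx_fun; case: ifPn => pt; last first.
  rewrite integral0_eq//= => s _; rewrite /weight /window (_ : \1_`[0, t] p.1 = 0) ?mul0r ?mulr0//.
  by rewrite indicE memNset//= in_itv/=; exact/negP.
rewrite /Rintegral integral_mkcond; congr fine; apply: eq_integral => s _.
rewrite patchE /weight /window [in RHS]indicE; case: ifPn => st; last by rewrite mul0r.
rewrite mul1r indicE mem_set/= ?in_itv//= mul1r heat_kernelE//.
congr (_ * _)%:E.
by apply: eq_bigr => i _; rewrite (tnth_mktuple (fun i => b i s + tnth x i - tnth p.2 i)).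
Qed.

Lemma measurable_window (dZ : measure_display) (Z : measurableType dZ) (s r : Z -> R) :
  measurable_fun setT s -> measurable_fun setT r ->
  measurable_fun setT (fun z => window (s z) (r z)).
Proof.
move=> ms mr; have mi (a c : R) : measurable_fun setT (\1_`[a, c] : R -> R) by exact: measurable_indic.
apply: measurable_funM; first exact: (measurableT_comp (mi _ _)).
apply: measurable_funM => //; apply: (measurableT_comp (mi _ _)).
by apply: measurable_funB => //; exact: measurable_funB.
Qed.

(** The path may depend on the parameter. A constant path gives measurability in the space-time
    point; the sample path of the Brownian motion gives measurability in the sample point, which the
    functionals on the product space need. *)
Lemma measurable_approx (dZ : measure_display) (Z : measurableType dZ)
    (b : Z -> 'I_d -> R -> R) (p : Z -> spacetime) :
  (forall i, measurable_fun [set: Z * R] (fun zs => b zs.1 i zs.2)) ->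
  measurable_fun setT p ->
  measurable_fun setT (fun z => approx_fun (b z) t x eps delta (p z)).
Proof.
move=> mb mp; under eq_fun do rewrite approx_funE.
apply: measurableT_comp => //.
have mw : measurable_fun [set: Z * R] (fun zs => (weight (b zs.1) (p zs.1) zs.2)%:E).
  have mi : measurable_fun setT (\1_`[0, t] : R -> R) by exact: measurable_indic.
  have mp1 : measurable_fun [set: Z * R] (p \o fst) by exact: measurableT_comp.
  apply/measurable_EFinP; apply: measurable_funM; first exact: (measurableT_comp mi).
  apply: measurable_funM.
    by apply: measurable_window => //; exact: (measurableT_comp _ mp1).
  apply: measurable_prod => i _; apply: (measurableT_comp (measurable_heat1 eps)).
  apply: measurable_funB; first exact: measurable_funD.
  exact: (measurableT_comp (measurable_tnth i) (measurableT_comp measurable_snd mp1)).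
apply: (@measurable_fun_fubini_tonelli_F _ _ _ _ R mu _ mw) => zs.
by rewrite lee_fin weight_ge0.
Qed.

Let C0 : R := delta^-1 * ((2 * pi * eps) `^ (- 2^-1)) ^+ d.

Lemma weight_le b p s : weight b p s <= C0 * \1_`[0, t] s.
Proof.
rewrite /weight mulrC ler_wpM2r//; apply: ler_pM.
- exact: window_ge0.
- by apply: prodr_ge0 => i _; exact: heat1_ge0.
- by apply: le_trans (window_le _ _) _; rewrite ler_piMl ?invr_ge0 ?(ltW delta0)// indicE lern1 leq_b1.
- rewrite -[X in _ ^+ X](card_ord d) -prodr_const; apply: ler_prod => i _.
  by rewrite heat1_ge0 heat1_le.
Qed.

Lemma integral_indic_itv : (\int[mu]_s (\1_`[0%R, t] s)%:E = t%:E)%E.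
Proof.
have -> : (\int[mu]_s (\1_`[0%R, t] s)%:E = mu `[0%R, t]%classic)%E by rewrite integral_indic// setIT.
by rewrite lebesgue_measure_itv/= lte_fin t0 oppr0 adde0.
Qed.

Lemma integrable_indic_itv (c : R) : mu.-integrable setT (fun s => (c * \1_`[0, t] s)%:E).
Proof.
have mi : measurable_fun setT (\1_`[0, t] : R -> R) by exact: measurable_indic.
have i1 : mu.-integrable setT (fun s => (\1_`[0, t] s)%:E).
  apply/integrableP; split; first exact/measurable_EFinP.
  under eq_integral => s _ do rewrite gee0_abs ?lee_fin//.
  by rewrite integral_indic_itv ltry.
exact: eq_integrable (integrableZl measurableT c i1).
Qed.

Lemma measurable_weight b p : (forall i, measurable_fun setT (b i)) ->
  measurable_fun setT (weight b p).
Proof.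
move=> mb; have mi : measurable_fun setT (\1_`[0, t] : R -> R) by exact: measurable_indic.
apply: measurable_funM => //; apply: measurable_funM; first exact: measurable_window.
apply: measurable_prod => i _; apply: (measurableT_comp (measurable_heat1 eps)).
by apply: measurable_funB => //; exact: measurable_funD.
Qed.

Lemma integrable_weight b p : (forall i, measurable_fun setT (b i)) ->
  mu.-integrable setT (fun s => (weight b p s)%:E).
Proof.
move=> mb; apply: (le_integrable measurableT _ _ (integrable_indic_itv C0)).
  by apply/measurable_EFinP; exact: measurable_weight.
move=> s _; rewrite !abse_EFin lee_fin ger0_norm ?weight_ge0//.
by rewrite (le_trans (weight_le _ _ _))// ler_norm.
Qed.

Lemma approx_fun_integral b p : (forall i, measurable_fun setT (b i)) ->
  ((approx_fun b t x eps delta p)%:E = \int[mu]_s (weight b p s)%:E)%E.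
Proof.
by move=> mb; rewrite approx_funE fineK//; exact: integrable_fin_num (integrable_weight _ mb).
Qed.

Lemma approx_fun_ge0 b p : 0 <= approx_fun b t x eps delta p.
Proof. by rewrite approx_funE fine_ge0// integral_ge0// => s _; rewrite lee_fin weight_ge0. Qed.

Lemma indic_itv_cvg (z : nat -> R) (l : R) : z @ \oo --> l -> l != 0 -> l != delta ->
  (\1_`[0, delta] (z n) : R) @[n --> \oo] --> (\1_`[0, delta] l : R).
Proof.
move=> zl l0 ld; apply: cvg_near_cst.
case: (ltgtP l 0) l0 => // [l0 _|l0 _].
  near=> n; rewrite !indicE !memNset//= in_itv/=; apply/negP; rewrite negb_and -!ltNge ?l0//.
  by apply/orP; left; near: n; exact: (cvgr_lt l zl).
case: (ltgtP l delta) ld => // [ld _|ld _].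
  near=> n; rewrite !indicE !mem_set//= in_itv/=; first by rewrite !ltW.
  apply/andP; split; apply: ltW; near: n; first exact: (cvgr_gt l zl).
  exact: (cvgr_lt l zl).
near=> n; rewrite !indicE !memNset//= in_itv/=; apply/negP; rewrite negb_and -!ltNge ?ld ?orbT//.
by apply/orP; right; near: n; exact: (cvgr_gt l zl).
Unshelve. all: by end_near. Qed.

Lemma approx_fun_cvg b (p : nat -> spacetime) (p' : spacetime) :
  (forall i, measurable_fun setT (b i)) ->
  (forall n, 0 <= (p n).1 <= t) -> 0 <= p'.1 <= t ->
  (p n).1 @[n --> \oo] --> p'.1 ->
  (forall i, tnth (p n).2 i @[n --> \oo] --> tnth p'.2 i) ->
  approx_fun b t x eps delta (p n) @[n --> \oo] --> approx_fun b t x eps delta p'.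
Proof.
move=> mb pt pt' p1 p2.
under eq_fun do rewrite approx_funE; rewrite approx_funE.
have ae1 : {ae mu, forall s, setT s -> (weight b (p n) s)%:E @[n --> \oo] --> (weight b p' s)%:E}.
  (* The box kernel jumps only where t - s - p'.1 is 0 or [delta], that is at two values of s. *)
  have neg : mu.-negligible ([set t - p'.1] `|` [set t - p'.1 - delta]).
    by apply: negligibleU; apply/negligibleP => //; exact: lebesgue_measure_set1.
  apply: (negligibleS _ neg) => s /=; apply: contra_notP => /not_orP[s1 s2] _.
  apply: cvg_EFin; first exact: nearW.
  apply: cvgM; first exact: cvg_cst.
  apply: cvgM; last first.
    apply: cvg_big => [|i _]; first exact: mul_continuous.
    apply: (@cvg_comp _ _ _ (fun n => b i s + tnth x i - tnth (p n).2 i) (heat1 eps)); last exact: continuous_heat1.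
    by apply: cvgB; [exact: cvg_cst|exact: p2].
  apply: cvgM.
    apply: cvg_near_cst; apply: nearW => n.
    by rewrite !indicE !mem_set/= ?in_itv//=.
  apply: cvgM; first exact: cvg_cst.
  apply: indic_itv_cvg.
  - by apply: cvgB => //; exact: cvg_cst.
  - by apply/eqP => h; apply: s1; lra.
  - by apply/eqP => h; apply: s2; lra.
have ae2 : {ae mu, forall s n, setT s -> (`|(weight b (p n) s)%:E| <= (C0 * \1_`[0, t] s)%:E)%E}.
  by apply: aeW => s n _; rewrite abse_EFin lee_fin ger0_norm ?weight_ge0// weight_le.
have [i1 _ cv] := @dominated_convergence _ _ R mu _ measurableT _ _ _
  (fun n => (measurable_int _ (integrable_weight (p n) mb)))
  (measurable_int _ (integrable_weight p' mb)) ae1 (integrable_indic_itv C0) ae2.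
by apply: fine_cvg; rewrite fineK//; exact: integrable_fin_num i1.
Qed.

Lemma approx_fun_controlled b (m : R) : (forall i, measurable_fun setT (b i)) ->
  (forall i s, 0 <= s <= t -> `|b i s + tnth x i| <= m) ->
  exists2 C, 0 <= C & controlled C t (4 * eps) (approx_fun b t x eps delta).
Proof.
move=> mb bm.
(* A Gaussian centered at u with |u| <= m is compared with a centered one of twice the variance: (u
   - y)^2 >= y^2 / 2 - u^2, and the term u^2 <= m^2 costs the exponential factor. This is also the
   origin of 4 eps in place of 2 eps. *)
pose k : R := (2 * pi * eps) `^ (- 2^-1) * expR (m ^+ 2 / (2 * eps)).
have k0 : 0 <= k by rewrite mulr_ge0 ?powR_ge0 ?expR_ge0.
exists (t * (delta^-1 * k ^+ d)).
  by rewrite mulr_ge0 ?(ltW t0)// mulr_ge0 ?exprn_ge0// invr_ge0 ltW.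
split.
  apply: (@measurable_approx _ _ (fun=> b) id) => // i.
  exact: (measurableT_comp (mb i)).
move=> p; rewrite ger0_norm ?approx_fun_ge0// -lee_fin approx_fun_integral//.
have hk (i : 'I_d) s : 0 <= s <= t ->
    heat1 eps (b i s + tnth x i - tnth p.2 i) <= k * gauss_tail (4 * eps) (tnth p.2 i).
  move=> st; rewrite /heat1 /k -[leRHS]mulrA ler_wpM2l ?powR_ge0//.
  rewrite /gauss_tail -expRD ler_expR.
  set u := b i s + _; set y := tnth _ _.
  have um : u ^+ 2 <= m ^+ 2.
    by rewrite -(real_normK (num_real u)) ler_pXn2r ?nnegrE ?(le_trans _ (bm i s st))//; exact: bm.
  rewrite -subr_ge0.
  have -> : m ^+ 2 / (2 * eps) + - y ^+ 2 / (4 * eps) - - (u - y) ^+ 2 / (2 * eps) =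
      ((m ^+ 2 - u ^+ 2) * 2 + (y - 2 * u) ^+ 2) / (4 * eps) by field; rewrite gt_eqF.
  by rewrite divr_ge0 ?mulr_ge0 ?(ltW eps0)// addr_ge0 ?sqr_ge0// mulr_ge0// subr_ge0.
have wle s : weight b p s <= (delta^-1 * \1_`[0, t] p.1 * \prod_(i < d) (k * gauss_tail (4 * eps) (tnth p.2 i))) * \1_`[0, t] s.
  rewrite /weight mulrC [X in X * _ <= _]mulrC.
  rewrite [\1_`[0, t] s]indicE; case: (boolP (s \in _)) => [st|_]; last by rewrite !mulr0.
  rewrite !mulr1 [leLHS]mulrC; apply: ler_pM.
  - exact: window_ge0.
  - by apply: prodr_ge0 => i _; exact: heat1_ge0.
  - by rewrite mulrC; exact: window_le.
  - apply: ler_prod => i _; rewrite heat1_ge0 hk//.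
    by move: st; rewrite inE/= in_itv.
apply: (@le_trans _ _ (\int[mu]_s ((delta^-1 * \1_`[0, t] p.1 *
    \prod_(i < d) (k * gauss_tail (4 * eps) (tnth p.2 i))) * \1_`[0, t] s)%:E)%E).
  apply: ge0_le_integral => //.
  - by move=> s _; rewrite lee_fin weight_ge0.
  - by apply/measurable_EFinP; exact: measurable_weight.
  - exact: (measurable_int _ (integrable_indic_itv _)).
  - by move=> s _; rewrite lee_fin wle.
have c0 : 0 <= delta^-1 * \1_`[0, t] p.1 * \prod_(i < d) (k * gauss_tail (4 * eps) (tnth p.2 i)).
  rewrite mulr_ge0 ?prodr_ge0// => [|i _]; last by rewrite mulr_ge0// gauss_tail_ge0.
  by rewrite mulr_ge0// invr_ge0 ltW.
under eq_integral => s _ do rewrite EFinM.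
have mi : measurable_fun setT (\1_`[0, t] : R -> R) by exact: measurable_indic.
rewrite ge0_integralZl//; last exact/measurable_EFinP.
rewrite integral_indic_itv -EFinM lee_fin /envelope.
rewrite big_split/= prodr_const card_ord le_eqVlt; apply/orP; left; apply/eqP; ring.
Qed.

End weights.

Section one_hot.
Context {R : realType} (I : finType).

Lemma zero_one_sum0 (F a : I -> R) : (forall j, 0 <= F j) -> \sum_j F j = 0 ->
  \sum_j a j * F j = 0.
Proof.
move=> F0 S0; have z := psumr_eq0P (fun j _ => F0 j) S0.
by rewrite big1// => j _; rewrite z// mulr0.
Qed.

(** Applied to the indicators of the cells of a partition at a given point: exactly one of them is
    1, and it selects the coefficient of its cell. *)
Lemma zero_one_sum1 (F : I -> R) : (forall j, F j = 0 \/ F j = 1) -> \sum_j F j = 1 ->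
  exists2 j, F j = 1 & forall a, \sum_i a i * F i = a j.
Proof.
move=> F01 S1; have F0 j : 0 <= F j by case: (F01 j) => ->.
have [j Fj] : exists j, F j = 1.
  apply/not_existsP => h; have : \sum_j F j = 0.
    by rewrite big1// => j _; case: (F01 j) => // /h.
  by rewrite S1 => /eqP; rewrite oner_eq0.
exists j => // a; rewrite (bigD1 j)//= Fj mulr1 -[RHS]addr0; congr (_ + _).
move: S1; rewrite (bigD1 j)//= Fj -[RHS]addr0 => /addrI S0.
have z := psumr_eq0P (fun i _ => F0 i) S0.
by rewrite big1// => i ij; rewrite z// mulr0.
Qed.

End one_hot.

Lemma sum_indic_oc (R : realType) (a : nat -> R) (m : nat) (z : R) :
  {homo a : i j / (i <= j)%N >-> i <= j} ->
  \sum_(j < m) (\1_`]a j, a j.+1] z : R) = \1_`]a 0%N, a m] z.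
Proof.
move=> am.
have e (u v : R) : u <= v -> \1_`]u, v] z = ((u < z)%R : nat)%:R - ((v < z)%R : nat)%:R :> R.
  move=> uv; rewrite indicE mem_setE in_itv/= [v < z]ltNge.
  by case: (ltP u z) => uz; case: (leP z v) => zv //=; rewrite ?subr0 ?subrr//; move: (lt_le_trans zv uz); rewrite ltNge uv.
under eq_bigr => j _ do rewrite e ?am// -opprB.
rewrite e ?am// sumrN -(big_mkord xpredT (fun j => ((a j.+1 < z)%R : nat)%:R - ((a j < z)%R : nat)%:R)) telescope_sumr//.
by rewrite opprB.
Qed.

(** * Approximation of a continuous function on a refining grid *)

Section grid.
Context {R : realType} (d : nat) (t : R).
Hypothesis t0 : 0 < t.
Local Notation spacetime := (measurableTypeR R * d.-tuple R)%type.
Implicit Types (phi : spacetime -> R) (p : spacetime) (n : nat).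

(** In space the mesh 1 / (n + 1) shrinks while the box ]-(n + 1), n + 1] grows, which is why there
    are 2 (n + 1)^2 cells in each direction. *)
Definition grid_time n (k : nat) : R := t * (k%:R / n.+1%:R).
Definition grid_space n (j : nat) : R := j%:R / n.+1%:R - n.+1%:R.

Let N0 n : 0 < n.+1%:R :> R. Proof. by rewrite ltr0n. Qed.

Lemma grid_time_ge0 n k : 0 <= grid_time n k.
Proof. by rewrite mulr_ge0 ?(ltW t0)// divr_ge0. Qed.

Lemma grid_time_homo n : {homo grid_time n : i j / (i <= j)%N >-> i <= j}.
Proof. by move=> i j ij; rewrite ler_wpM2l ?(ltW t0)// ler_wpM2r ?invr_ge0// ler_nat. Qed.

Lemma grid_space_homo n : {homo grid_space n : i j / (i <= j)%N >-> i <= j}.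
Proof. by move=> i j ij; rewrite lerD2r ler_wpM2r ?invr_ge0// ler_nat. Qed.

Definition grid_point n (k : nat) (f : 'I_d -> nat) : spacetime :=
  (grid_time n k, [tuple grid_space n (f i) | i < d]).

Definition grid_rect n (k : nat) (f : 'I_d -> nat) : @rectangle R d.
apply: (@Rectangle R d (grid_time n k) (grid_time n k.+1)
  [tuple grid_space n (f i) | i < d] [tuple grid_space n (f i).+1 | i < d]).
- exact: grid_time_ge0.
- exact: grid_time_homo.
- by move=> i; rewrite !tnth_mktuple; exact: grid_space_homo.
Defined.

Definition grid_index n : finType := ('I_n.+1 * {ffun 'I_d -> 'I_(2 * n.+1 * n.+1)})%type.

Definition grid_step phi n : @step R d :=
  [seq (phi (grid_point n kf.1 (fun i => kf.2 i)), grid_rect n kf.1 (fun i => kf.2 i))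
  | kf : grid_index n <- enum (grid_index n)].

Lemma step_fun_grid phi n p : step_fun (grid_step phi n) p =
  \sum_(kf : grid_index n) phi (grid_point n kf.1 (fun i => kf.2 i)) *
     \1_(rect_set (grid_rect n kf.1 (fun i => kf.2 i))) p.
Proof. by rewrite /step_fun /grid_step big_map big_enum. Qed.

Lemma sum_indic_grid n p :
  \sum_(kf : grid_index n) \1_(rect_set (grid_rect n kf.1 (fun i => kf.2 i))) p =
  \1_`]0, t] p.1 * \prod_(i < d) \1_`]- n.+1%:R, n.+1%:R] (tnth p.2 i) :> R.
Proof.
under eq_bigr => kf _ do rewrite indic_rect/=.
rewrite -(pair_big xpredT xpredT (fun (k : 'I_n.+1) (f : {ffun 'I_d -> 'I_(2 * n.+1 * n.+1)}) =>
  \1_`]grid_time n k, grid_time n k.+1] p.1 *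
  \prod_(i < d) \1_`]tnth [tuple grid_space n (f i) | i < d] i,
     tnth [tuple grid_space n (f i).+1 | i < d] i] (tnth p.2 i)))/=.
have -> : \prod_(i < d) \1_`]- n.+1%:R, n.+1%:R] (tnth p.2 i) =
    \sum_(f : {ffun 'I_d -> 'I_(2 * n.+1 * n.+1)}) \prod_(i < d)
      \1_`]tnth [tuple grid_space n (f i) | i < d] i,
         tnth [tuple grid_space n (f i).+1 | i < d] i] (tnth p.2 i) :> R.
  under [RHS]eq_bigr => f _ do under eq_bigr => i _ do rewrite !tnth_mktuple.
  rewrite -(bigA_distr_bigA (fun i (j : 'I_(2 * n.+1 * n.+1)) =>
     \1_`]grid_space n j, grid_space n j.+1] (tnth p.2 i))).
  apply: eq_bigr => i _; rewrite sum_indic_oc; last exact: grid_space_homo.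
  have -> : grid_space n 0 = - n.+1%:R by rewrite /grid_space mul0r sub0r.
  have -> // : grid_space n (2 * n.+1 * n.+1) = n.+1%:R.
  by rewrite /grid_space natrM mulfK ?gt_eqF// natrM; ring.
rewrite -big_distrlr/= sum_indic_oc; last exact: grid_time_homo.
have -> : grid_time n 0 = 0 by rewrite /grid_time mul0r mulr0.
by have -> : grid_time n n.+1 = t by rewrite /grid_time divff ?mulr1// gt_eqF.
Qed.

(** This keeps all that is needed of the grid: either the step function takes the value of [phi] at
    a corner within one mesh of [p], or it vanishes and [p] is not in the interior of the space box
    at a time of ]0, t]. *)
Lemma step_fun_gridP phi n p :
  (exists c : spacetime, [/\ step_fun (grid_step phi n) p = phi c,
     0 <= c.1 < p.1, p.1 <= t, p.1 <= c.1 + t / n.+1%:R &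
     forall i, tnth c.2 i < tnth p.2 i <= tnth c.2 i + n.+1%:R^-1]) \/
  (step_fun (grid_step phi n) p = 0 /\
   ~ (0 < p.1 <= t /\ forall i, `|tnth p.2 i| < n.+1%:R)).
Proof.
rewrite step_fun_grid; have S := sum_indic_grid n p.
case: (pselect (0 < p.1 <= t /\ forall i, - n.+1%:R < tnth p.2 i <= n.+1%:R)) => [[pt px]|np].
  have {}S : \sum_(kf : grid_index n) \1_(rect_set (grid_rect n kf.1 (fun i => kf.2 i))) p = 1 :> R.
    rewrite S indicE mem_set/= ?in_itv//= mul1r big1// => i _.
    by rewrite indicE mem_set//= in_itv/= px.
  have [|[k f] /= rp h] := zero_one_sum1 _ S.
    by move=> j; rewrite indicE; case: (_ \in _); [right|left].
  left; exists (grid_point n k (fun i => f i)); rewrite h.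
  have : p \in rect_set (grid_rect n k (fun i => f i)).
    by apply: contraT => np; move: rp; rewrite indicE (negbTE np) => /esym/eqP; rewrite oner_eq0.
  rewrite inE => -[/= /andP[r1 r2] rx]; split => //.
  - by rewrite grid_time_ge0.
  - by case/andP: pt.
  - by rewrite (le_trans r2)// /grid_time -mulrDr -natr1 mulrDl mul1r.
  - move=> i; move: (rx i); rewrite !tnth_mktuple => /andP[-> /= h2].
    by rewrite (le_trans h2)// /grid_space -natr1 mulrDl mul1r addrAC.
right; split; last first.
  move=> [pt px]; apply: np; split => // i; have := px i; rewrite ltr_norml => /andP[-> /ltW //].
apply: zero_one_sum0 => [j|]; first by rewrite indicE ler0n.
rewrite S; apply/eqP; apply: contra_notT np; rewrite mulf_eq0 negb_or => /andP[h1 h2].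
split.
  by apply: contraNT h1 => h; rewrite indicE memNset//= in_itv/=; exact/negP.
move=> i; apply: contraNT h2 => h; rewrite (bigD1 i)//= indicE memNset ?mul0r//= in_itv/=.
exact/negP.
Qed.

(** Continuity is sequential and confined to times in [0, t], because an approximating function may
    jump at both ends of this interval. Corners of cells used at a point with time in ]0, t] stay in
    it. *)
Lemma stepcvg_grid C l phi : 0 <= C -> 0 < l -> controlled C t l phi ->
  (forall (p : nat -> spacetime) (p' : spacetime),
     (forall n, 0 <= (p n).1 <= t) -> 0 <= p'.1 <= t ->
     (p n).1 @[n --> \oo] --> p'.1 ->
     (forall i, tnth (p n).2 i @[n --> \oo] --> tnth p'.2 i) ->
     phi (p n) @[n --> \oo] --> phi p') ->
  stepcvg (grid_step phi) phi.
Proof.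
move=> C0 l0 [mphi cphi] phi_cont.
have e1 : 1 <= expR l^-1 :> R by rewrite -expR0 ler_expR invr_ge0 ltW.
(* The step function at [p] is [phi] at a corner whose coordinates differ by at most 1. Doubling the
   width of the tail compensates the shift, up to a factor exp(1 / l) in each direction. *)
exists (C * expR l^-1 ^+ d), t, (2 * l); split => //.
- by rewrite mulr_ge0// exprn_ge0// expR_ge0.
- by rewrite mulr_gt0.
split.
- apply: (controlled_le C0 _ _ l0 _ (conj mphi cphi)) => //.
    by rewrite ler_peMr// exprn_ege1.
  by rewrite ler_peMl ?(ltW l0)// ler1n.
- move=> n; split.
    have -> : step_fun (grid_step phi n) = (fun p => \sum_(kf : grid_index n)
        phi (grid_point n kf.1 (fun i => kf.2 i)) *
        \1_(rect_set (grid_rect n kf.1 (fun i => kf.2 i))) p).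
      by apply/funext => p; exact: step_fun_grid.
    apply: measurable_sum => kf; apply: measurable_funM => //; exact: measurable_indic_rect.
  move=> p; have [[c [-> /andP[c0 cp] pt _ cx]]|[-> _]] := step_fun_gridP phi n p; last first.
    by rewrite normr0 envelope_ge0// mulr_ge0// exprn_ge0// expR_ge0.
  apply: le_trans (cphi c) _; rewrite /envelope.
  have -> : \1_`[0, t] c.1 = 1 :> R.
    by rewrite indicE mem_set//= in_itv/= c0 (le_trans (ltW cp) pt).
  have -> : \1_`[0, t] p.1 = 1 :> R.
    by rewrite indicE mem_set//= in_itv/= pt (le_trans c0 (ltW cp)).
  rewrite !mulr1 -mulrA ler_wpM2l// -[X in _ ^+ X](card_ord d) -prodr_const -big_split/=.
  apply: ler_prod => i _; rewrite gauss_tail_ge0/= /gauss_tail -expRD ler_expR.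
  have /andP[h1 h2] := cx i; set y := tnth c.2 i; set z := tnth p.2 i.
  have n1 : n.+1%:R^-1 <= 1 :> R by rewrite invf_le1// ler1n.
  have h : (z - y) ^+ 2 <= 1.
    have : `|z - y| <= 1.
      by rewrite ger0_norm ?subr_ge0 ?(ltW h1)// lerBlDl (le_trans h2)// lerD2l.
    by move=> h; rewrite -(real_normK (num_real (z - y))) expr_le1.
  rewrite -subr_ge0.
  rewrite (_ : _ - _ = ((1 - (z - y) ^+ 2) * 2 + (z - 2 * y) ^+ 2) / (2 * l)); last first.
    by field; rewrite gt_eqF.
  by rewrite divr_ge0 ?mulr_ge0 ?(ltW l0)// addr_ge0 ?sqr_ge0// mulr_ge0// subr_ge0.
- move=> p p0; have [pt|pt] := leP p.1 t; last first.
    have -> : phi p = 0.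
      apply/eqP; rewrite -normr_le0; apply: le_trans (cphi p) _.
      by rewrite /envelope indicE memNset ?mulr0 ?mul0r//= in_itv/= (leNgt p.1) pt andbF.
    apply: cvg_near_cst; apply: nearW => n.
    have [[c [_ _ pt' _ _]]|[-> _ //]] := step_fun_gridP phi n p.
    by move: pt; rewrite ltNge pt'.
  (* A nearby point is provided for every n, [p] itself if the grid does not yet reach it, so that a
     sequence converging to [p] can be chosen; the value of the step function is prescribed only
     once the box contains [p]. *)
  pose good n (c : spacetime) := [/\ 0 <= c.1 <= t, `|c.1 - p.1| <= t / n.+1%:R,
     forall i, `|tnth c.2 i - tnth p.2 i| <= n.+1%:R^-1 &
     (forall i, `|tnth p.2 i| < n.+1%:R) -> step_fun (grid_step phi n) p = phi c].
  have ex n : exists c, good n c.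
    have [[c [e /andP[c0 cp] _ c1 cx]]|[_ np]] := step_fun_gridP phi n p.
      exists c; split => //; first by rewrite c0 (le_trans (ltW cp) pt).
        by rewrite distrC ger0_norm ?lerBlDl// subr_ge0 ltW.
      move=> i; have /andP[h1 h2] := cx i.
      by rewrite distrC ger0_norm ?lerBlDl// subr_ge0 ltW.
    exists p; split; first by rewrite pt ltW.
    + by rewrite subrr normr0 divr_ge0// ltW.
    + by move=> i; rewrite subrr normr0 invr_ge0.
    + by move=> px; exfalso; apply: np; rewrite p0 pt.
  have [c cP] := choice ex.
  have N00 : (n.+1%:R^-1 : R) @[n --> \oo] --> 0 by exact: cvg_harmonic.
  have cv : phi (c n) @[n --> \oo] --> phi p.
    apply: phi_cont => [n||| i].
    - by have [] := cP n.
    - by rewrite pt ltW.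
    - apply/subr_cvg0; apply/norm_cvg0P.
      apply: (@squeeze_cvgr _ _ _ _ (cst 0) (fun n => t / n.+1%:R)).
      + by apply: nearW => n; rewrite normr_ge0/=; have [] := cP n.
      + exact: cvg_cst.
      + by rewrite -(mulr0 t); apply: cvgM => //; exact: cvg_cst.
    - apply/subr_cvg0; apply/norm_cvg0P.
      apply: (@squeeze_cvgr _ _ _ _ (cst 0) (fun n => n.+1%:R^-1)) => //.
      + by apply: nearW => n; rewrite normr_ge0/=; have [_ _ + _] := cP n; exact.
      + exact: cvg_cst.
  apply: cvg_trans cv; apply: near_eq_cvg; near=> n.
  have [_ _ _ ->//] := cP n => i.
  have : \sum_(i < d) `|tnth p.2 i| < n.+1%:R.
    near: n; exists (Num.truncn (\sum_(i < d) `|tnth p.2 i|)) => // m /= h.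
    by apply: (lt_le_trans (truncnS_gt _)); rewrite ler_nat ltnS.
  by apply: le_lt_trans; rewrite (bigD1 i)//= lerDl sumr_ge0.
Unshelve. all: by end_near. Qed.

End grid.

Section window_peaked.
Context {R : realType}.
Local Notation mu := (@lebesgue_measure R).
Variables (t delta : R).
Hypotheses (t0 : 0 < t) (delta0 : 0 < delta).

Lemma integral_box (u : R) : (\int[mu]_r (box_kernel delta (u - r))%:E = 1)%E.
Proof.
have mi : measurable_fun setT (\1_`[u - delta, u] : R -> R) by exact: measurable_indic.
transitivity (\int[mu]_r ((delta^-1)%:E * (\1_`[(u - delta)%R, u] r)%:E))%E.
  apply: eq_integral => r _; rewrite -EFinM /box_kernel !indicE !mem_setE !in_itv/=.
  by congr (_ * (nat_of_bool _)%:R)%:E; apply/idP/idP => /andP[? ?]; apply/andP; split; lra.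
rewrite ge0_integralZl//; last 2 first.
- exact/measurable_EFinP.
- by rewrite lee_fin invr_ge0 ltW.
have -> : (\int[mu]_r (\1_`[(u - delta)%R, u] r)%:E = mu `[(u - delta)%R, u]%classic)%E.
  by rewrite integral_indic// setIT.
rewrite lebesgue_measure_itv/= lte_fin ltrBlDr ltrDl delta0 -EFinB -EFinM.
by congr EFin; field; rewrite gt_eqF.
Qed.

Lemma window_peaked s : peaked (t - s) delta (window t delta s).
Proof.
have m1 : measurable_fun setT (fun r => window t delta s r).
  exact: (@measurable_window _ _ _ _ _ (fun=> s) id).
have b0 r : 0 <= box_kernel delta (t - s - r) by rewrite mulr_ge0// invr_ge0 ltW.
have wb r : window t delta s r <= box_kernel delta (t - s - r).
  by rewrite ler_piMl// indicE; case: (_ \in _).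
have bE r : `|r - (t - s)| * box_kernel delta (t - s - r) <= 1 /\
    `|r - (t - s)| ^+ 2 * box_kernel delta (t - s - r) <= delta.
  rewrite /box_kernel indicE mem_setE in_itv/=.
  case: (boolP (0 <= t - s - r <= delta)) => [/andP[h1 h2]|_]/=; last by rewrite !mulr0 ler01 (ltW delta0).
  rewrite mulr1 distrC ger0_norm//; split; rewrite ler_pdivrMr ?mul1r//.
  by rewrite -expr2 ler_pXn2r ?nnegrE// ltW.
split => //.
- by move=> r; exact: window_ge0.
- rewrite -(integral_box (t - s)); apply: ge0_le_integral => //.
  + by move=> r _; rewrite lee_fin window_ge0.
  + exact/measurable_EFinP.
  + apply/measurable_EFinP; apply: measurable_funM => //.
    have mi : measurable_fun setT (\1_`[0, delta] : R -> R) by exact: measurable_indic.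
    by apply: (measurableT_comp mi); exact: measurable_funB.
  + by move=> r _; rewrite lee_fin.
- by move=> r; apply: le_trans (ler_wpM2l _ (wb r)) (bE r).1.
- by move=> r; apply: le_trans (ler_wpM2l _ (wb r)) (bE r).2.
Qed.

(** No mass is cut off once [delta] is at most t - s; every s < t is eventually in this case as
    [delta] decreases, but s = t never is. *)
Lemma integral_window s : 0 <= s -> delta <= t - s -> (\int[mu]_r (window t delta s r)%:E = 1)%E.
Proof.
move=> s0 ds; rewrite -(integral_box (t - s)); apply: eq_integral => r _.
congr EFin; rewrite /window /box_kernel !indicE !mem_setE !in_itv/=.
have [h|h] := boolP (0 <= t - s - r <= delta); last by rewrite !mulr0.
have -> : (0 <= r <= t) = true by move: h => /andP[? ?]; apply/andP; split; lra.
by rewrite mul1r.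
Qed.

End window_peaked.

Lemma near_cvg_EFin (R : realType) (f : nat -> \bar R) (l : R) :
  (forall e, 0 < e -> \forall n \near \oo, ((l - e)%:E <= f n <= (l + e)%:E)%E) ->
  f @ \oo --> l%:E.
Proof.
move=> h; apply/fine_cvgP; split.
  have := h 1 ltr01; apply: filterS => n /andP[h1 h2].
  by rewrite fin_numElt (lt_le_trans _ h1) ?ltNyr//= (le_lt_trans h2) ?ltry.
apply/cvgrPdist_le => e e0; have := h e e0; apply: filterS => n /andP[h1 h2].
have fn : f n \is a fin_num by rewrite fin_numElt (lt_le_trans _ h1) ?ltNyr//= (le_lt_trans h2) ?ltry.
rewrite -(fineK fn) !lee_fin in h1 h2.
by rewrite /= ler_norml; apply/andP; split; lra.
Qed.

Lemma cvg_prode (R : realType) (I : Type) (r : seq I) (f : I -> nat -> \bar R) (l : I -> R) :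
  (forall i, f i @ \oo --> (l i)%:E) ->
  (\prod_(i <- r) f i n)%E @[n --> \oo] --> (\prod_(i <- r) l i)%:E.
Proof.
move=> fl; elim: r => [|i r IH].
  by rewrite big_nil; under eq_fun do rewrite big_nil; exact: cvg_cst.
by rewrite big_cons EFinM; under eq_fun do rewrite big_cons; exact: cvgeM.
Qed.

Lemma lee_prode (R : realType) (I : Type) (r : seq I) (f g : I -> \bar R) :
  (forall i, 0 <= f i <= g i)%E -> (\prod_(i <- r) f i <= \prod_(i <- r) g i)%E.
Proof.
move=> fg; have f0 i : (0 <= f i)%E by have /andP[] := fg i.
elim: r => [|i r IH]; first by rewrite !big_nil.
by rewrite !big_cons lee_pmul// ?prode_ge0//; have /andP[] := fg i.
Qed.

(** * Inner products of approximating functions along a fixed path *)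

Section approx_inner.
Context {R : realType} (d : nat).
Variables (H0 : R) (H : 'I_d -> R).
Hypotheses (hH0 : 2^-1 < H0 < 1) (hH : forall i, 2^-1 < H i < 1).
Variables (t : R) (x : d.-tuple R) (b : 'I_d -> R -> R) (m : R).
Hypotheses (t0 : 0 < t) (mb : forall i, measurable_fun setT (b i)).
Hypothesis bm : forall i s, 0 <= s <= t -> `|b i s + tnth x i| <= m.
Local Notation mu := (@lebesgue_measure R).
Local Notation mu2 := (prodm mu mu).
Local Notation spacetime := (measurableTypeR R * d.-tuple R)%type.
Local Notation M := (prodm (lebesgue_spacetime R d) (lebesgue_spacetime R d)).
Local Notation half2 := (@halfspace R d `*` @halfspace R d).
Local Notation K pq := (kernelH H0 H pq.1 pq.2).
Local Notation A := (approx_fun b t x).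
Local Notation inner := (innerH H0 H).

Definition square_indic (z : R * R) : R := \1_`[0, t] z.1 * \1_`[0, t] z.2.

Definition path_kernel (z : R * R) : R :=
  `|z.1 - z.2| `^ (2 * H0 - 2) * \prod_(i < d) `|b i z.1 - b i z.2| `^ (2 * H i - 2).

Definition path_energy : \bar R := (\int[mu2]_z (square_indic z * path_kernel z)%:E)%E.

Lemma measurable_path_kernel : measurable_fun [set: R * R] (fun z => square_indic z * path_kernel z).
Proof.
have mi : measurable_fun setT (\1_`[0, t] : R -> R) by exact: measurable_indic.
apply: measurable_funM; first by apply: measurable_funM; exact: (measurableT_comp mi).
apply: measurable_funM.
  by apply: (measurableT_comp (measurable_norm_powR _)); exact: measurable_funB.
apply: measurable_prod => i _; apply: (measurableT_comp (measurable_norm_powR _)).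
by apply: measurable_funB; exact: (measurableT_comp (mb i)).
Qed.

Lemma square_path_kernel_ge0 z : 0 <= square_indic z * path_kernel z.
Proof.
by rewrite mulr_ge0 ?mulr_ge0 ?powR_ge0// prodr_ge0// => i _; exact: powR_ge0.
Qed.

Section two_regularizations.
Variables (e1 d1 e2 d2 : R).
Hypotheses (e10 : 0 < e1) (d10 : 0 < d1) (e20 : 0 < e2) (d20 : 0 < d2).

Let G (z : R * R) (pq : spacetime * spacetime) : R :=
  weight t x e1 d1 b pq.1 z.1 * weight t x e2 d2 b pq.2 z.2 * K pq.

(** The pairing, through the kernel, of the two regularized point masses that the path contributes
    at the times z.1 and z.2. *)
Definition smeared (z : R * R) : \bar R := (\int[M]_pq (G z pq)%:E)%E.

Let G0 z pq : (0 <= (G z pq)%:E)%E.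
Proof. by rewrite lee_fin mulr_ge0 ?kernelH_ge0// mulr_ge0 ?weight_ge0. Qed.

Let mweight e dd (dZ : measure_display) (Z : measurableType dZ) (p : Z -> spacetime) (s : Z -> R) :
  measurable_fun setT p -> measurable_fun setT s ->
  measurable_fun setT (fun z => weight t x e dd b (p z) (s z)).
Proof.
move=> mp ms.
have mi : measurable_fun setT (\1_`[0, t] : R -> R) by exact: measurable_indic.
apply: measurable_funM; first exact: (measurableT_comp mi).
apply: measurable_funM.
  by apply: measurable_window => //; exact: (measurableT_comp measurable_fst).
apply: measurable_prod => i _; apply: (measurableT_comp (measurable_heat1 e)).
apply: measurable_funB; first by apply: measurable_funD => //; exact: (measurableT_comp (mb i)).
exact: (measurableT_comp (measurable_tnth i) (measurableT_comp measurable_snd mp)).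
Qed.

Let mG : measurable_fun [set: (R * R) * (spacetime * spacetime)] (fun zp => (G zp.1 zp.2)%:E).
Proof.
apply/measurable_EFinP; apply: measurable_funM; last first.
  exact: (measurableT_comp (measurable_kernelH H0 H)).
apply: measurable_funM; apply: mweight.
- exact: (measurableT_comp measurable_fst measurable_snd).
- exact: (measurableT_comp measurable_fst measurable_fst).
- exact: (measurableT_comp measurable_snd measurable_snd).
- exact: (measurableT_comp measurable_snd measurable_fst).
Qed.

Lemma measurable_smeared : measurable_fun [set: R * R] smeared.
Proof. by apply: (@measurable_fun_fubini_tonelli_F _ _ _ _ R M _ mG) => zp; exact: G0. Qed.

Lemma smearedE z : smeared z = ((square_indic z)%:E *
  (smear (2 * H0 - 1) (window t d1 z.1) (window t d2 z.2) *
   \prod_(i < d) smear (2 * H i - 1) (fun y => heat1 e1 (b i z.1 + tnth x i - y))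
      (fun y => heat1 e2 (b i z.2 + tnth x i - y))))%E.
Proof.
have mh e (u : R) : measurable_fun setT (fun y : R => heat1 e (u - y)).
  by apply: (measurableT_comp (measurable_heat1 e)); exact: measurable_funB.
have mw dd s : measurable_fun setT (window t dd s).
  exact: (@measurable_window _ _ _ _ _ (fun=> s) id).
rewrite /smear.
have h2 (h : R) : 2 * h - 1 - 1 = 2 * h - 2 by ring.
rewrite h2; under eq_bigr => i _ do rewrite h2.
rewrite -(@integral_tensor_kernelH R d H0 H (window t d1 z.1) (window t d2 z.2)
  (fun i y => heat1 e1 (b i z.1 + tnth x i - y)) (fun i y => heat1 e2 (b i z.2 + tnth x i - y)))//; last 4 first.
- by move=> r; exact: window_ge0.
- by move=> r; exact: window_ge0.
- by move=> i r; exact: heat1_ge0.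
- by move=> i r; exact: heat1_ge0.
rewrite -ge0_integralZl//.
- by apply: eq_integral => pq _; rewrite -EFinM /G /weight /square_indic; congr EFin; ring.
- apply/measurable_EFinP; apply: measurable_funM; last exact: measurable_kernelH.
  have mm dd e s (u : 'I_d -> R) : measurable_fun [set: spacetime]
      (fun p => window t dd s p.1 * \prod_(i < d) heat1 e (u i - tnth p.2 i)).
    apply: measurable_funM; first exact: (measurableT_comp (mw dd s)).
    apply: measurable_prod => i _.
    exact: (measurableT_comp (mh e (u i)) (measurableT_comp (measurable_tnth i) measurable_snd)).
  by apply: measurable_funM; apply: (measurableT_comp (mm _ _ _ (fun i => _))).
- move=> pq _; rewrite lee_fin mulr_ge0 ?kernelH_ge0// mulr_ge0// mulr_ge0 ?window_ge0//.
    by apply: prodr_ge0 => i _; exact: heat1_ge0.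
  by apply: prodr_ge0 => i _; exact: heat1_ge0.
- by rewrite lee_fin mulr_ge0.
Qed.

Lemma approx_innerE : (inner (A e1 d1) (A e2 d2))%:E =
  ((alphaH H0 H)%:E * \int[mu2]_z smeared z)%E.
Proof.
have [C1 C10 c1] := approx_fun_controlled t0 e10 d10 mb bm.
have [C2 C20 c2] := approx_fun_controlled t0 e20 d20 mb bm.
have e40 (e : R) : 0 < e -> 0 < 4 * e by move=> ?; rewrite mulr_gt0.
have [C [l [C0 l0 {}c1 {}c2]]] : exists C l, [/\ 0 <= C, 0 < l,
    controlled C t l (A e1 d1) & controlled C t l (A e2 d2)].
  exists (C1 + C2), (4 * e1 + 4 * e2); have := e40 _ e10; have := e40 _ e20.
  split; try lra; [apply: controlled_le c1|apply: controlled_le c2] => //; lra.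
have i1 := integrable_pairing hH0 hH C0 t0 l0 c1 c2.
have mz (pq : spacetime * spacetime) : measurable_fun [set: R * R] (fun z => (G z pq)%:E).
  exact: (measurableT_comp mG (measurable_pair2 pq)).
rewrite /innerH EFinM; congr (_ * _)%E.
(* The pairing converges absolutely because both functions lie under one envelope, so the
   real-valued integral is a true value; the rest is Tonelli for nonnegative integrands. *)
rewrite /Rintegral fineK; last exact: (@integrable_fin_num _ _ R M half2 (@measurable_half2 R d) _ i1).
transitivity (\int[M]_pq \int[mu2]_z (G z pq)%:E)%E; last first.
  by rewrite -(@fubini_tonelli _ _ _ _ R mu2 M _ mG).
rewrite integral_mkcond; apply: eq_integral => pq _.
rewrite patchE; case: ifPn => pqh; last first.
  rewrite integral0_eq// => z _; rewrite /G.
  have out e dd p s : ~ halfspace p -> weight t x e dd b p s = 0.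
    move=> np; rewrite /weight /window (_ : \1_`[0, t] p.1 = 0) ?mul0r ?mulr0//.
    by rewrite indicE memNset//= in_itv/= => /andP[? _].
  case: (pselect (halfspace pq.1)) => h1; last by rewrite out// !mul0r.
  rewrite (out e2)// ?mulr0 ?mul0r// => h2.
  by move: pqh; rewrite notin_setE; apply.
rewrite (@ge0_integral_prodm1 _ _ _ _ R mu mu _ (mz pq))//.
have [ma1 ma2] : measurable_fun setT (weight t x e1 d1 b pq.1) /\ measurable_fun setT (weight t x e2 d2 b pq.2).
  by split; exact: measurable_weight.
have w0 e dd p s : 0 < dd -> (0 <= (weight t x e dd b p s)%:E)%E by move=> ?; rewrite lee_fin weight_ge0.
transitivity (\int[mu]_s ((A e2 d2 pq.2 * K pq)%:E * (weight t x e1 d1 b pq.1 s)%:E))%E.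
  rewrite ge0_integralZl//.
  - by rewrite -approx_fun_integral// -EFinM; congr EFin; ring.
  - exact/measurable_EFinP.
  - by move=> s _; exact: w0.
  - by rewrite lee_fin mulr_ge0 ?kernelH_ge0// approx_fun_ge0.
apply: eq_integral => s _.
transitivity (\int[mu]_s' ((weight t x e1 d1 b pq.1 s * K pq)%:E * (weight t x e2 d2 b pq.2 s')%:E))%E.
  rewrite ge0_integralZl//.
  - by rewrite -approx_fun_integral// -!EFinM; congr EFin; ring.
  - exact/measurable_EFinP.
  - by move=> s' _; exact: w0.
  - by rewrite lee_fin mulr_ge0 ?kernelH_ge0// weight_ge0.
by apply: eq_integral => s' _; rewrite -EFinM /G/=; congr EFin; ring.
Qed.

Definition smear_bound : R :=
  smoothing_const (2 * H0 - 1) * \prod_(i < d) smoothing_const (2 * H i - 1).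

(** Coinciding coordinates have to be excluded: negative powers of 0 are 0, so the right-hand side
    would vanish there. *)
Lemma smeared_le z : z.1 != z.2 -> (forall i, b i z.1 != b i z.2) ->
  (smeared z <= (smear_bound * (square_indic z * path_kernel z))%:E)%E.
Proof.
move=> z12 bz; rewrite smearedE.
have h01 (h : R) : 2^-1 < h < 1 -> 0 < 2 * h - 1 /\ 2 * h - 1 < 1 by move=> /andP[? ?]; split; lra.
have [a1 a2] := h01 _ hH0.
have s0 : (0 <= smear (2 * H0 - 1) (window t d1 z.1) (window t d2 z.2))%E.
  exact: smear_ge0 (window_peaked t d10 z.1) (window_peaked t d20 z.2) _.
have t1 : (smear (2 * H0 - 1) (window t d1 z.1) (window t d2 z.2) <=
    (smoothing_const (2 * H0 - 1) * `|z.1 - z.2| `^ (2 * H0 - 2))%:E)%E.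
  have := smear_le (window_peaked t d10 z.1) (window_peaked t d20 z.2) a1 a2.
  rewrite (_ : t - z.1 - (t - z.2) = z.2 - z.1); last by ring.
  rewrite (distrC z.2) (_ : 2 * H0 - 1 - 1 = 2 * H0 - 2); last by ring.
  by apply; apply: contra z12 => /eqP h; apply/eqP; lra.
have t2 i : (0 <= smear (2 * H i - 1) (fun y => heat1 e1 (b i z.1 + tnth x i - y))
      (fun y => heat1 e2 (b i z.2 + tnth x i - y)) <=
    (smoothing_const (2 * H i - 1) * `|b i z.1 - b i z.2| `^ (2 * H i - 2))%:E)%E.
  have [c1 c2] := h01 _ (hH i).
  have p1 := heat1_peaked (b i z.1 + tnth x i) e10.
  have p2 := heat1_peaked (b i z.2 + tnth x i) e20.
  rewrite (smear_ge0 p1 p2)/=; have := smear_le p1 p2 c1 c2.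
  rewrite (_ : b i z.1 + tnth x i - (b i z.2 + tnth x i) = b i z.1 - b i z.2); last by ring.
  rewrite (_ : 2 * H i - 1 - 1 = 2 * H i - 2); last by ring.
  by apply; apply: contra (bz i) => /eqP h; apply/eqP; lra.
rewrite (_ : _ * (_ * _) = square_indic z * ((smoothing_const (2 * H0 - 1) * `|z.1 - z.2| `^ (2 * H0 - 2)) *
  \prod_(i < d) (smoothing_const (2 * H i - 1) * `|b i z.1 - b i z.2| `^ (2 * H i - 2)))); last first.
  by rewrite big_split/= /smear_bound /path_kernel; ring.
rewrite [leRHS]EFinM; apply: lee_wpmul2l; first by rewrite lee_fin mulr_ge0.
rewrite [leRHS]EFinM -prodEFin; apply: lee_pmul => //.
  by apply: prode_ge0 => i _; have /andP[] := t2 i.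
by apply: lee_prode => i; exact: t2.
Qed.

End two_regularizations.

Lemma negligible_diagonal : mu2.-negligible [set z : R * R | z.1 = z.2].
Proof.
have mD : measurable [set z : R * R | z.1 = z.2].
  rewrite (_ : [set z | _] = (fun z : R * R => z.1 - z.2) @^-1` [set 0]).
    rewrite -[X in measurable X]setTI; apply: measurable_funB => //; exact: measurable_set1.
  by apply/seteqP; split => z /=; [move=> ->; rewrite subrr|move/subr0_eq].
exists [set z : R * R | z.1 = z.2]; split; [exact: mD| |exact: subset_refl].
rewrite /= /prodm /product_measure1 integral0_eq// => s _ /=.
rewrite (_ : xsection _ s = [set s]) ?lebesgue_measure_set1//.
by apply/seteqP; split => r; rewrite /xsection/= inE/=.
Qed.

Let negligible_fst (c : R) : mu2.-negligible [set z : R * R | z.1 = c].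
Proof.
exists ([set c] `*` setT); split; first exact: measurableX.
  by apply: etrans (product_measure1E _ _ _ _) _ => //; rewrite [X in (X * _)%E](lebesgue_measure_set1 c) mul0e.
by move=> [z1 z2] /= ->.
Qed.

Let negligible_snd (c : R) : mu2.-negligible [set z : R * R | z.2 = c].
Proof.
exists (setT `*` [set c]); split; first exact: measurableX.
  by apply: etrans (product_measure1E _ _ _ _) _ => //; rewrite [X in (_ * X)%E](lebesgue_measure_set1 c) mule0.
by move=> [z1 z2] /= ->.
Qed.

Section limits.
Hypothesis energy : (path_energy < +oo)%E.
Hypothesis separated : mu2.-negligible
  [set z : R * R | (0 <= z.1 <= t) /\ (0 <= z.2 <= t) /\ exists i, b i z.1 = b i z.2].

(** The pairs of times left out of the limit: the diagonal, the coincidences of coordinates of the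
    path, and the final time [t], where the window does not keep its mass. *)
Let bad : set (R * R) := [set z | z.1 = z.2] `|` ([set z | z.1 = t] `|` [set z | z.2 = t]) `|`
  [set z : R * R | (0 <= z.1 <= t) /\ (0 <= z.2 <= t) /\ exists i, b i z.1 = b i z.2].

Let negligible_bad : mu2.-negligible bad.
Proof.
apply: negligibleU => //; apply: negligibleU; first exact: negligible_diagonal.
by apply: negligibleU; [exact: negligible_fst|exact: negligible_snd].
Qed.

Let square_indicP z : ~ bad z ->
  square_indic z = 0 \/ [/\ 0 <= z.1 < t, 0 <= z.2 < t, z.1 != z.2 & forall i, b i z.1 != b i z.2].
Proof.
move=> /not_orP[/not_orP[z12 /not_orP[z1 z2]] zb].
have [h|h] := boolP ((0 <= z.1 <= t) && (0 <= z.2 <= t)); last first.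
  left; move: h; rewrite negb_and /square_indic => /orP[h|h].
    by rewrite [X in X * _]indicE memNset ?mul0r//= in_itv/=; exact/negP.
  by rewrite [X in _ * X]indicE memNset ?mulr0//= in_itv/=; exact/negP.
right; move: h => /andP[h1 h2]; split.
- by move: h1 => /andP[-> h1]; rewrite lt_neqAle h1 andbT; exact/eqP.
- by move: h2 => /andP[-> h2]; rewrite lt_neqAle h2 andbT; exact/eqP.
- exact/eqP.
- by move=> i; apply/eqP => bi; apply: zb; split => //; split => //; exists i.
Qed.

Let integrable_energy (c : R) : mu2.-integrable setT (fun z => (c * (square_indic z * path_kernel z))%:E).
Proof.
have i1 : mu2.-integrable setT (fun z => (square_indic z * path_kernel z)%:E).
  apply/integrableP; split; first by apply/measurable_EFinP; exact: measurable_path_kernel.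
  by under eq_integral => z _ do rewrite gee0_abs ?lee_fin ?square_path_kernel_ge0//.
exact: eq_integrable (integrableZl measurableT c i1).
Qed.

Lemma smear_bound_ge0 : 0 <= smear_bound.
Proof.
have h0 (h : R) : 2^-1 < h < 1 -> 0 <= smoothing_const (2 * h - 1).
  by move=> /andP[? ?]; apply: smoothing_const_ge0; lra.
by rewrite mulr_ge0 ?h0// prodr_ge0// => i _; exact: h0.
Qed.

Let smeared_le_ae e1 d1 e2 d2 z : 0 < e1 -> 0 < d1 -> 0 < e2 -> 0 < d2 -> ~ bad z ->
  (`|smeared e1 d1 e2 d2 z| <= (smear_bound * (square_indic z * path_kernel z))%:E)%E.
Proof.
move=> e10 d10 e20 d20 nb; rewrite gee0_abs; last first.
  by apply: integral_ge0 => pq _; rewrite lee_fin mulr_ge0 ?kernelH_ge0// mulr_ge0 ?weight_ge0.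
have [z0|[z1 z2 z12 bz]] := square_indicP nb; last exact: smeared_le.
by rewrite smearedE// z0 mul0e mul0r mulr0.
Qed.

(** The bound does not depend on the four parameters; as a function of the path it is what dominates
    the integration with respect to the Brownian motion. *)
Lemma approx_inner_le e1 d1 e2 d2 : 0 < e1 -> 0 < d1 -> 0 < e2 -> 0 < d2 ->
  inner (A e1 d1) (A e2 d2) <= alphaH H0 H * (smear_bound * fine path_energy).
Proof.
move=> e10 d10 e20 d20; rewrite -lee_fin approx_innerE//.
have a0 := alphaH_gt0 hH0 hH.
have s0 z : (0 <= smeared e1 d1 e2 d2 z)%E.
  by apply: integral_ge0 => pq _; rewrite lee_fin mulr_ge0 ?kernelH_ge0// mulr_ge0 ?weight_ge0.
have fe : path_energy \is a fin_num.
  by rewrite ge0_fin_numE// integral_ge0// => z _; rewrite lee_fin square_path_kernel_ge0.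
rewrite [leRHS]EFinM lee_wpmul2l ?lee_fin ?(ltW a0)// EFinM fineK//.
rewrite -ge0_integralZl//; last 3 first.
- by apply/measurable_EFinP; exact: measurable_path_kernel.
- by move=> z _; rewrite lee_fin square_path_kernel_ge0.
- by rewrite lee_fin smear_bound_ge0.
apply: ae_ge0_le_integral => //.
- exact: measurable_smeared.
- by move=> z _; rewrite mule_ge0 ?lee_fin ?smear_bound_ge0 ?square_path_kernel_ge0.
- by apply: emeasurable_funM => //; apply/measurable_EFinP; exact: measurable_path_kernel.
- apply: (negligibleS _ negligible_bad) => z /=; apply: contra_notP => nb _.
  by rewrite -EFinM; have := smeared_le_ae e10 d10 e20 d20 nb; rewrite gee0_abs.
Qed.

Section sequences.
Variables (e1 d1 e2 d2 : nat -> R).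
Hypotheses (e10 : forall n, 0 < e1 n) (d10 : forall n, 0 < d1 n).
Hypotheses (e20 : forall n, 0 < e2 n) (d20 : forall n, 0 < d2 n).
Hypotheses (e1_0 : e1 @ \oo --> 0) (d1_0 : d1 @ \oo --> 0).
Hypotheses (e2_0 : e2 @ \oo --> 0) (d2_0 : d2 @ \oo --> 0).

Let near_lt (u : nat -> R) c : u @ \oo --> 0 -> 0 < c -> \forall n \near \oo, u n <= c.
Proof. 
move=> u0 c0; near=> n; apply: ltW; near: n; exact: (cvgr_lt 0 u0).
Unshelve. all: by end_near. Qed.

Let near_sqrt_lt (u : nat -> R) c : u @ \oo --> 0 -> 0 < c -> \forall n \near \oo, Num.sqrt (u n) <= c.
Proof.
move=> u0 c0; have := near_lt u0 (exprn_gt0 2 c0); apply: filterS => n h.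
by rewrite -(ger0_norm (ltW c0)) -sqrtr_sqr ler_wsqrtr.
Qed.

Lemma smeared_cvg z : ~ bad z ->
  smeared (e1 n) (d1 n) (e2 n) (d2 n) z @[n --> \oo] --> (square_indic z * path_kernel z)%:E.
Proof.
move=> nb; have [z0|[/andP[z10 z1] /andP[z20 z2] z12 bz]] := square_indicP nb.
  rewrite z0 mul0r; apply: cvg_near_cst; apply: nearW => n.
  by rewrite smearedE// z0 mul0e.
under eq_fun do rewrite smearedE//.
have h01 (h : R) : 2^-1 < h < 1 -> 0 < 2 * h - 1 /\ 2 * h - 1 < 1 by move=> /andP[? ?]; split; lra.
have c0 : smear (2 * H0 - 1) (window t (d1 n) z.1) (window t (d2 n) z.2) @[n --> \oo] -->
    (`|z.1 - z.2| `^ (2 * H0 - 2))%:E.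
  have [a1 a2] := h01 _ hH0.
  apply: near_cvg_EFin => e e_gt0.
  have uv : t - z.1 != t - z.2 by apply: contra z12 => /eqP h; apply/eqP; lra.
  have [dl dl0 Hd] := smear_cvg a1 a2 uv e_gt0.
  rewrite (_ : t - z.1 - (t - z.2) = z.2 - z.1) in Hd; last by ring.
  rewrite (distrC z.2) (_ : 2 * H0 - 1 - 1 = 2 * H0 - 2) in Hd; last by ring.
  have tz1 : 0 < t - z.1 by rewrite subr_gt0.
  have tz2 : 0 < t - z.2 by rewrite subr_gt0.
  near=> n; apply: (Hd _ _ _ _ (window_peaked t (d10 n) z.1) (window_peaked t (d20 n) z.2)).
  - by near: n; exact: near_lt.
  - by near: n; exact: near_lt.
  - by apply: integral_window => //; near: n; exact: near_lt.
  - by apply: integral_window => //; near: n; exact: near_lt.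
have ci i : smear (2 * H i - 1) (fun y => heat1 (e1 n) (b i z.1 + tnth x i - y))
      (fun y => heat1 (e2 n) (b i z.2 + tnth x i - y)) @[n --> \oo] -->
    (`|b i z.1 - b i z.2| `^ (2 * H i - 2))%:E.
  have [a1 a2] := h01 _ (hH i).
  apply: near_cvg_EFin => e e_gt0.
  have uv : b i z.1 + tnth x i != b i z.2 + tnth x i.
    by apply: contra (bz i) => /eqP h; apply/eqP; lra.
  have [dl dl0 Hd] := smear_cvg a1 a2 uv e_gt0.
  rewrite (_ : _ - (_ + _) = b i z.1 - b i z.2) in Hd; last by ring.
  rewrite (_ : 2 * H i - 1 - 1 = 2 * H i - 2) in Hd; last by ring.
  have int1 (u e' : R) : 0 < e' -> (\int[mu]_y (heat1 e' (u - y))%:E = 1)%E by exact: integral_heat1_sub.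
  near=> n; apply: (Hd _ _ _ _ (heat1_peaked _ (e10 n)) (heat1_peaked _ (e20 n))).
  - by near: n; exact: near_sqrt_lt.
  - by near: n; exact: near_sqrt_lt.
  - exact: int1.
  - exact: int1.
have -> : (square_indic z * path_kernel z)%:E = ((square_indic z)%:E *
    ((`|z.1 - z.2| `^ (2 * H0 - 2))%:E * (\prod_(i < d) `|b i z.1 - b i z.2| `^ (2 * H i - 2))%:E))%E.
  by rewrite -!EFinM.
apply: cvgeM => //; first exact: cvg_cst.
by apply: cvgeM => //; exact: cvg_prode.
Unshelve. all: by end_near. Qed.

(** The two pairs of sequences are unrelated: squares and cross terms have one and the same limit,
    which makes the distances between approximations vanish. *)
Lemma approx_inner_cvg :
  inner (A (e1 n) (d1 n)) (A (e2 n) (d2 n)) @[n --> \oo] --> alphaH H0 H * fine path_energy.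
Proof.
have ae1 : {ae mu2, forall z, setT z -> smeared (e1 n) (d1 n) (e2 n) (d2 n) z @[n --> \oo] -->
    (square_indic z * path_kernel z)%:E}.
  by apply: (negligibleS _ negligible_bad) => z /=; apply: contra_notP => nb _; exact: smeared_cvg.
have ae2 : {ae mu2, forall z n, setT z -> (`|smeared (e1 n) (d1 n) (e2 n) (d2 n) z| <=
    (smear_bound * (square_indic z * path_kernel z))%:E)%E}.
  apply: (negligibleS _ negligible_bad) => z /=; apply: contra_notP => nb n _; exact: smeared_le_ae.
have mlim : measurable_fun setT (fun z => (square_indic z * path_kernel z)%:E).
  by apply/measurable_EFinP; exact: measurable_path_kernel.
have [i1 _ cv] := @dominated_convergence _ _ R mu2 _ measurableT _ _ _
  (fun n => measurable_smeared (e1 n) (e2 n) (d10 n) (d20 n)) mlim ae1 (integrable_energy smear_bound) ae2.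
have fe : path_energy \is a fin_num.
  by rewrite ge0_fin_numE// integral_ge0// => z _; rewrite lee_fin square_path_kernel_ge0.
have cv' : ((alphaH H0 H)%:E * \int[mu2]_z smeared (e1 n) (d1 n) (e2 n) (d2 n) z)%E @[n --> \oo] -->
   (alphaH H0 H * fine path_energy)%:E.
  have -> : (alphaH H0 H * fine path_energy)%:E = ((alphaH H0 H)%:E * path_energy)%E by rewrite EFinM fineK.
  by apply: cvgeZl.
rewrite (_ : (fun n => _) = fine \o (fun n => (alphaH H0 H)%:E *
    \int[mu2]_z smeared (e1 n) (d1 n) (e2 n) (d2 n) z)%E); first exact: fine_cvg.
by apply/funext => n; rewrite /= -approx_innerE.
Qed.

End sequences.
End limits.

End approx_inner.

(** * Brownian paths *)

(** Selection among countably many functions by a measurable index. It serves both for discretizing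
    time and for subsequences that depend on the path. *)
Lemma measurable_fun_nat_index d d' (Z : measurableType d) (T : measurableType d')
    (k : Z -> nat) (F : nat -> Z -> T) :
  (forall m, measurable (k @^-1` [set m])) -> (forall m, measurable_fun setT (F m)) ->
  measurable_fun setT (fun z => F (k z) z).
Proof.
move=> mk mF _ Y mY; rewrite setTI.
rewrite (_ : _ @^-1` Y = \bigcup_m (k @^-1` [set m] `&` F m @^-1` Y)); last first.
  apply/seteqP; split => z /=; first by exists (k z).
  by move=> [m _ [/= -> ]].
apply: bigcup_measurable => m _; apply: measurableI => //.
by rewrite -[X in measurable X]setTI; exact: mF.
Qed.

Lemma measurable_truncn d (Z : measurableType d) (R : realType) (f : Z -> R) m :
  measurable_fun setT f -> (forall z, 0 <= f z) ->
  measurable ((fun z => Num.truncn (f z)) @^-1` [set m]).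
Proof.
move=> mf f0.
rewrite (_ : _ @^-1` _ = f @^-1` `[m%:R, m.+1%:R[).
  by rewrite -[X in measurable X]setTI; apply: mf => //; exact: measurable_itv.
apply/seteqP; split => z /=; rewrite in_itv/=; last exact: truncn_def.
by move=> <-; exact: truncn_itv.
Qed.

Lemma max0_cvg (R : realType) (I : Type) (F : set_system I) {FF : Filter F} (u : I -> R) (l : R) :
  u @ F --> l -> Num.max (u i) 0 @[i --> F] --> Num.max l 0.
Proof.
move=> ul; rewrite maxr_absE; under eq_fun do rewrite maxr_absE.
apply: cvgM; last exact: cvg_cst.
apply: cvgD; first by apply: cvgD => //; exact: cvg_cst.
by apply: cvg_norm; apply: cvgB => //; exact: cvg_cst.
Qed.

Lemma dyadic_floor_cvg (R : realType) (s : R) :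
  ((Num.truncn (n.+1%:R * Num.max s 0))%:R / n.+1%:R : R) @[n --> \oo] --> Num.max s 0.
Proof.
set r := Num.max s 0; have r0 : 0 <= r by rewrite le_max lexx orbT.
have h0 : (n.+1%:R^-1 : R) @[n --> \oo] --> 0 by exact: cvg_harmonic.
apply: (@squeeze_cvgr _ _ _ _ (fun n => r - n.+1%:R^-1) (cst r)).
- apply: nearW => n; have n0 : 0 < n.+1%:R :> R by rewrite ltr0n.
  have /andP[h1 h2] := truncn_itv (mulr_ge0 (ltW n0) r0).
  rewrite /= ler_pdivrMr// [r * _]mulrC h1 andbT ler_pdivlMr// mulrBl mulVf ?gt_eqF//.
  by rewrite lerBlDr mulrC natr1 ltW.
- by rewrite -[X in _ --> X]subr0; apply: cvgB => //; exact: cvg_cst.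
- exact: cvg_cst.
Qed.

(** A continuous process is the limit of its values at the multiples of 1 / (n + 1), where time
    takes countably many values. Times are truncated at 0, as rounding down is used on the
    nonnegative half-line. *)
Lemma measurable_continuous_process d (Z : measurableType d) (R : realType) (X : R -> Z -> R) :
  (forall s, measurable_fun setT (X s)) -> (forall z, continuous (X^~ z)) ->
  measurable_fun [set: Z * R] (fun zs => X (Num.max zs.2 0) zs.1).
Proof.
move=> mX cX.
apply: (@measurable_fun_cvg _ _ _ _ (fun n (zs : Z * R) =>
  X ((Num.truncn (n.+1%:R * Num.max zs.2 0))%:R / n.+1%:R) zs.1)) => [n|[z s] _] /=.
  apply: (@measurable_fun_nat_index _ _ _ _ (fun zs : Z * R => Num.truncn (n.+1%:R * Num.max zs.2 0))
     (fun m zs => X (m%:R / n.+1%:R) zs.1)) => m.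
    apply: measurable_truncn => [|zs]; last by rewrite mulr_ge0// le_max lexx orbT.
    by apply: measurable_funM => //; apply: measurable_maxr.
  exact: (measurableT_comp (mX _)).
apply: (@cvg_comp _ _ _ (fun n => (Num.truncn (n.+1%:R * Num.max s 0))%:R / n.+1%:R) (X^~ z)).
  exact: dyadic_floor_cvg.
exact: cX.
Qed.

Section brownian_modification.
Context dO (Omega : measurableType dO) (R : realType) (P : probability Omega R) (d : nat).
Variable B : 'I_d -> R -> {RV P >-> R}.
Hypothesis hB : standard_brownian_motion B.

(** The paths of [B] are continuous only almost surely and only on nonnegative times. The
    modification is 0 on a measurable null set containing the bad paths and is frozen at its initial
    value for negative times; it is continuous everywhere, hence jointly measurable. *)
Lemma brownian_modification : exists b : Omega -> 'I_d -> R -> R,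
  [/\ forall i s, measurable_fun setT (fun w => b w i s),
      forall w i, continuous (b w i),
      forall i, measurable_fun [set: Omega * R] (fun ws => b ws.1 i ws.2) &
      {ae P, forall w, forall i s, 0 <= s -> b w i s = B i s w}].
Proof.
have [N [mN PN NB]] := bm_continuous hB.
pose b w i s := \1_(~` N) w * B i (Num.max s 0) w.
have mb i s : measurable_fun setT (fun w => b w i s).
  apply: measurable_funM; last exact: measurable_funP.
  by apply: measurable_indic; exact: measurableC.
have cb w i : continuous (b w i).
  rewrite /b indicE; case: (boolP (w \in ~` N)) => [wN|_]; last first.
    by under eq_fun do rewrite mul0r; exact: cst_continuous.
  under eq_fun do rewrite mul1r.
  have /(_ i)/subspace_continuousP cB : forall i, {within `[0, +oo[, continuous (fun s => B i s w)}.
    by apply: contrapT => nc; move: wN; rewrite inE; apply; exact: NB.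
  move=> s; have r0 : 0 <= Num.max s 0 by rewrite le_max lexx orbT.
  apply: (@cvg_comp _ _ _ (fun y : R => Num.max y 0) (fun y => B i y w) _
     (within `[0, +oo[ (nbhs (Num.max s 0)))).
    have h : Num.max y 0 @[y --> s] --> Num.max s 0 by apply: max0_cvg; exact: cvg_id.
    move=> U wU; have := h [set z | `[0, +oo[%classic z -> U z] wU; apply: (@filterS _ (nbhs s)) => y /= Uy; apply: Uy.
    by rewrite in_itv/= andbT le_max lexx orbT.
  by apply: cB; rewrite /= in_itv/= andbT.
exists b; split => //.
- move=> i; rewrite (_ : (fun ws => b ws.1 i ws.2) = (fun zs : Omega * R => b zs.1 i (Num.max zs.2 0))).
    exact: measurable_continuous_process (mb i) (fun w => cb w i).
  by apply/funext => ws; rewrite /b/= -maxA maxxx.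
- exists N; split => // w /= nb; apply: contrapT => wN; apply: nb => i s s0.
  by rewrite /b indicE mem_set// mul1r max_l.
Qed.

End brownian_modification.

Lemma continuous_bounded_segment (R : realType) (f : R -> R) (a b : R) : continuous f ->
  exists m, forall s, a <= s <= b -> `|f s| <= m.
Proof.
move=> cf; have cc : compact (f @` `[a, b]).
  by apply: continuous_compact; [exact: continuous_subspaceT|exact: segment_compact].
have [m [_ mP]] := compact_bounded cc.
exists (m + 1) => s s_ab; apply: (mP (m + 1)); first by rewrite ltrDl.
by exists s => //=; rewrite in_itv.
Qed.

Section independent_products.
Context d (T : measurableType d) (R : realType) (P : probability T R).
Context (I : finType) (X : I -> T -> R) (f : I -> R -> R) (e : I -> R).
Hypotheses (mX : forall i, measurable_fun setT (X i)) (indX : mutually_independent P X).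
Hypotheses (mf : forall i, measurable_fun setT (f i)) (f0 : forall i x, 0 <= f i x).
Hypothesis fe : forall i, (\int[P]_w (f i (X i w))%:E = (e i)%:E)%E.

Let factor (s : seq I) (A : I -> set R) i x : R := if i \in s then f i x else \1_(A i) x.
Let value (s : seq I) (A : I -> set R) i : R := if i \in s then e i else fine (P (X i @^-1` A i)).

Let e0 i : 0 <= e i.
Proof. by rewrite -lee_fin -fe integral_ge0// => w _; rewrite lee_fin. Qed.

Let mXA i A : measurable A -> measurable (X i @^-1` A).
Proof. by move=> mA; rewrite -[X in measurable X]setTI; exact: mX. Qed.

(* The indicators in the product rule are replaced by the functions one at a time. *)
Let partial_product (s : seq I) : forall A : I -> set R, (forall i, measurable (A i)) ->
  (\int[P]_w (\prod_i factor s A i (X i w))%:E = (\prod_i value s A i)%:E)%E.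
Proof.
have factor_ge0 r A i x : 0 <= factor r A i x by rewrite /factor; case: ifP.
have mfactor r A i : measurable (A i) -> measurable_fun setT (factor r A i).
  move=> mA; rewrite /factor; case: (i \in r); first exact: mf.
  exact: measurable_indic.
elim: s => [|j s IH] A mA.
  have -> : (fun w => (\prod_i factor [::] A i (X i w))%:E) =
      (fun w => (\1_[set w | forall i, A i (X i w)] w)%:E).
    apply/funext => w; congr EFin; rewrite [RHS]indicE.
    case: (boolP (w \in _)) => [|]; rewrite ?inE ?notin_setE/= => h.
      by rewrite big1// => i _; rewrite /factor/= indicE mem_set.
    have [i nA] : exists i, ~ A i (X i w) by apply/existsNP.
    by rewrite (bigD1 i)//= /factor/= indicE memNset// mul0r.
  have mall : measurable [set w | forall i, A i (X i w)].
    rewrite (_ : [set w | _] = \bigcap_(i in [set: I]) (X i @^-1` A i)).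
      by apply: fin_bigcap_measurable => [|i _]; [exact: finite_finset|exact: mXA].
    by apply/seteqP; split => w /= h i => [_|]; exact: h.
  rewrite integral_indic// setIT; apply: etrans (indX mA) _.
  rewrite -prodEFin; apply: eq_bigr => i _.
  by rewrite /value/= fineK// fin_num_measure//; exact: mXA.
have [js|js] := boolP (j \in s).
  have -> : factor (j :: s) A = factor s A.
    by apply/funext => i; apply/funext => x; rewrite /factor in_cons; case: eqP => // ->; rewrite js.
  have -> : value (j :: s) A = value s A.
    by apply/funext => i; rewrite /value in_cons; case: eqP => // ->; rewrite js.
  exact: IH.
pose Z w : R := \prod_(i | i != j) factor s A i (X i w).
pose c : R := \prod_(i | i != j) value s A i.
have value_ge0 i : 0 <= value s A i by rewrite /value; case: ifP => // _; rewrite fine_ge0.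
have c0 : 0 <= c by apply: prodr_ge0.
have Z0 w : 0 <= Z w by apply: prodr_ge0.
have mZ : measurable_fun setT Z.
  rewrite /Z; under eq_fun do rewrite -big_filter.
  apply: measurable_prod => i _; exact: (measurableT_comp (mfactor _ _ _ (mA i))).
have eqA (B : set R) : measurable B ->
    (\int[P]_w ((Z w)%:E * (\1_B (X j w))%:E) = \int[P]_w (c%:E * (\1_B (X j w))%:E))%E.
  move=> mB; pose A' i := if i == j then B else A i.
  have mA' i : measurable (A' i) by rewrite /A'; case: ifP.
  have := IH A' mA'.
  have -> : (fun w => (\prod_i factor s A' i (X i w))%:E) =
      (fun w => ((Z w)%:E * (\1_B (X j w))%:E)%E).
    apply/funext => w; rewrite -EFinM (bigD1 j)//= mulrC; congr (_ * _)%:E.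
      by apply: eq_bigr => i ij; rewrite /factor /A' (negbTE ij).
    by rewrite /factor /A' (negbTE js) eqxx.
  have mB1 : measurable_fun setT (fun w => (\1_B (X j w))%:E : \bar R).
    have mi : measurable_fun setT (\1_B : R -> R) by exact: measurable_indic.
    by apply/measurable_EFinP; exact: (measurableT_comp mi (mX j)).
  move=> ->; rewrite ge0_integralZl//.
  have -> : (fun w => (\1_B (X j w))%:E) = (fun w => (\1_(X j @^-1` B) w)%:E) by [].
  rewrite integral_indic ?setIT//; last exact: mXA.
  rewrite (bigD1 j)//= EFinM muleC; congr (_ * _)%E.
    by congr EFin; apply: eq_bigr => i ij; rewrite /value /A' (negbTE ij).
  by rewrite /value /A' (negbTE js) eqxx fineK// fin_num_measure//; exact: mXA.
have mfj : measurable_fun setT (EFin \o f j) by exact/measurable_EFinP.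
have := @weighted_change_of_variables _ _ _ _ _ _ R P P Z (fun=> c) (X j) (X j)
  mZ (measurable_cst _) (mX j) (mX j) Z0 (fun=> c0) eqA (EFin \o f j) mfj (fun x => f0 j x).
have -> : (fun w => ((Z w)%:E * (EFin \o f j) (X j w))%E) =
    (fun w => (\prod_i factor (j :: s) A i (X i w))%:E).
  apply/funext => w; rewrite /= -EFinM (bigD1 j)//= mulrC; congr (_ * _)%:E.
    by rewrite /factor mem_head.
  by apply: eq_bigr => i ij; rewrite /factor in_cons (negbTE ij).
have mfX : measurable_fun setT (fun w => (EFin \o f j) (X j w)) by exact: (measurableT_comp mfj).
move=> ->; rewrite ge0_integralZl//; last by move=> w _; rewrite lee_fin.
rewrite fe -EFinM (bigD1 j)//= mulrC; congr (_ * _)%:E.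
  by rewrite /value mem_head.
by apply: eq_bigr => i ij; rewrite /value in_cons (negbTE ij).
Qed.

Lemma integral_prod_independent :
  (\int[P]_w (\prod_i f i (X i w))%:E = (\prod_i e i)%:E)%E.
Proof.
have := partial_product (enum I) (fun=> measurableT).
rewrite /factor /value.
by under eq_integral => w _ do under eq_bigr => i _ do rewrite mem_enum;
  under eq_bigr => i _ do rewrite mem_enum.
Qed.

End independent_products.

Section gaussian_negative_moment.
Context d (T : measurableType d) (R : realType) (P : probability T R).
Local Notation mu := (@lebesgue_measure R).

(** The density is at most 1 / k with k the standard deviation; taking k as radius in
    [integral_powR_bounded] gives 2 / h + 1 times k^(h - 1), which is a power (h - 1) / 2 of the
    variance. *)
Lemma gaussian_negative_moment (X : T -> R) (v h : R) : is_gaussian P X 0 v -> 0 < v ->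
  0 < h -> h < 1 ->
  (\int[P]_w (`|X w| `^ (h - 1))%:E <= ((2 / h + 1) * v `^ ((h - 1) / 2))%:E)%E.
Proof.
move=> gX v0 h0 h1; set k := Num.sqrt v.
have k0 : 0 < k by rewrite sqrtr_gt0.
have kn0 : k != 0 by rewrite gt_eqF.
have mp : measurable_fun setT (fun x : R => (`|x| `^ (h - 1))%:E).
  by apply/measurable_EFinP; exact: measurable_norm_powR.
have vn0 : v != 0 by rewrite gt_eqF.
have p0 (x : R) : (0 <= (`|x| `^ (h - 1))%:E)%E by rewrite lee_fin powR_ge0.
rewrite (gaussian_ge0_integral gX vn0 mp p0).
have pk : normal_peak k <= k^-1.
  rewrite /normal_peak lef_pV2 ?posrE//; last by rewrite sqrtr_gt0 mulrn_wgt0// mulr_gt0 ?exprn_gt0 ?pi_gt0.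
  rewrite -{1}(ger0_norm (ltW k0)) -sqrtr_sqr ler_wsqrtr// -mulrnAr ler_peMr ?sqr_ge0//.
  by rewrite -mulr_natr; have := pi_ge2 R; lra.
rewrite -/k; have -> : (\int[mu]_x ((normal_pdf 0 k x)%:E * (`|x| `^ (h - 1))%:E) =
    \int[mu]_w ((normal_pdf 0 k w)%:E * (`|0 - w| `^ (h - 1))%:E))%E.
  by apply: eq_integral => w _; rewrite sub0r normrN.
apply: le_trans (@integral_powR_bounded R (fun x => (normal_pdf 0 k x)%:E) 0 h k k^-1 _ _ _ h0 h1 k0 _ _) _.
- by apply/measurable_EFinP; exact: measurable_normal_pdf.
- by move=> x; rewrite lee_fin normal_pdf_ge0.
- by rewrite integral_normal_pdf.
- by rewrite invr_ge0 ltW.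
- by move=> x; rewrite lee_fin (le_trans (normal_pdf_ub _ _ kn0)).
rewrite lee_fin le_eqVlt; apply/orP; left; apply/eqP.
have -> : v `^ ((h - 1) / 2) = k `^ (h - 1).
  by rewrite mulrC powRrM powR12_sqrt// ltW.
have -> : k `^ h = k `^ (h - 1) * k.
  by rewrite -[X in _ * X](powRr1 (ltW k0)) -powRD ?kn0 ?implybT// subrK.
by field; rewrite kn0 gt_eqF.
Qed.

End gaussian_negative_moment.

Lemma powR_sum_exponents (R : realType) (I : Type) (s : seq I) (x : R) (a : I -> R) : 0 < x ->
  \prod_(i <- s) x `^ a i = x `^ (\sum_(i <- s) a i).
Proof.
move=> x0; elim: s => [|i s IH]; first by rewrite !big_nil powRr0.
by rewrite !big_cons IH powRD// (gt_eqF x0) implybT.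
Qed.

Lemma mutually_independent_ord1 d (T : measurableType d) (R : realType) (P : probability T R)
    (I : finType) (X : I -> T -> R) :
  mutually_independent P (fun (p : I * 'I_1) => X p.1) -> mutually_independent P X.
Proof.
move=> h A mA; have := h (fun p => A p.1) (fun p => mA p.1).
rewrite -(pair_bigA _ (fun i (k : 'I_1) => P (X i @^-1` A i)))/=.
under eq_bigr => i _ do rewrite big_ord1.
move=> <-; congr (P _); apply/seteqP; split => w /= hw i; first exact: hw.
exact: (hw (i, ord0)).
Qed.

(** The interval is open on the left, so a radius [t] would miss v = 0 when u = t; the radius 2 t
    avoids this. *)
Lemma segment_sub_ball (R : realDomainType) (t u v : R) : 0 < t -> 0 <= u -> u <= t ->
  0 <= v -> v <= t -> u - 2 * t < v <= u + 2 * t.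
Proof. by move=> *; apply/andP; split; lra. Qed.

(** * Energy and coincidences of Brownian paths *)

Section brownian_energy.
Context dO (Omega : measurableType dO) (R : realType) (P : probability Omega R) (d : nat).
Variable B : 'I_d -> R -> {RV P >-> R}.
Hypothesis hB : standard_brownian_motion B.
Variable b : Omega -> 'I_d -> R -> R.
Hypothesis jb : forall i, measurable_fun [set: Omega * R] (fun ws => b ws.1 i ws.2).
Hypothesis bB : {ae P, forall w, forall i s, 0 <= s -> b w i s = B i s w}.
Variables (H0 : R) (H : 'I_d -> R) (t : R).
Hypotheses (hH0 : 2^-1 < H0 < 1) (hH : forall i, 2^-1 < H i < 1).
Hypothesis hsum : d%:R + 1 < 2 * H0 + \sum_(i < d) H i.
Hypothesis t0 : 0 < t.
Local Notation mu := (@lebesgue_measure R).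
Local Notation mu2 := (prodm mu mu).

(** One more than the exponent of the time singularity, to match the form |w|^(h - 1) of the
    one-dimensional estimates. Its positivity is the hypothesis on the Hurst parameters. *)
Let energy_exponent : R := 2 * H0 - 1 + \sum_(i < d) (H i - 1).

Let energy_exponent_gt0 : 0 < energy_exponent.
Proof.
have e : \sum_(i < d) (H i - 1) = \sum_(i < d) H i - d%:R by rewrite sumrB sumr_const card_ord.
rewrite /energy_exponent e (_ : _ + _ = 2 * H0 + \sum_(i < d) H i - (d%:R + 1)) ?subr_gt0//.
by ring.
Qed.

Let energy_const : R := \prod_(i < d) (2 / (2 * H i - 1) + 1).

Let h01 (h : R) : 2^-1 < h < 1 -> 0 < 2 * h - 1 /\ 2 * h - 1 < 1.
Proof. by move=> /andP[? ?]; split; lra. Qed.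

Let energy_const_ge0 : 0 <= energy_const.
Proof.
by apply: prodr_ge0 => i _; have [h _] := h01 (hH i); rewrite addr_ge0// divr_ge0// ltW.
Qed.

Let increments_moment s r : 0 <= s -> s < r ->
  (\int[P]_w (\prod_(i < d) `|B i r w - B i s w| `^ (2 * H i - 2))%:E <=
   (energy_const * (r - s) `^ (\sum_(i < d) (H i - 1)))%:E)%E.
Proof.
move=> s0 sr; have rs0 : 0 < r - s by rewrite subr_gt0.
pose X i w := B i r w - B i s w.
have gX i : is_gaussian P (X i) 0 (r - s) by apply: (bm_increments hB) => //; exact: ltW.
have mX i : measurable_fun setT (X i) by case: (gX i).
have iX : mutually_independent P X.
  apply: mutually_independent_ord1.
  (* A single step from s to r; the sequence is constant afterwards only because times are indexed
     by all natural numbers. Independence of increments then reduces to independence of the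
     coordinates. *)
  pose u (k : nat) : R := if k == 0%N then s else r.
  have u_mono k : u k <= u k.+1 by rewrite /u /=; case: k => //=; exact: ltW.
  have := @bm_independent_increments _ _ _ _ _ _ hB 1%N u s0 u_mono.
  by congr mutually_independent; apply/funext => -[i k] /=; rewrite /X (ord1 k).
have mom i : (\int[P]_w (`|X i w| `^ (2 * H i - 2))%:E <=
    ((2 / (2 * H i - 1) + 1) * (r - s) `^ (H i - 1))%:E)%E.
  have [a1 a2] := h01 (hH i).
  have := gaussian_negative_moment (gX i) rs0 a1 a2.
  have -> : 2 * H i - 1 - 1 = 2 * H i - 2 by ring.
  by have -> : (2 * H i - 2) / 2 = H i - 1 by field.
pose e i := fine (\int[P]_w (`|X i w| `^ (2 * H i - 2))%:E)%E.
have eE i : (\int[P]_w (`|X i w| `^ (2 * H i - 2))%:E = (e i)%:E)%E.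
  rewrite fineK// ge0_fin_numE; first by rewrite (le_lt_trans (mom i))// ltry.
  by apply: integral_ge0 => w _; rewrite lee_fin powR_ge0.
have e_ge0 i : 0 <= e i.
  by rewrite fine_ge0// integral_ge0// => w _; rewrite lee_fin powR_ge0.
rewrite (@integral_prod_independent _ _ _ _ _ X (fun i y => `|y| `^ (2 * H i - 2)) e)//.
- rewrite lee_fin -powR_sum_exponents// /energy_const -big_split/=.
  by apply: ler_prod => i _; rewrite e_ge0/= -lee_fin -eE.
- by move=> i; exact: measurable_norm_powR.
Qed.

Let increment_neq s r i : 0 <= s -> s < r ->
  (\int[P]_w (\1_[set 0%R] (B i r w - B i s w)%R)%:E = 0 :> \bar R)%E.
Proof.
move=> s0 sr; have rs0 : r - s != 0 by rewrite gt_eqF// subr_gt0.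
have gX := bm_increments hB i s0 (ltW sr).
have mi : measurable_fun setT (\1_[set 0%R] : R -> R) by exact: measurable_indic.
have mE : measurable_fun setT (fun y : R => (\1_[set 0%R] y)%:E : \bar R) by exact/measurable_EFinP.
have E0 (y : R) : (0 <= (\1_[set 0%R] y)%:E :> \bar R)%E by rewrite lee_fin.
rewrite (gaussian_ge0_integral gX rs0 mE E0).
have k0 : Num.sqrt (r - s) != 0 by rewrite sqrtr_eq0 -ltNge subr_gt0.
apply/eqP; rewrite eq_le integral_ge0 ?andbT; last first.
  by move=> y _; rewrite mule_ge0// lee_fin normal_pdf_ge0.
apply: (@le_trans _ _ (\int[mu]_y ((normal_peak (Num.sqrt (r - s)))%:E * (\1_[set 0%R] y)%:E))%E).
  apply: ge0_le_integral => //.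
  - by move=> y _; rewrite mule_ge0// lee_fin normal_pdf_ge0.
  - by apply: emeasurable_funM => //; apply/measurable_EFinP; exact: measurable_normal_pdf.
  - by apply: emeasurable_funM.
  - by move=> y _; rewrite lee_wpmul2r// lee_fin normal_pdf_ub.
rewrite ge0_integralZl//; last by rewrite lee_fin normal_peak_ge0.
have -> : (\int[mu]_y (\1_[set 0%R] y)%:E = mu [set 0%R])%E by rewrite integral_indic// setIT.
by rewrite [X in (_ * X)%E]lebesgue_measure_set1 mule0.
Qed.

(** The coordinates of an increment are independent, so their negative moments multiply, and their
    powers of |z.1 - z.2| add up with that of the time factor to [energy_exponent] - 1. *)
Let kernel_moment z : 0 <= z.1 -> 0 <= z.2 -> z.1 != z.2 ->
  (\int[P]_w (path_kernel H0 H (b w) z)%:E <=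
   (energy_const * `|z.1 - z.2| `^ (energy_exponent - 1))%:E)%E.
Proof.
wlog z12 : z / z.2 < z.1 => [hw z1 z2 z12|].
  case: (ltgtP z.2 z.1) z12 => // [lt _|lt _]; first by apply: hw => //; rewrite gt_eqF.
  have -> : (\int[P]_w (path_kernel H0 H (b w) z)%:E = \int[P]_w (path_kernel H0 H (b w) (z.2, z.1))%:E)%E.
    apply: eq_integral => w _; rewrite /path_kernel/= distrC; congr (_ * _)%:E.
    by apply: eq_bigr => i _; rewrite distrC.
  by rewrite distrC; apply: (hw (z.2, z.1)) => //=; rewrite gt_eqF.
move=> z1 z2 _; have zp : 0 < z.1 - z.2 by rewrite subr_gt0.
have mB (i : 'I_d) : measurable_fun setT (fun w => `|B i z.1 w - B i z.2 w| `^ (2 * H i - 2)).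
  apply: (measurableT_comp (measurable_norm_powR _)); apply: measurable_funB; exact: measurable_funP.
have mp : measurable_fun setT (fun w => (\prod_(i < d) `|B i z.1 w - B i z.2 w| `^ (2 * H i - 2))%:E).
  by apply/measurable_EFinP; apply: measurable_prod.
have mb i s : measurable_fun setT (fun w => b w i s).
  exact: (measurableT_comp (jb i) (measurable_pair2 s)).
have -> : (\int[P]_w (path_kernel H0 H (b w) z)%:E =
    \int[P]_w ((`|z.1 - z.2| `^ (2 * H0 - 2))%:E *
      (\prod_(i < d) `|B i z.1 w - B i z.2 w| `^ (2 * H i - 2))%:E))%E.
  apply: ae_eq_integral => //.
  - apply/measurable_EFinP; apply: measurable_funM => //; apply: measurable_prod => i _.
    by apply: (measurableT_comp (measurable_norm_powR _)); exact: measurable_funB.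
  - exact: emeasurable_funM.
  - apply: filterS bB => w bw _; rewrite -EFinM /path_kernel; congr (_ * _)%:E.
    by apply: eq_bigr => i _; rewrite !bw.
rewrite ge0_integralZl//; last by move=> w _; rewrite lee_fin prodr_ge0// => i _; exact: powR_ge0.
apply: le_trans (lee_wpmul2l _ (increments_moment z2 z12)) _; first by rewrite lee_fin powR_ge0.
rewrite -EFinM lee_fin gtr0_norm// mulrCA -powRD ?(gt_eqF zp) ?implybT//.
by rewrite (_ : _ + _ = energy_exponent - 1)// /energy_exponent; ring.
Qed.

Let mkernel : measurable_fun [set: Omega * (R * R)]
  (fun wz => square_indic t wz.2 * path_kernel H0 H (b wz.1) wz.2).
Proof.
have mi : measurable_fun setT (\1_`[0, t] : R -> R) by exact: measurable_indic.
have m1 : measurable_fun [set: Omega * (R * R)] (fun wz => wz.2.1) by exact: (measurableT_comp measurable_fst).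
have m2 : measurable_fun [set: Omega * (R * R)] (fun wz => wz.2.2) by exact: (measurableT_comp measurable_snd).
apply: measurable_funM; first by apply: measurable_funM; exact: (measurableT_comp mi).
apply: measurable_funM.
  by apply: (measurableT_comp (measurable_norm_powR _)); exact: measurable_funB.
apply: measurable_prod => i _; apply: (measurableT_comp (measurable_norm_powR _)).
apply: measurable_funB.
  exact: (measurableT_comp (jb i) (measurable_fun_pair measurable_fst m1)).
exact: (measurableT_comp (jb i) (measurable_fun_pair measurable_fst m2)).
Qed.

Lemma measurable_path_energy : measurable_fun setT (fun w => path_energy H0 H t (b w)).
Proof.
have mE : measurable_fun [set: Omega * (R * R)]
    (fun wz => (square_indic t wz.2 * path_kernel H0 H (b wz.1) wz.2)%:E) by exact/measurable_EFinP.
by apply: (@measurable_fun_fubini_tonelli_F _ _ _ _ R mu2 _ mE) => wz; rewrite lee_fin square_path_kernel_ge0.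
Qed.

Let integral_power_square (g : R) : 0 < g ->
  (\int[mu2]_z (square_indic t z * `|z.1 - z.2| `^ (g - 1))%:E < +oo)%E.
Proof.
move=> g0; have mi : measurable_fun setT (\1_`[0, t] : R -> R) by exact: measurable_indic.
have m2 : measurable_fun [set: R * R] (fun z : R * R => (square_indic t z * `|z.1 - z.2| `^ (g - 1))%:E).
  apply/measurable_EFinP; apply: measurable_funM.
    by apply: measurable_funM; exact: (measurableT_comp mi).
  by apply: (measurableT_comp (measurable_norm_powR _)); exact: measurable_funB.
have ge0 (z : R * R) : (0 <= (square_indic t z * `|z.1 - z.2| `^ (g - 1))%:E)%E.
  by rewrite lee_fin mulr_ge0 ?powR_ge0// mulr_ge0.
rewrite (@ge0_integral_prodm1 _ _ _ _ R mu mu _ m2 ge0).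
pose c : R := 2 * (2 * t) `^ g / g.
have c0 : 0 <= c by rewrite divr_ge0 ?(ltW g0)// mulr_ge0 ?powR_ge0.
apply: (@le_lt_trans _ _ (\int[mu]_s (c%:E * (\1_`[0%R, t] s)%:E))%E).
  apply: ge0_le_integral => //.
  - by move=> s _; apply: integral_ge0 => r _; exact: ge0.
  - exact: (@measurable_fun_fubini_tonelli_F _ _ _ _ R mu _ m2 ge0).
  - by apply: emeasurable_funM => //; exact/measurable_EFinP.
  move=> s _; rewrite [X in (_ <= _ * X%:E)%E]indicE.
  case: (boolP (s \in _)) => st; last first.
    rewrite integral0_eq ?mule0// => r _; rewrite /square_indic/= (_ : \1_`[0, t] s = 0) ?mul0r ?mul0r//.
    by rewrite indicE (negbTE st).
  rewrite mule1 -(integral_ball_powR s g0 (_ : 0 <= 2 * t)); last by rewrite mulr_ge0// ltW.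
  rewrite [leRHS]integral_mkcond; apply: ge0_le_integral => //.
  - exact: (measurableT_comp m2 (measurable_pair1 s)).
  - apply/(measurable_restrictT _ _).1 => //.
    by apply: measurable_funTS; apply/measurable_EFinP; exact: measurable_sub_powR.
  move=> r _; rewrite patchE /square_indic/= (_ : \1_`[0, t] s = 1) ?mul1r; last by rewrite indicE st.
  move: st; rewrite inE/= in_itv/= => /andP[s0 st].
  rewrite indicE mem_setE in_itv/=; case: (boolP (0 <= r <= t)) => [/andP[r0 rt]|_].
    by rewrite mul1r mem_set//= in_itv/=; exact: segment_sub_ball.
  by rewrite mul0r; case: ifP => // _; rewrite lee_fin powR_ge0.
rewrite ge0_integralZl//; last exact/measurable_EFinP.
rewrite integral_indic_itv//; exact: ltry.
Qed.

Lemma expected_energy : (\int[P]_w path_energy H0 H t (b w) < +oo)%E.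
Proof.
have mE : measurable_fun [set: Omega * (R * R)]
    (fun wz => (square_indic t wz.2 * path_kernel H0 H (b wz.1) wz.2)%:E) by exact/measurable_EFinP.
have ge0 (wz : Omega * (R * R)) :
  (0 <= (square_indic t wz.2 * path_kernel H0 H (b wz.1) wz.2)%:E)%E by rewrite lee_fin square_path_kernel_ge0.
rewrite /path_energy (@fubini_tonelli _ _ _ _ R P mu2 _ mE ge0).
have c0 := energy_const_ge0.
have mi : measurable_fun setT (\1_`[0, t] : R -> R) by exact: measurable_indic.
have mz : measurable_fun [set: R * R] (fun z : R * R =>
    (square_indic t z * `|z.1 - z.2| `^ (energy_exponent - 1))%:E).
  apply/measurable_EFinP; apply: measurable_funM.
    by apply: measurable_funM; exact: (measurableT_comp mi).
  by apply: (measurableT_comp (measurable_norm_powR _)); exact: measurable_funB.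
have gez (z : R * R) : (0 <= (square_indic t z * `|z.1 - z.2| `^ (energy_exponent - 1))%:E)%E.
  by rewrite lee_fin mulr_ge0 ?powR_ge0// mulr_ge0.
apply: (@le_lt_trans _ _ (\int[mu2]_z (energy_const%:E *
    (square_indic t z * `|z.1 - z.2| `^ (energy_exponent - 1))%:E))%E); last first.
  rewrite ge0_integralZl//.
  by apply: lte_mul_pinfty => //; exact: integral_power_square.
apply: ae_ge0_le_integral => //.
- by move=> z _; apply: integral_ge0 => w _; exact: (ge0 (w, z)).
- exact: (@measurable_fun_fubini_tonelli_G _ _ _ _ R P _ mE ge0).
- by move=> z _; rewrite mule_ge0// lee_fin.
- exact: emeasurable_funM.
apply: (negligibleS _ (@negligible_diagonal R)) => z /=; apply: contra_notP => /eqP z12 _.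
have [h|h] := boolP ((0 <= z.1 <= t) && (0 <= z.2 <= t)); last first.
  have s0 : square_indic t z = 0.
    rewrite /square_indic; move: h; rewrite negb_and => /orP[h|h].
      by rewrite [X in X * _]indicE memNset ?mul0r//= in_itv/=; exact/negP.
    by rewrite [X in _ * X]indicE memNset ?mulr0//= in_itv/=; exact/negP.
  by rewrite integral0_eq => [|w _]; rewrite s0 mul0r// mule0.
move: h => /andP[/andP[z1 z1t] /andP[z2 z2t]].
have -> : square_indic t z = 1.
  by rewrite /square_indic !indicE !mem_set/= ?mul1r// in_itv/= ?z1 ?z2.
under eq_integral => w _ do rewrite mul1r.
by rewrite mul1r -EFinM; exact: kernel_moment.
Qed.

Lemma brownian_energy_lty : {ae P, forall w, (path_energy H0 H t (b w) < +oo)%E}.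
Proof.
have p0 w : (0 <= path_energy H0 H t (b w))%E.
  by apply: integral_ge0 => z _; rewrite lee_fin square_path_kernel_ge0.
have i1 : P.-integrable setT (fun w => path_energy H0 H t (b w)).
  apply/integrableP; split; first exact: measurable_path_energy.
  by under eq_integral => w _ do rewrite gee0_abs//; exact: expected_energy.
apply: filterS (integrable_ae measurableT i1) => w /(_ I).
by rewrite ge0_fin_numE.
Qed.

Let coincidence (w : Omega) (z : R * R) (i : 'I_d) : R :=
  square_indic t z * \1_[set 0%R] (b w i z.1 - b w i z.2).

Let mcoincidence : measurable_fun [set: Omega * (R * R)]
  (fun wz => (\sum_(i < d) coincidence wz.1 wz.2 i)%:E).
Proof.
have mi : measurable_fun setT (\1_`[0, t] : R -> R) by exact: measurable_indic.
have m0 : measurable_fun setT (\1_[set 0%R] : R -> R) by exact: measurable_indic.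
have m1 : measurable_fun [set: Omega * (R * R)] (fun wz => wz.2.1) by exact: (measurableT_comp measurable_fst).
have m2 : measurable_fun [set: Omega * (R * R)] (fun wz => wz.2.2) by exact: (measurableT_comp measurable_snd).
apply/measurable_EFinP; apply: measurable_sum => i.
apply: measurable_funM; first by apply: measurable_funM; exact: (measurableT_comp mi).
apply: (measurableT_comp m0); apply: measurable_funB.
  exact: (measurableT_comp (jb i) (measurable_fun_pair measurable_fst m1)).
exact: (measurableT_comp (jb i) (measurable_fun_pair measurable_fst m2)).
Qed.

Let mb i s : measurable_fun setT (fun w => b w i s).
Proof. exact: (measurableT_comp (jb i) (measurable_pair2 s)). Qed.

Let coincidence_null i s r : 0 <= s -> 0 <= r -> s != r ->
  (\int[P]_w (\1_[set 0%R] (b w i s - b w i r)%R)%:E = 0 :> \bar R)%E.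
Proof.
move=> s0 r0 sr.
have m0 : measurable_fun setT (\1_[set 0%R] : R -> R) by exact: measurable_indic.
have mm (f g : Omega -> R) : measurable_fun setT f -> measurable_fun setT g ->
    measurable_fun setT (fun w => (\1_[set 0%R] (f w - g w))%:E : \bar R).
  move=> mf mg; apply/measurable_EFinP; apply: (measurableT_comp m0); exact: measurable_funB.
transitivity (\int[P]_w (\1_[set 0%R] (B i s w - B i r w)%R)%:E : \bar R)%E.
  apply: ae_eq_integral => //; [exact: mm|by apply: mm; exact: measurable_funP|].
  by apply: filterS bB => w bw _; rewrite !bw.
case: (ltgtP s r) sr => // [sr|rs] _; last exact: increment_neq.
rewrite -(increment_neq i s0 sr); apply: eq_integral => w _.
by rewrite !indicE; congr ((nat_of_bool _)%:R%:E); apply/idP/idP; rewrite !inE/= => h; lra.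
Qed.

(** For distinct times each coordinate of the increment has a density, so coincidence has
    probability 0. By Tonelli the expected measure of the coincidences in the square vanishes, hence
    so does their measure for almost every path. *)
Lemma brownian_separated : {ae P, forall w, mu2.-negligible
  [set z : R * R | (0 <= z.1 <= t) /\ (0 <= z.2 <= t) /\ exists i, b w i z.1 = b w i z.2]}.
Proof.
have co0 w z i : 0 <= coincidence w z i by rewrite mulr_ge0// mulr_ge0.
have ge0 (wz : Omega * (R * R)) : (0 <= (\sum_(i < d) coincidence wz.1 wz.2 i)%:E)%E.
  by rewrite lee_fin sumr_ge0.
have I0 : (\int[P]_w \int[mu2]_z (\sum_(i < d) coincidence w z i)%:E = 0)%E.
  rewrite (@fubini_tonelli _ _ _ _ R P mu2 _ mcoincidence ge0).
  apply/eqP; rewrite eq_le integral_ge0 ?andbT; last first.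
    by move=> z _; apply: integral_ge0 => w _; exact: (ge0 (w, z)).
  rewrite -[leRHS](integral0 mu2 setT); apply: ae_ge0_le_integral => //.
  - by move=> z _; apply: integral_ge0 => w _; exact: (ge0 (w, z)).
  - exact: (@measurable_fun_fubini_tonelli_G _ _ _ _ R P _ mcoincidence ge0).
  apply: (negligibleS _ (@negligible_diagonal R)) => z /=; apply: contra_notP => /eqP z12 _.
  have [h|h] := boolP ((0 <= z.1 <= t) && (0 <= z.2 <= t)); last first.
    have s0 : square_indic t z = 0.
      rewrite /square_indic; move: h; rewrite negb_and => /orP[h|h].
        by rewrite [X in X * _]indicE memNset ?mul0r//= in_itv/=; exact/negP.
      by rewrite [X in _ * X]indicE memNset ?mulr0//= in_itv/=; exact/negP.
    by rewrite integral0_eq => [|w _] //; rewrite big1// => i _; rewrite /coincidence s0 mul0r.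
  move: h => /andP[/andP[z1 z1t] /andP[z2 z2t]].
  under eq_integral => w _ do rewrite -sumEFin.
  rewrite ge0_integral_sum//; last 2 first.
  - move=> i; apply/measurable_EFinP; apply: measurable_funM => //.
    have m0 : measurable_fun setT (\1_[set 0%R] : R -> R) by exact: measurable_indic.
    by apply: (measurableT_comp m0); exact: measurable_funB.
  - by move=> i w _; rewrite lee_fin.
  rewrite big1// => i _; rewrite -(coincidence_null i z1 z2 z12).
  apply: eq_integral => w _; rewrite /coincidence (_ : square_indic t z = 1) ?mul1r//.
  by rewrite /square_indic !indicE !mem_set/= ?mul1r// in_itv/= ?z1 ?z2.
have mI : measurable_fun setT (fun w => \int[mu2]_z (\sum_(i < d) coincidence w z i)%:E)%E.
  exact: (@measurable_fun_fubini_tonelli_F _ _ _ _ R mu2 _ mcoincidence ge0).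
have I0' w : (0 <= \int[mu2]_z (\sum_(i < d) coincidence w z i)%:E)%E.
  by apply: integral_ge0 => z _; exact: (ge0 (w, z)).
have := (ae_eq_integral_abs P measurableT mI).1.
under eq_integral => w _ do rewrite gee0_abs//.
move=> /(_ I0); apply: filterS => w /(_ I) /= w0.
have mw : measurable_fun [set: R * R] (fun z => (\sum_(i < d) coincidence w z i)%:E).
  exact: (measurableT_comp mcoincidence (measurable_pair1 w)).
have := (ae_eq_integral_abs mu2 measurableT mw).1.
under eq_integral => z _ do rewrite gee0_abs ?(ge0 (w, z))//.
move=> /(_ w0); apply: negligibleS => z /= [z1 [z2 [i bi]]] /(_ I) /eqP.
rewrite eqe psumr_eq0 => [|k _]; last exact: co0.
move=> /allP /(_ i (mem_index_enum i)) /eqP/eqP.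
rewrite /coincidence /square_indic bi subrr !indicE !mem_set//= ?in_itv//=.
by rewrite !mul1r oner_eq0.
Qed.

End brownian_energy.

(** * Limits depending measurably on a parameter *)

Section fast_cauchy.
Context d (T : measurableType d) (R : realType) (P : probability T R).
Variable U : nat -> T -> R.
Hypothesis mU : forall k, measurable_fun setT (U k).

(** Written in the form of the terms of [epsilon_trick0], whose sum is at most 1. *)
Definition halving (k : nat) : R := 1 / (2 ^ k.+1)%:R.

Lemma halving_gt0 k : 0 < halving k.
Proof. by rewrite divr_gt0// ltr0n expn_gt0. Qed.

Lemma halving_cvg0 : halving k @[k --> \oo] --> 0.
Proof.
have h : (k.+1%:R^-1 : R) @[k --> \oo] --> 0 by exact: cvg_harmonic.
apply: (@squeeze_cvgr _ _ _ _ (cst 0) (fun k => k.+1%:R^-1)) => //; last exact: cvg_cst.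
apply: nearW => k; rewrite /= (ltW (halving_gt0 k))/= /halving div1r lef_pV2 ?posrE ?ltr0n ?expn_gt0//.
by rewrite ler_nat ltnW// ltn_expl.
Qed.

Hypothesis fast : forall k, (sqint P (U k.+1 \- U k) <= (halving k ^+ 2)%:E)%E.

(** The series of absolute increments has a finite expectation, so it converges almost everywhere,
    and the sequence telescopes. *)
Lemma fast_cauchy_cvg : {ae P, forall w, cvgn (U^~ w)}.
Proof.
have mD k : measurable_fun setT (U k.+1 \- U k) by exact: measurable_funB.
have mD2 k : measurable_fun setT (fun w => ((U k.+1 w - U k w) ^+ 2)%:E) := measurable_sqr (mD k).
have mE k : measurable_fun setT (fun w => (`|U k.+1 w - U k w|)%:E).
  by apply/measurable_EFinP; apply: (measurableT_comp _ (mD k)).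
have tot : (\int[P]_w \sum_(0 <= k <oo) (`|U k.+1 w - U k w|)%:E < +oo)%E.
  rewrite (integral_nneseries _ measurableT mE)//.
  apply: (@le_lt_trans _ _ 1%:E); last exact: ltry.
  apply: (le_trans _ (@epsilon_trick0 R 1 xpredT ler01)).
  apply: lee_nneseries => [k _ _|k _]; first by apply: integral_ge0 => w _; rewrite lee_fin.
  rewrite -/(halving k); have q0 := halving_gt0 k; set q := halving k in q0 *.
  (* [|x| <= (q + x^2 / q) / 2] *)
  apply: (@le_trans _ _ (\int[P]_w ((q / 2)%:E + (q^-1 / 2)%:E * ((U k.+1 w - U k w) ^+ 2)%:E))%E).
    apply: ge0_le_integral => //.
    - by apply: emeasurable_funD => //; apply: emeasurable_funM.
    move=> w _; rewrite -EFinM -EFinD lee_fin -(real_normK (num_real (U k.+1 w - U k w))).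
    set a := `|_|; rewrite -subr_ge0 (_ : _ - a = q^-1 / 2 * (a - q) ^+ 2).
      by rewrite mulr_ge0 ?sqr_ge0// divr_ge0// invr_ge0 ltW.
    by field; rewrite gt_eqF.
  have q20 : 0 <= q^-1 / 2 by rewrite divr_ge0// invr_ge0 ltW.
  rewrite ge0_integralD//; last 3 first.
  - by move=> w _; rewrite lee_fin divr_ge0// ltW.
  - by move=> w _; rewrite mule_ge0// lee_fin ?sqr_ge0.
  - by apply: emeasurable_funM.
  rewrite ge0_integralZl//; last by move=> w _; rewrite lee_fin sqr_ge0.
  have -> : (\int[P]_w (q / 2)%:E = (q / 2)%:E)%E.
    by rewrite integral_cst// [X in (_ * X)%E]probability_setT mule1.
  apply: (@le_trans _ _ ((q / 2)%:E + (q^-1 / 2)%:E * (q ^+ 2)%:E)%E).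
    by rewrite leeD2l// lee_wpmul2l ?lee_fin//; exact: fast.
  by rewrite -EFinM -EFinD lee_fin le_eqVlt; apply/orP; left; apply/eqP; field; rewrite gt_eqF.
have mS : measurable_fun setT (fun w => \sum_(0 <= k <oo) (`|U k.+1 w - U k w|)%:E)%E.
  by apply: ge0_emeasurable_sum => // k w _ _; rewrite lee_fin.
have S0 w : (0 <= \sum_(0 <= k <oo) (`|U k.+1 w - U k w|)%:E)%E.
  by apply: nneseries_ge0 => k _ _; rewrite lee_fin.
have iS : P.-integrable setT (fun w => \sum_(0 <= k <oo) (`|U k.+1 w - U k w|)%:E)%E.
  by apply/integrableP; split => //; under eq_integral => w _ do rewrite gee0_abs//.
apply: filterS (integrable_ae measurableT iS) => w /(_ I) fin.
have cs : cvgn (series (fun k => U k.+1 w - U k w)).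
  apply: normed_cvg; apply: nondecreasing_is_cvgn.
    apply/nondecreasing_seqP => n; rewrite /= /series/= big_nat_recr//= lerDl//.
  exists (fine (\sum_(0 <= k <oo) (`|U k.+1 w - U k w|)%:E)%E) => _ [n _ <-] /=.
  rewrite -lee_fin fineK// /series/= -sumEFin.
  by apply: nneseries_lim_ge => k _ _; rewrite lee_fin.
have -> : U^~ w = (fun n => U 0%N w + series (fun k => U k.+1 w - U k w) n).
  apply/funext => n; rewrite /series/= telescope_sumr//; ring.
by apply: is_cvgD => //; exact: is_cvg_cst.
Qed.

End fast_cauchy.

(** Transfers a mean-square bound to an almost everywhere limit, without assuming mean-square
    convergence to that limit. *)
Lemma sqint_fatou d (T : measurableType d) (R : realType) (P : probability T R)
    (X L : T -> R) (U : nat -> T -> R) (c : R) :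
  measurable_fun setT X -> measurable_fun setT L -> (forall k, measurable_fun setT (U k)) ->
  {ae P, forall w, U k w @[k --> \oo] --> L w} ->
  (forall k, sqint P (X \- U k) <= c%:E)%E -> (sqint P (X \- L) <= c%:E)%E.
Proof.
move=> mX mL mU UL Uc.
have mf k : measurable_fun setT (fun w => ((X w - U k w) ^+ 2)%:E).
  by apply: measurable_sqr; exact: measurable_funB.
have f0 k w : setT w -> (0 <= ((X w - U k w) ^+ 2)%:E)%E by move=> _; rewrite lee_fin sqr_ge0.
have := @fatou _ _ _ P _ measurableT _ mf f0.
have -> : (\int[P]_w limn_einf (fun k => ((X w - U k w) ^+ 2)%:E) = sqint P (X \- L))%E.
  apply: ae_eq_integral => //.
  - rewrite (_ : (fun w => _) = (fun w => - limn_esup (fun k => - ((X w - U k w) ^+ 2)%:E))%E).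
      apply: measurableT_comp => //; apply: measurable_fun_limn_esup => k.
      exact: measurableT_comp.
    by apply/funext => w; rewrite -[RHS]/(- limn_esup (-%E \o (fun k => ((X w - U k w) ^+ 2)%:E)))%E limn_esupN oppeK.
  - by apply: measurable_sqr; exact: measurable_funB.
  - apply: filterS UL => w cw _; apply: (cvg_limn_einf_sup _).1.
    apply: cvg_EFin; first exact: nearW.
    by rewrite !expr2; apply: cvgM; apply: cvgB => //; exact: cvg_cst.
move=> h; apply: (le_trans h); rewrite limn_einf_lim.
apply: lime_le; first exact: is_cvg_einfs.
apply: nearW => n; apply: (le_trans _ (Uc n)).
by apply: ereal_inf_lbound; exists n => //=.
Qed.

(** * Jointly measurable limits of sequences converging at fixed parameter *)

Section joint_limit.
Context dW dB (OmegaW : measurableType dW) (OmegaB : measurableType dB) (R : realType).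
Context (PW : probability OmegaW R) (PB : probability OmegaB R).
Variable V : nat -> OmegaW * OmegaB -> R.
Hypothesis mV : forall n, measurable_fun setT (V n).

Let slice n b w := V n (w, b).

Let mslice n b : measurable_fun setT (slice n b).
Proof. exact: (measurableT_comp (mV n) (measurable_pair2 b)). Qed.

Let D n m b : \bar R := sqint PW (slice n b \- slice m b).

Let mD n m : measurable_fun setT (D n m).
Proof.
have mf : measurable_fun [set: OmegaW * OmegaB] (fun z => ((V n z - V m z) ^+ 2)%:E).
  by apply: measurable_sqr; exact: measurable_funB.
by apply: (@measurable_fun_fubini_tonelli_G _ _ _ _ R PW _ mf) => z; rewrite lee_fin sqr_ge0.
Qed.

Let DC n m b : D n m b = D m n b.
Proof. by rewrite /D -sqintN; apply: eq_sqint => w /=; rewrite opprB. Qed.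

Definition slicewise_cauchy b : Prop := forall e : R, 0 < e -> exists N : nat, forall n m : nat,
  (N <= n)%N -> (N <= m)%N -> (sqint PW (fun w => V n (w, b) - V m (w, b))%R <= e%:E)%E.

(** The parameters for which all members from [n] on are within [halving R k] of each other. Being a
    countable intersection of conditions on measurable second moments, this set is measurable. *)
Let stable k n : set OmegaB :=
  [set b | forall m m' : nat, (n <= m)%N -> (n <= m')%N -> (D m m' b <= (halving R k ^+ 2)%:E)%E].

Let measurable_stable k n : measurable (stable k n).
Proof.
rewrite (_ : stable k n = \bigcap_(m in [set m : nat | (n <= m)%N])
    \bigcap_(m' in [set m : nat | (n <= m)%N]) [set b | (D m m' b <= (halving R k ^+ 2)%:E)%E]).
  apply: bigcap_measurable; first by exists n => /=.
  move=> m _; apply: bigcap_measurable; first by exists n => /=.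
  move=> m' _; rewrite -[X in measurable X]setTI.
  by apply: emeasurable_fun_le => //; exact: measurable_cst.
by apply/seteqP; split => b /= h m => [nm m' nm'|m' nm nm']; exact: h.
Qed.

Let has_index k b : Prop := exists n, `[< stable k n b >].

(** The least index from which precision k is reached; the default 0 concerns only parameters whose
    slices are not Cauchy. *)
Let index k b : nat := if pselect (has_index k b) is left ex then ex_minn ex else 0%N.

Let indexP k b : has_index k b -> stable k (index k b) b.
Proof. by move=> h; rewrite /index; case: pselect => // ex; case: ex_minnP => n /asboolP. Qed.

Let index_min k b n : stable k n b -> (index k b <= n)%N.
Proof.
by move=> sn; rewrite /index; case: pselect => // ex; case: ex_minnP => m _; apply; exact/asboolP.
Qed.

(** Minimality describes each level set by countably many stability conditions: stable at j and at
    no smaller index, with the case of no index at all added to the level 0. *)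
Let measurable_index k j : measurable (index k @^-1` [set j]).
Proof.
have e : index k @^-1` [set j] =
    (stable k j `&` \bigcap_(i in [set i : nat | (i < j)%N]) ~` stable k i) `|`
    (if j == 0%N then \bigcap_i ~` stable k i else set0).
  apply/seteqP; split => b.
    move=> /= bj; have [ex|nex] := pselect (has_index k b).
      left; split; first by rewrite -bj; exact: indexP.
      by move=> i /= ij si; move: (index_min si); rewrite bj leqNgt ij.
    right; move: bj; rewrite /index; case: pselect => // _ <-; rewrite eqxx => i _ si.
    by apply: nex; exists i; exact/asboolP.
  move=> [[sj nj]|].
    apply/eqP; rewrite eqn_leq index_min//= leqNgt; apply/negP => lt.
    by apply: (nj _ lt); apply: indexP; exists j; exact/asboolP.
  case: ifP => [/eqP -> ns|//] /=; rewrite /index; case: pselect => // ex.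
  by exfalso; case: ex => n /asboolP; exact: (ns n).
rewrite e; apply: measurableU.
  apply: measurableI; first exact: measurable_stable.
  by apply: bigcap_measurableType => i _; apply: measurableC; exact: measurable_stable.
case: ifP => // _; apply: bigcap_measurableType => i _; apply: measurableC.
exact: measurable_stable.
Qed.

Let U k z := V (index k z.2) z.

Let mU k : measurable_fun setT (U k).
Proof.
apply: (@measurable_fun_nat_index _ _ _ _ (fun z => index k z.2) V) => // m.
rewrite (_ : _ @^-1` _ = snd @^-1` (index k @^-1` [set m])) //.
by rewrite -[X in measurable X]setTI; apply: measurable_snd.
Qed.

(* A fast subsequence is extracted measurably, with indices depending on the
   second variable only. *)
Lemma joint_limit : {ae PB, forall b, slicewise_cauchy b} ->
  exists2 L : OmegaW * OmegaB -> R, measurable_fun setT L &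
    {ae PB, forall b, sqint PW (fun w => V n (w, b) - L (w, b)) @[n --> \oo] --> 0%E}.
Proof.
(* The upper limit is measurable in the pair without knowing where the sequence converges; where the
   subsequence converges it is the limit. *)
move=> cV; pose L z := fine (limn_esup (fun k => (U k z)%:E)).
have mL : measurable_fun setT L.
  apply: measurableT_comp => //; apply: measurable_fun_limn_esup => k.
  exact/measurable_EFinP.
exists L => //; apply: filterS cV => b cb.
have has k : has_index k b.
  have [N HN] := cb _ (exprn_gt0 2 (halving_gt0 R k)).
  by exists N; apply/asboolP => m m' ? ?; exact: HN.
have close k m : (index k b <= m)%N -> (D (index k b) m b <= (halving R k ^+ 2)%:E)%E.
  by move=> km; exact: (indexP (has k)).
have half_mono k j : (k <= j)%N -> halving R j <= halving R k.
  move=> kj; rewrite /halving !div1r lef_pV2 ?posrE ?ltr0n ?expn_gt0//.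
  by rewrite ler_nat leq_exp2l.
have index_mono k j : (k <= j)%N -> (index k b <= index j b)%N.
  move=> kj; apply: index_min => m m' hm hm'.
  apply: le_trans (indexP (has j) hm hm') _.
  by rewrite lee_fin ler_pXn2r ?nnegrE ?half_mono// ltW// halving_gt0.
pose u k w := U k (w, b).
have mu k : measurable_fun setT (u k) by exact: (measurableT_comp (mU k) (measurable_pair2 b)).
have Lb : measurable_fun setT (fun w => L (w, b)) by exact: (measurableT_comp mL (measurable_pair2 b)).
have fast k : (sqint PW (u k.+1 \- u k) <= (halving R k ^+ 2)%:E)%E.
  by have := close k _ (index_mono _ _ (leqnSn k)); rewrite DC.
have uL : {ae PW, forall w, u k w @[k --> \oo] --> L (w, b)}.
  apply: filterS (fast_cauchy_cvg mu fast) => w /cvg_ex[l ul].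
  have ulE : (u k w)%:E @[k --> \oo] --> l%:E by apply: cvg_EFin; [exact: nearW|].
  by rewrite /L (cvg_limn_einf_sup ulE).2.
(* All later members of the subsequence are within [halving R k] of the k-th one, and Fatou passes
   this to the pointwise limit. *)
have ukL k : (sqint PW (u k \- (fun w => L (w, b))) <= (halving R k ^+ 2)%:E)%E.
  have uL' : {ae PW, forall w, u (j + k)%N w @[j --> \oo] --> L (w, b)}.
    by apply: filterS uL => w; rewrite -(cvg_shiftn k).
  apply: (sqint_fatou (mu k) Lb (fun j => mu (j + k)%N) uL') => j.
  exact: (close k _ (index_mono _ _ (leq_addl j k))).
apply/ge0_cvg0P => [n|e e0]; first exact: sqint_ge0.
(* Both terms of the triangle inequality carry a factor 2, so 4 e / 5 in total stays strictly below
   e. *)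
have e4 : 0 < e / 5 by rewrite divr_gt0.
have [k hk] : exists k, halving R k ^+ 2 <= e / 5.
  have h2 : halving R k ^+ 2 @[k --> \oo] --> 0.
    rewrite -[X in _ --> X](mulr0 (0 : R)); under eq_fun do rewrite expr2.
    by apply: cvgM; exact: halving_cvg0.
  have [k _ hk] := cvgr_lt 0 h2 _ e4.
  by exists k; apply: ltW; apply: (hk k) => /=.
near=> n; apply: (@le_lt_trans _ _ (2%:E * sqint PW (slice n b \- u k) +
    2%:E * sqint PW (u k \- (fun w => L (w, b))))%E).
  by apply: (@sqint_sub_tri _ _ _ PW (slice n b) (u k) (fun w => L (w, b))).
have h1 : (sqint PW (slice n b \- u k) <= (e / 5)%:E)%E.
  have kn : (index k b <= n)%N by near: n; exists (index k b).
  by have := close k n kn; rewrite DC => /le_trans; apply; rewrite lee_fin.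
have h2 : (sqint PW (u k \- (fun w => L (w, b))) <= (e / 5)%:E)%E.
  by apply: le_trans (ukL k) _; rewrite lee_fin.
apply: (@le_lt_trans _ _ (2%:E * (e / 5)%:E + 2%:E * (e / 5)%:E)%E).
  by apply: leeD; apply: lee_wpmul2l.
by rewrite -!EFinM -EFinD lte_fin; lra.
Unshelve. all: by end_near. Qed.

End joint_limit.

(** * The limiting functional *)

Section wiener_sequences.
Context {R : realType} (d : nat).
Variables (H0 : R) (H : 'I_d -> R).
Hypotheses (hH0 : 2^-1 < H0 < 1) (hH : forall i, 2^-1 < H i < 1).
Context dO (Omega : measurableType dO) (P : probability Omega R).
Variable W : R -> d.-tuple R -> {RV P >-> R}.
Hypothesis hW : fractional_brownian_sheet H0 H W.
Local Notation spacetime := (measurableTypeR R * d.-tuple R)%type.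
Local Notation inner := (innerH H0 H).
Implicit Types phi psi : spacetime -> R.

Lemma step_integral_cauchy u phi (e : R) : stepcvg u phi -> 0 < e -> exists N : nat,
  forall n m : nat, (N <= n)%N -> (N <= m)%N ->
  (sqint P (step_integral W (u n) \- step_integral W (u m)) <= e%:E)%E.
Proof.
move=> uphi e0; have aphi : approximable phi by exists u.
have e4 : 0 < e / 4 by rewrite divr_gt0.
have cv := stepcvg_calH hH0 hH uphi.
have [N _ HN] := cvgr_lt 0 cv _ e4; exists N => n m Nn Nm.
rewrite (@eq_sqint _ _ _ P _ (step_integral W (step_lin (-1) (u n) (u m)))); last first.
  by move=> w; rewrite /= step_integral_lin mulN1r.
rewrite (sqint_step_integral hH0 hH hW) step_fun_lin -sub_linE lee_fin.
have an : approximable (step_fun (u n)) by exact: approximable_step.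
have am : approximable (step_fun (u m)) by exact: approximable_step.
have ad : approximable (fun p => step_fun (u n) p - step_fun (u m) p).
  by rewrite sub_linE; exact: approximable_lin.
have ap : approximable (fun p => step_fun (u n) p - phi p).
  by rewrite sub_linE; exact: approximable_lin.
(* With parameter 1 this compares u n - u m to u n - phi, the remainder being phi - u m: twice two
   energies below e / 4. *)
have := inner_young hH0 hH hW ad ap ltr01.
have -> : (fun p => step_fun (u n) p - step_fun (u m) p - (step_fun (u n) p - phi p)) =
    (fun p => phi p - step_fun (u m) p) by apply/funext => p; ring.
rewrite (inner_subC hH0 hH aphi am) invr1.
have := HN n Nn; have := HN m Nm; rewrite /=; lra.
Qed.

Lemma wiener_limit u phi X : stepcvg u phi -> measurable_fun setT X ->
  sqint P (step_integral W (u n) \- X) @[n --> \oo] --> 0%E ->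
  is_wiener_integral H0 H W phi X.
Proof.
move=> uphi mX uX.
have mu n := Lfun2_measurable (step_integral_Lfun2 hW (u n)).
have uoo n : (sqint P (step_integral W (u n)) < +oo)%E by exact/Lfun2P/(step_integral_Lfun2 hW).
split.
- exact: (stepcvg_in_calH hH0 hH uphi).
- by apply/Lfun2P => //; have [] := sqint_cvg mu mX uoo uX.
- by exists u; [exact: (stepcvg_calH hH0 hH uphi)|apply/Lnorm2_cvg0].
Qed.

(** The difference is a Wiener integral of phi - psi, so its second moment is its Gaussian variance.
    The cross terms are left unsymmetrized, since both are limits of the same kind. *)
Lemma wiener_distance phi psi X Y : approximable phi -> approximable psi ->
  is_wiener_integral H0 H W phi X -> is_wiener_integral H0 H W psi Y ->
  sqint P (X \- Y) =
  (inner phi phi - (inner phi psi + inner psi phi) + inner psi psi)%:E.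
Proof.
move=> aphi apsi wX wY.
have ad : approximable (fun p => phi p - psi p) by rewrite sub_linE; exact: approximable_lin.
rewrite (gaussian_sqint (wiener_gaussian hH0 hH hW ad (wiener_sub hH0 hH hW aphi apsi wX wY))).
rewrite sub_linE (inner_quad hH0 hH); [|exact: approximable_controllable|exact: approximable_controllable].
by congr EFin; ring.
Qed.

End wiener_sequences.

Section product_square_integral.
Context d1 d2 (T1 : measurableType d1) (T2 : measurableType d2) (R : realType).
Variables (P1 : probability T1 R) (P2 : probability T2 R).

Lemma sqint_product (f : T1 * T2 -> R) : measurable_fun setT f ->
  (sqint (P1 \x P2)%E f = \int[P2]_y sqint P1 (fun x => f (x, y)))%E.
Proof.
move=> mf; apply: (@fubini_tonelli2 _ _ _ _ R P1 P2 (fun z => ((f z) ^+ 2)%:E)).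
  exact: measurable_sqr.
by move=> z; rewrite lee_fin sqr_ge0.
Qed.

Lemma measurable_sqint_slice (f : T1 * T2 -> R) : measurable_fun setT f ->
  measurable_fun setT (fun y => sqint P1 (fun x => f (x, y))).
Proof.
move=> mf; apply: (@measurable_fun_fubini_tonelli_G _ _ _ _ R P1 (fun z => ((f z) ^+ 2)%:E)).
  exact: measurable_sqr.
by move=> z; rewrite lee_fin sqr_ge0.
Qed.

End product_square_integral.

(** * The approximating functionals on the product space *)

Section approximating_functionals.
Context (R : realType) (d : nat) (H0 : R) (H : 'I_d -> R).
Hypotheses (hH0 : 2^-1 < H0 < 1) (hH : forall i, 2^-1 < H i < 1).
Hypothesis hsum : d%:R + 1 < 2 * H0 + \sum_(i < d) H i.
Context dW dB (OmegaW : measurableType dW) (OmegaB : measurableType dB).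
Context (PW : probability OmegaW R) (PB : probability OmegaB R).
Variable W : R -> d.-tuple R -> {RV PW >-> R}.
Hypothesis hW : fractional_brownian_sheet H0 H W.
Variable B : 'I_d -> R -> {RV PB >-> R}.
Hypothesis hB : standard_brownian_motion B.
Variables (t : R) (x : d.-tuple R).
Hypothesis t0 : 0 < t.
Variable b : OmegaB -> 'I_d -> R -> R.
Hypothesis cb : forall w i, continuous (b w i).
Hypothesis jb : forall i, measurable_fun [set: OmegaB * R] (fun ws => b ws.1 i ws.2).
Hypothesis bB : {ae PB, forall w, forall i s, 0 <= s -> b w i s = B i s w}.
Local Notation mu := (@lebesgue_measure R).
Local Notation mu2 := (prodm mu mu).
Local Notation inner := (innerH H0 H).
Local Notation A w e dd := (approx_fun (b w) t x e dd).
Local Notation energy w := (path_energy H0 H t (b w)).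
Implicit Types (e dd : R) (w : OmegaB).

Let mbw w i : measurable_fun setT (b w i).
Proof. exact: continuous_measurable_fun. Qed.

Let bounded_path w : exists m, forall i s, 0 <= s <= t -> `|b w i s + tnth x i| <= m.
Proof.
have h i : exists m, forall s, 0 <= s <= t -> `|b w i s + tnth x i| <= m.
  apply: continuous_bounded_segment => s; apply: cvgD; [exact: cb|exact: cvg_cst].
have [m mP] := choice h; exists (\sum_(i < d) `|m i|) => i s st.
apply: (le_trans (mP i s st)); apply: (le_trans (ler_norm _)).
by rewrite (bigD1 i)//= lerDl sumr_ge0.
Qed.

Let grid_cvg w e dd : 0 < e -> 0 < dd -> stepcvg (grid_step t0 (A w e dd)) (A w e dd).
Proof.
move=> e0 dd0; have [m bm] := bounded_path w.
have [C C0 cA] := approx_fun_controlled t0 e0 dd0 (mbw w) bm.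
apply: (stepcvg_grid t0 C0 _ cA); first by rewrite mulr_gt0.
by move=> p p'; exact: approx_fun_cvg.
Qed.

Let approximable_A w e dd : 0 < e -> 0 < dd -> approximable (A w e dd).
Proof. by move=> e0 dd0; exists (grid_step t0 (A w e dd)); exact: grid_cvg. Qed.

Let A_funE w e dd : (forall i s, 0 <= s -> b w i s = B i s w) ->
  A_fun B t x e dd w = A w e dd.
Proof.
move=> bw; apply/funext => p; rewrite /A_fun /approx_fun.
case: (0 <= p.1 <= t); last exact: erefl.
apply: eq_Rintegral => s; rewrite inE/= in_itv/= => /andP[s0 _].
congr (_ * heat_kernel _ _).
by apply: eq_from_tnth => i; rewrite !tnth_mktuple bw.
Qed.

Lemma A_fun_approximable e dd w : 0 < e -> 0 < dd ->
  (forall i s, 0 <= s -> b w i s = B i s w) -> approximable (A_fun B t x e dd w).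
Proof. by move=> e0 dd0 bw; rewrite A_funE//; exact: approximable_A. Qed.

Lemma in_calH_A_fun e dd : 0 < e -> 0 < dd ->
  {ae PB, forall w, in_calH H0 H (A_fun B t x e dd w)}.
Proof.
move=> e0 dd0; apply: filterS bB => w bw; rewrite A_funE//.
exact: (stepcvg_in_calH hH0 hH (grid_cvg w e0 dd0)).
Qed.

(** A grid step integral is a finite sum of products of a function of the path of [B] and an
    increment of [W], hence jointly measurable; [joint_limit] keeps this in the limit. *)
Lemma V_approx_exists e dd : 0 < e -> 0 < dd ->
  exists V, is_V_approx H0 H W B t x e dd V.
Proof.
move=> e0 dd0.
pose V n (z : OmegaW * OmegaB) := step_integral W (grid_step t0 (A z.2 e dd) n) z.1.
have mV n : measurable_fun setT (V n).
  rewrite /V /step_integral /grid_step; under eq_fun do rewrite big_map.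
  apply: measurable_sum => kf; apply: measurable_funM.
    have mp : measurable_fun setT (fun w => A w e dd (grid_point t n kf.1 (fun i => kf.2 i))).
      by apply: measurable_approx => //; exact: measurable_cst.
    exact: (measurableT_comp mp measurable_snd).
  have mi := Lfun2_measurable (increment_Lfun2 hW (grid_rect t0 n kf.1 (fun i => kf.2 i))).
  exact: (measurableT_comp mi measurable_fst).
have [|L mL VL] := joint_limit (PW := PW) (PB := PB) mV.
  by apply: aeW => w r r0; exact: (step_integral_cauchy hH0 hH hW (grid_cvg w e0 dd0) r0).
exists L; split => //; apply: filterS2 bB VL => w bw VLw; rewrite A_funE//.
apply: (wiener_limit hH0 hH hW (grid_cvg w e0 dd0)) => //.
exact: (measurableT_comp mL (measurable_pair2 w)).
Qed.

Definition regular w : Prop :=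
  [/\ forall i s, 0 <= s -> b w i s = B i s w, (energy w < +oo)%E &
      mu2.-negligible [set z : R * R |
        (0 <= z.1 <= t) /\ (0 <= z.2 <= t) /\ exists i, b w i z.1 = b w i z.2]].

Lemma regular_ae : {ae PB, forall w, regular w}.
Proof.
have h1 := brownian_energy_lty hB jb bB hH hsum t0.
have h2 := brownian_separated hB jb bB t.
by apply: filterS3 bB h1 h2 => w ? ? ?; split.
Qed.

Let energy_ge0 w : (0 <= energy w)%E.
Proof. by apply: integral_ge0 => z _; rewrite lee_fin square_path_kernel_ge0. Qed.

Lemma regular_inner_cvg w (e1 d1 e2 d2 : nat -> R) : regular w ->
  (forall n, 0 < e1 n) -> (forall n, 0 < d1 n) -> (forall n, 0 < e2 n) -> (forall n, 0 < d2 n) ->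
  e1 @ \oo --> 0 -> d1 @ \oo --> 0 -> e2 @ \oo --> 0 -> d2 @ \oo --> 0 ->
  inner (A_fun B t x (e1 n) (d1 n) w) (A_fun B t x (e2 n) (d2 n) w) @[n --> \oo] -->
  alphaH H0 H * fine (energy w).
Proof.
move=> [bw en sep] e10 d10 e20 d20 e1c d1c e2c d2c; have [m bm] := bounded_path w.
under eq_fun do rewrite !(A_funE _ _ bw).
exact: (approx_inner_cvg hH0 hH t0 (mbw w) bm en sep).
Qed.

Lemma regular_sqint_cvg w (e1 d1 e2 d2 : nat -> R) (X Y : nat -> OmegaW -> R) : regular w ->
  (forall n, 0 < e1 n) -> (forall n, 0 < d1 n) -> (forall n, 0 < e2 n) -> (forall n, 0 < d2 n) ->
  e1 @ \oo --> 0 -> d1 @ \oo --> 0 -> e2 @ \oo --> 0 -> d2 @ \oo --> 0 ->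
  (forall n, is_wiener_integral H0 H W (A_fun B t x (e1 n) (d1 n) w) (X n)) ->
  (forall n, is_wiener_integral H0 H W (A_fun B t x (e2 n) (d2 n) w) (Y n)) ->
  sqint PW (X n \- Y n) @[n --> \oo] --> 0%E.
Proof.
move=> rw e10 d10 e20 d20 e1c d1c e2c d2c wX wY; have [bw _ _] := rw.
have eq n := wiener_distance hH0 hH hW (A_fun_approximable (e10 n) (d10 n) bw)
  (A_fun_approximable (e20 n) (d20 n) bw) (wX n) (wY n).
under eq_fun do rewrite eq.
apply: cvg_EFin; first exact: nearW.
set l := alphaH H0 H * fine (energy w).
rewrite -[X in _ --> X](_ : l - (l + l) + l = 0); last by ring.
by apply: cvgD; [apply: cvgB; [|apply: cvgD]|]; exact: regular_inner_cvg.
Qed.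

Lemma regular_sqint_le w e dd X : regular w -> 0 < e -> 0 < dd ->
  is_wiener_integral H0 H W (A_fun B t x e dd w) X ->
  (sqint PW X <= (alphaH H0 H * smear_bound H0 H * fine (energy w))%:E)%E.
Proof.
move=> [bw en sep] e0 dd0; rewrite (A_funE _ _ bw) => wX.
have [m bm] := bounded_path w.
rewrite (gaussian_sqint (wiener_gaussian hH0 hH hW (approximable_A w e0 dd0) wX)) lee_fin -mulrA.
exact: (approx_inner_le hH0 hH t0 (mbw w) bm en sep).
Qed.

Definition inv_succ (n : nat) : R := n.+1%:R^-1.

Let inv_succ_gt0 n : 0 < inv_succ n. Proof. by rewrite invr_gt0. Qed.

Let inv_succ_cvg (f : nat -> nat) : (forall n, (n <= f n)%N) -> inv_succ (f n) @[n --> \oo] --> 0.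
Proof.
move=> nf; apply: (@squeeze_cvgr _ _ _ _ (cst 0) inv_succ); last 2 first.
- exact: cvg_cst.
- exact: cvg_harmonic.
by apply: nearW => n; rewrite (ltW (inv_succ_gt0 _))/= lef_pV2 ?posrE// ler_nat ltnS.
Qed.

(** The distances are controlled only along sequences of parameters. A failure of the Cauchy
    property would give two index sequences tending to infinity with distances above r, against
    [regular_sqint_cvg]. *)
Lemma regular_cauchy w (V : nat -> OmegaW * OmegaB -> R) : regular w ->
  (forall n, is_wiener_integral H0 H W (A_fun B t x (inv_succ n) (inv_succ n) w)
     (fun wW => V n (wW, w))) ->
  slicewise_cauchy PW V w.
Proof.
move=> rw wV r r0; apply: contrapT => /forallNP h.
have ex N : exists nm : nat * nat, [/\ (N <= nm.1)%N, (N <= nm.2)%N &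
    ~ (sqint PW (fun wW => V nm.1 (wW, w) - V nm.2 (wW, w))%R <= r%:E)%E].
  by have /existsNP[n /existsNP[k /not_implyP[Nn /not_implyP[Nk hk]]]] := h N; exists (n, k).
have [f fP] := choice ex.
have c1 : inv_succ (f n).1 @[n --> \oo] --> 0 by apply: inv_succ_cvg => n; case: (fP n).
have c2 : inv_succ (f n).2 @[n --> \oo] --> 0 by apply: inv_succ_cvg => n; case: (fP n).
have := regular_sqint_cvg rw (fun n => inv_succ_gt0 (f n).1) (fun n => inv_succ_gt0 (f n).1)
  (fun n => inv_succ_gt0 (f n).2) (fun n => inv_succ_gt0 (f n).2) c1 c1 c2 c2
  (fun n => wV (f n).1) (fun n => wV (f n).2).
move/(ge0_cvg0P (fun n => sqint_ge0 PW _)) => /(_ r r0)[N _ HN].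
by have [_ _] := fP N; apply; exact: ltW (HN N (leqnn N)).
Qed.

(** The limit is determined by the diagonal eps = delta = 1 / (n + 1); that other parameters and
    other versions lead to it is shown afterwards. *)
Lemma joint_functional_exists : exists V : OmegaW * OmegaB -> R,
  measurable_fun setT V /\ exists Vn : nat -> OmegaW * OmegaB -> R,
    (forall n, is_V_approx H0 H W B t x (inv_succ n) (inv_succ n) (Vn n)) /\
    {ae PB, forall w, sqint PW (fun wW => Vn n (wW, w) - V (wW, w)) @[n --> \oo] --> 0%E}.
Proof.
have [Vn VnP] := choice (fun n => V_approx_exists (inv_succ_gt0 n) (inv_succ_gt0 n)).
have mV n : measurable_fun setT (Vn n) by case: (VnP n).
have wV : {ae PB, forall w, forall n, is_wiener_integral H0 H W
    (A_fun B t x (inv_succ n) (inv_succ n) w) (fun wW => Vn n (wW, w))}.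
  by apply/ae_foralln => n; case: (VnP n).
have [|L mL VL] := joint_limit (PW := PW) (PB := PB) mV.
  by apply: filterS2 regular_ae wV => w; exact: regular_cauchy.
by exists L; split => //; exists Vn.
Qed.

End approximating_functionals.

(** * Law of the limit and convergence of the whole family *)

Section limit_functional.
Context (R : realType) (d : nat) (H0 : R) (H : 'I_d -> R).
Hypotheses (hH0 : 2^-1 < H0 < 1) (hH : forall i, 2^-1 < H i < 1).
Hypothesis hsum : d%:R + 1 < 2 * H0 + \sum_(i < d) H i.
Context dW dB (OmegaW : measurableType dW) (OmegaB : measurableType dB).
Context (PW : probability OmegaW R) (PB : probability OmegaB R).
Variable W : R -> d.-tuple R -> {RV PW >-> R}.
Hypothesis hW : fractional_brownian_sheet H0 H W.
Variable B : 'I_d -> R -> {RV PB >-> R}.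
Hypothesis hB : standard_brownian_motion B.
Variables (t : R) (x : d.-tuple R).
Hypothesis t0 : 0 < t.
Variable b : OmegaB -> 'I_d -> R -> R.
Hypothesis cb : forall w i, continuous (b w i).
Hypothesis jb : forall i, measurable_fun [set: OmegaB * R] (fun ws => b ws.1 i ws.2).
Hypothesis bB : {ae PB, forall w, forall i s, 0 <= s -> b w i s = B i s w}.
Variables (V : OmegaW * OmegaB -> R) (Vn : nat -> OmegaW * OmegaB -> R).
Hypothesis mV : measurable_fun setT V.
Hypothesis VnP : forall n, is_V_approx H0 H W B t x (inv_succ R n) (inv_succ R n) (Vn n).
Hypothesis VnV : {ae PB, forall w,
  sqint PW (fun wW => Vn n (wW, w) - V (wW, w)) @[n --> \oo] --> 0%E}.
Local Notation mu := (@lebesgue_measure R).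
Local Notation energy w := (path_energy H0 H t (b w)).

Let energy_ge0 w : (0 <= energy w)%E.
Proof. by apply: integral_ge0 => z _; rewrite lee_fin square_path_kernel_ge0. Qed.

Let inv_succ_gt0 n : 0 < inv_succ R n. Proof. by rewrite invr_gt0. Qed.

Definition typical w : Prop := [/\ regular H0 H B t b w,
  forall n, is_wiener_integral H0 H W (A_fun B t x (inv_succ R n) (inv_succ R n) w)
    (fun wW => Vn n (wW, w)) &
  sqint PW (fun wW => Vn n (wW, w) - V (wW, w)) @[n --> \oo] --> 0%E].

Lemma typical_ae : {ae PB, forall w, typical w}.
Proof.
have h1 := regular_ae hH hsum hB t0 jb bB.
have h2 : {ae PB, forall w, forall n, is_wiener_integral H0 H W
    (A_fun B t x (inv_succ R n) (inv_succ R n) w) (fun wW => Vn n (wW, w))}.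
  by apply/ae_foralln => n; case: (VnP n).
by apply: filterS3 h1 h2 VnV => w ? ? ?; split.
Qed.

Let mVw w : measurable_fun setT (fun wW => V (wW, w)).
Proof. exact: (measurableT_comp mV (measurable_pair2 w)). Qed.

(** The second moments along the diagonal sequence converge to that of the slice of [V] and also to
    the energy of the path, so uniqueness of limits identifies the variance. *)
Lemma limit_slice w : typical w ->
  is_gaussian PW (fun wW => V (wW, w)) 0 (alphaH H0 H * fine (energy w)).
Proof.
move=> [rw wV cV]; have [bw en sep] := rw.
have gV n := wiener_gaussian hH0 hH hW (A_fun_approximable x t0 cb (inv_succ_gt0 n) (inv_succ_gt0 n) bw) (wV n).
have := gaussian_limit gV (mVw w) cV.
suff -> : fine (sqint PW (fun wW => V (wW, w))) = alphaH H0 H * fine (energy w) by [].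
have mVn n : measurable_fun setT (fun wW => Vn n (wW, w)) by case: (gV n).
have fin n : (sqint PW (fun wW => Vn n (wW, w)) < +oo)%E by rewrite (gaussian_sqint (gV n)) ltry.
have [_ cv] := sqint_cvg mVn (mVw w) fin cV.
have cv2 := regular_inner_cvg hH0 hH x t0 cb rw inv_succ_gt0 inv_succ_gt0 inv_succ_gt0 inv_succ_gt0
  (@cvg_harmonic R) (@cvg_harmonic R) (@cvg_harmonic R) (@cvg_harmonic R).
apply: (cvg_unique _ cv) => //.
by apply: cvg_trans cv2; apply: near_eq_cvg; apply: nearW => n; rewrite (gaussian_sqint (gV n)).
Qed.

Let integrable_energy (c : R) : PB.-integrable setT (fun w => c%:E * energy w)%E.
Proof.
apply: integrableZl => //; apply/integrableP; split; first exact: (measurable_path_energy jb).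
under eq_integral => w _ do rewrite gee0_abs//.
exact: (expected_energy hB jb bB hH hsum t0).
Qed.

Lemma Lfun2_product (f : OmegaW * OmegaB -> R) (c : R) : measurable_fun setT f -> 0 <= c ->
  {ae PB, forall w, (sqint PW (fun wW => f (wW, w)) <= c%:E * energy w)%E} ->
  f \in Lfun (PW \x PB)%E 2%:E.
Proof.
move=> mf c0 fc; apply/Lfun2P => //; rewrite sqint_product//.
apply: (@le_lt_trans _ _ (\int[PB]_w (c%:E * energy w))%E).
  apply: ae_ge0_le_integral => //.
  - by move=> w _; exact: sqint_ge0.
  - exact: measurable_sqint_slice.
  - by move=> w _; rewrite mule_ge0.
  - exact: (measurable_int _ (integrable_energy c)).
  - by apply: filterS fc => w h _.
have /integrableP[_] := integrable_energy c.
by under eq_integral => w _ do rewrite gee0_abs ?mule_ge0//.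
Qed.

Let fine_energy (c : R) w : (energy w < +oo)%E -> ((c * fine (energy w))%:E = c%:E * energy w)%E.
Proof. by move=> en; rewrite EFinM fineK// ge0_fin_numE. Qed.

Let a0 : 0 <= alphaH H0 H. Proof. exact: ltW (alphaH_gt0 hH0 hH). Qed.

Let S0 : 0 <= alphaH H0 H * smear_bound H0 H.
Proof. by rewrite mulr_ge0// smear_bound_ge0. Qed.

Lemma limit_Lfun2 : V \in Lfun (PW \x PB)%E 2%:E.
Proof.
apply: (Lfun2_product mV a0); apply: filterS typical_ae => w tw.
have [[_ en _] _ _] := tw.
by rewrite (gaussian_sqint (limit_slice tw)) fine_energy.
Qed.

Lemma approx_Lfun2 e dd U : 0 < e -> 0 < dd -> is_V_approx H0 H W B t x e dd U ->
  U \in Lfun (PW \x PB)%E 2%:E.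
Proof.
move=> e0 dd0 [mU wU]; apply: (Lfun2_product mU S0).
apply: filterS2 typical_ae wU => w [rw _ _] wUw; have [_ en _] := rw.
by rewrite -fine_energy//; exact: (regular_sqint_le hH0 hH hW t0 cb rw e0 dd0 wUw).
Qed.

(** For a typical path the distance to [V] is split at the diagonal versions [Vn], where both parts
    tend to 0. The squared distance is at most a multiple of the energy, which is integrable over
    the paths, so domination gives convergence on the product space. *)
Lemma approx_cvg_sequence (e dd : nat -> R) (U : nat -> OmegaW * OmegaB -> R) :
  (forall n, 0 < e n) -> (forall n, 0 < dd n) -> e @ \oo --> 0 -> dd @ \oo --> 0 ->
  (forall n, is_V_approx H0 H W B t x (e n) (dd n) (U n)) ->
  sqint (PW \x PB)%E (U n \- V) @[n --> \oo] --> 0%E.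
Proof.
move=> e0 dd0 ec ddc UP.
have mU n : measurable_fun setT (U n) by case: (UP n).
have mD n : measurable_fun setT (U n \- V) by exact: measurable_funB.
have wU : {ae PB, forall w, forall n, is_wiener_integral H0 H W
    (A_fun B t x (e n) (dd n) w) (fun wW => U n (wW, w))}.
  by apply/ae_foralln => n; case: (UP n).
have mUw n w : measurable_fun setT (fun wW => U n (wW, w)).
  exact: (measurableT_comp (mU n) (measurable_pair2 w)).
have mVnw n w : measurable_fun setT (fun wW => Vn n (wW, w)).
  have mVn : measurable_fun setT (Vn n) by case: (VnP n).
  exact: (measurableT_comp mVn (measurable_pair2 w)).
have gc := @cvg_harmonic R.
(* From [sqintB2]: twice the uniform bound on the approximations plus twice the variance of the
   limit. *)
pose c : R := 2 * (alphaH H0 H * smear_bound H0 H) + 2 * alphaH H0 H.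
have ae1 : {ae PB, forall w, setT w -> sqint PW (fun wW => (U n \- V) (wW, w)) @[n --> \oo] --> 0%E}.
  apply: filterS2 typical_ae wU => w [rw wVn cV] wUw _.
  apply: (@squeeze_cvge _ _ _ _ (cst 0%E) _ (fun n =>
    2%:E * sqint PW ((fun wW => U n (wW, w)) \- (fun wW => Vn n (wW, w))) +
    2%:E * sqint PW (fun wW => (Vn n (wW, w) - V (wW, w))%R))%E).
  - apply: nearW => n; rewrite sqint_ge0/=.
    exact: (@sqint_sub_tri _ _ _ PW (fun wW => U n (wW, w)) (fun wW => Vn n (wW, w)) (fun wW => V (wW, w))).
  - exact: cvg_cst.
  - apply: cvge0_double => //.
    exact: (regular_sqint_cvg hH0 hH hW t0 cb rw e0 dd0 inv_succ_gt0 inv_succ_gt0 ec ddc gc gc wUw wVn).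
have ae2 : {ae PB, forall w n, setT w ->
    (`|sqint PW (fun wW => (U n \- V)%R (wW, w))| <= c%:E * energy w)%E}.
  apply: filterS2 typical_ae wU => w tw wUw n _; have [rw _ _] := tw; have [_ en _] := rw.
  rewrite gee0_abs ?sqint_ge0//.
  apply: le_trans (@sqintB2 _ _ _ PW (fun wW => U n (wW, w)) (fun wW => V (wW, w)) (mUw n w) (mVw w)) _.
  rewrite -fine_energy// (gaussian_sqint (limit_slice tw)).
  apply: le_trans (leeD (lee_wpmul2l _ (regular_sqint_le hH0 hH hW t0 cb rw (e0 n) (dd0 n) (wUw n))) (le_refl _)) _ => //.
  by rewrite -!EFinM -EFinD lee_fin le_eqVlt; apply/orP; left; apply/eqP; rewrite /c; ring.
under eq_fun do rewrite sqint_product//.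
have := @dominated_convergence _ _ R PB _ measurableT
  (fun n w => sqint PW (fun wW => (U n \- V) (wW, w))) (cst 0%E) _
  (fun n => measurable_sqint_slice PW (mD n)) (measurable_cst _) ae1 (integrable_energy c) ae2.
by move=> [_ _]; rewrite integral0.
Qed.

(** If the convergence failed, each square ]0, 1 / (n + 1)]^2 would contain parameters at which the
    squared distance is at least r; along the sequence so chosen [approx_cvg_sequence] gives a
    contradiction. *)
Lemma approx_cvg_family (U : R -> R -> OmegaW * OmegaB -> R) :
  (forall e dd, 0 < e -> 0 < dd -> is_V_approx H0 H W B t x e dd (U e dd)) ->
  'N[(PW \x PB)%E]_2%:E[EFin \o (U p.1 p.2 \- V)%R]%E @[p --> filter_prod 0^'+ 0^'+] --> 0%E.
Proof.
move=> UP; apply/Lnorm2_cvg0; apply/ge0_cvg0P => [p|r r0]; first exact: sqint_ge0.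
apply: contrapT => nn.
have ex n : exists p : R * R, [/\ 0 < p.1 <= inv_succ R n, 0 < p.2 <= inv_succ R n &
    ~ (sqint (PW \x PB)%E (U p.1 p.2 \- V) < r%:E)%E].
  apply: contrapT => /forallNP h; apply: nn.
  exists ([set y : R | 0 < y <= inv_succ R n], [set y : R | 0 < y <= inv_succ R n]) => /=.
    by split; near=> y; apply/andP; split; near: y; [exact: nbhs_right_gt|exact: nbhs_right_le|exact: nbhs_right_gt|exact: nbhs_right_le].
  by move=> p [p1 p2]; apply: contrapT => np; exact: (h p).
have [p pP] := choice ex.
have cv (f : nat -> R) : (forall n, 0 < f n <= inv_succ R n) -> f @ \oo --> 0.
  move=> fn; apply: (@squeeze_cvgr _ _ _ _ (cst 0) (inv_succ R)).
  - by apply: nearW => n; have /andP[/ltW -> ->] := fn n.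
  - exact: cvg_cst.
  - exact: cvg_harmonic.
have p1 n : 0 < (p n).1 <= inv_succ R n by case: (pP n).
have p2 n : 0 < (p n).2 <= inv_succ R n by case: (pP n).
have p10 n : 0 < (p n).1 by have /andP[] := p1 n.
have p20 n : 0 < (p n).2 by have /andP[] := p2 n.
have := approx_cvg_sequence p10 p20 (cv _ p1) (cv _ p2) (fun n => UP _ _ (p10 n) (p20 n)).
move/(ge0_cvg0P (fun n => sqint_ge0 (PW \x PB)%E _)) => /(_ r r0)[N _ HN].
by have [_ _] := pP N; apply; exact: (HN N (leqnn N)).
Unshelve. all: by end_near. Qed.

(** The mean is 0, so the variance is the second moment. What remains is to pass from the energy of
    the modified path on the plane to the iterated integral over [0, t] for [B], with which the
    modification agrees at nonnegative times. *)
Lemma limit_variance w : typical w ->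
  is_gaussian PW (fun wW => V (wW, w)) 0 (fine 'V_PW[(fun wW => V (wW, w))]) /\
  'V_PW[(fun wW => V (wW, w))] = cond_variance H0 H B t w.
Proof.
move=> tw; have gV := limit_slice tw; have [[bw en _] _ _] := tw.
have V2 : (fun wW => V (wW, w)) \in Lfun PW 2%:E.
  by apply/Lfun2P; [exact: mVw|rewrite (gaussian_sqint gV) ltry].
have var : 'V_PW[(fun wW => V (wW, w))] = (alphaH H0 H * fine (energy w))%:E.
  rewrite varianceE// (gaussian_mean0 gV) -(gaussian_sqint gV).
  rewrite [X in (_ - X)%E](_ : _ = 0%E) ?sube0; last by rewrite expe2 mule0.
  by rewrite unlock; apply: eq_integral => wW _.
split; first by rewrite var.
rewrite var fine_energy// /cond_variance; congr (_ * _)%E.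
rewrite /path_energy (@ge0_integral_prodm1 _ _ _ _ R mu mu); last 2 first.
- by apply/measurable_EFinP; apply: measurable_path_kernel => i; exact: continuous_measurable_fun.
- by move=> z; rewrite lee_fin square_path_kernel_ge0.
rewrite [RHS]integral_mkcond; apply: eq_integral => r _; rewrite patchE.
case: ifPn => rt; last first.
  rewrite integral0_eq// => s _; rewrite /square_indic/= (_ : \1_`[0, t] r = 0) ?mul0r ?mul0r//.
  by rewrite indicE (negbTE rt).
rewrite [RHS]integral_mkcond; apply: eq_integral => s _; rewrite patchE /square_indic/=.
rewrite (_ : \1_`[0, t] r = 1) ?mul1r; last by rewrite indicE rt.
rewrite indicE; case: ifPn => st; last by rewrite mul0r.
rewrite mul1r /path_kernel/=; congr (_ * _)%:E; apply: eq_bigr => i _.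
move: rt st; rewrite !inE/= !in_itv/= => /andP[r0 _] /andP[s0 _].
by rewrite !bw.
Qed.

End limit_functional.

(** The independence of [W] and [B] is built into the product space, so conditioning on [B] means
    freezing [wB]. The existence of versions in the first part ensures that the quantification over
    [Veps] is not vacuous. *)
Theorem theorem3p1 (R : realType) (d : nat) (hd : (1 <= d)%N)
    (H0 : R) (H : 'I_d -> R)
    (hH0 : 2^-1 < H0 < 1) (hH : forall i, 2^-1 < H i < 1)
    (hsum : d%:R + 1 < 2 * H0 + \sum_(i < d) H i)
    (dW dB : measure_display)
    (OmegaW : measurableType dW) (OmegaB : measurableType dB)
    (PW : probability OmegaW R) (PB : probability OmegaB R)
    (W : R -> d.-tuple R -> {RV PW >-> R})
    (hW : fractional_brownian_sheet H0 H W)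
    (B : 'I_d -> R -> {RV PB >-> R})
    (hB : standard_brownian_motion B)
    (t : R) (ht : 0 < t) (x : d.-tuple R) :
  (forall eps delta : R, 0 < eps -> 0 < delta ->
     {ae PB, forall wB, in_calH H0 H (A_fun B t x eps delta wB)} /\
     exists V, is_V_approx H0 H W B t x eps delta V) /\
  exists V : OmegaW * OmegaB -> R,
    [/\ V \in Lfun (PW \x PB)%E 2%:E,
        forall Veps : R -> R -> OmegaW * OmegaB -> R,
          (forall eps delta, 0 < eps -> 0 < delta ->
             is_V_approx H0 H W B t x eps delta (Veps eps delta)) ->
          (forall eps delta, 0 < eps -> 0 < delta ->
             Veps eps delta \in Lfun (PW \x PB)%E 2%:E) /\
          'N[(PW \x PB)%E]_2%:E[EFin \o (Veps p.1 p.2 \- V)%R]%E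
            @[p --> filter_prod 0^'+ 0^'+] --> 0%E
      & {ae PB, forall wB,
          is_gaussian PW (fun wW => V (wW, wB)) 0
            (fine 'V_PW[(fun wW => V (wW, wB))]) /\
          'V_PW[(fun wW => V (wW, wB))] = cond_variance H0 H B t wB}].
Proof.
have [b [_ cb jb bB]] := brownian_modification hB.
split.
  move=> eps delta eps0 delta0; split.
    exact: (in_calH_A_fun hH0 hH x ht cb bB eps0 delta0).
  exact: (V_approx_exists hH0 hH hW x ht cb jb bB eps0 delta0).
have [V [mV [Vn [VnP VnV]]]] := joint_functional_exists hH0 hH hsum hW hB x ht cb jb bB.
exists V; split.
- exact: (limit_Lfun2 hH0 hH hsum hW hB ht cb jb bB mV VnP VnV).
- move=> Veps VP; split => [eps delta eps0 delta0|].
    exact: (approx_Lfun2 hH0 hH hsum hW hB ht cb jb bB VnP VnV eps0 delta0 (VP _ _ eps0 delta0)).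
  exact: (approx_cvg_family hH0 hH hsum hW hB ht cb jb bB mV VnP VnV VP).
- apply: filterS (typical_ae hH hsum hB ht jb bB VnP VnV) => w.
  exact: (limit_variance hH0 hH hW ht cb mV).
Qed.
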